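(* Let $J:\mathbb{R}^N\setminus\{0\}\to[0,\infty)$ be a measurable, even function ($J(-z)=J(z)$) satisfying $(J1)$ $\int_{\mathbb{R}^N\setminus B_1(0)}J(z)\,dz+\int_{B_1(0)}|z|^2J(z)\,dz<\infty$ and $\int_{\mathbb{R}^N}J(z)\,dz=\infty$; $(J2)$ for all $z'\in\mathbb{R}^{N-1}$ and $s,t\in\mathbb{R}$ with $|s|<|t|$ and $(s,z')\neq 0$ we have $J(s,z')>J(t,z')$. Let $\Omega\subset\mathbb{R}^N$ satisfy $(D)$ $\Omega$ is open and bounded, and for every $x\in\Omega$ and $s\in[-1,1]$ we have $(sx_1,x_2,\dots,x_N)\in\Omega$. Let $f$ satisfy $(F1)$ $f:\Omega\times\mathbb{R}\to\mathbb{R}$, $(x,u)\mapsto f(x,u)$, is a Carathéodory function such that for every bounded set $K\subset\mathbb{R}$ there exists $L=L(K)>0$ with $\sup_{x\in\Omega}|f(x,u)-f(x,v)|\le L|u-v|$ for all $u,v\in K$; $(F2)$ for every $u\in\mathbb{R}$, $x\in\Omega$ and $s\in[-1,1]$ we have $f(sx_1,x_2,\dots,x_N,u)\ge f(x,u)$. Then every nonnegative solution $u\in L^\infty(\Omega)\cap\mathcal{D}(\Omega)$ of $$(P)\qquad Iu=f(x,u)\ \text{ in }\Omega,\qquad u=0\ \text{ on }\mathbb{R}^N\setminus\Omega$$ is symmetric in $x_1$. Moreover, either $u\equiv0$ in $\mathbb{R}^N$, or $u$ is strictly decreasing in $|x_1|$ and therefore satisfies $\operatorname{ess\,inf}_K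 u>0$ for every compact set $K\subset\Omega$.
   Context: Functions are identified when they agree almost everywhere. For $J$ as in the claim, put $$\mathcal{J}(u,v)=\frac12\int_{\mathbb{R}^N}\int_{\mathbb{R}^N}(u(x)-u(y))(v(x)-v(y))J(x-y)\,dx\,dy,$$ $$\mathcal{D}(\Omega)=\{u:\mathbb{R}^N\to\mathbb{R}\text{ measurable}:\ \mathcal{J}(u,u)<\infty,\ u\equiv0\text{ on }\mathbb{R}^N\setminus\Omega\}.$$ $L^2(\Omega)$, $L^\infty(\Omega)$ are identified with the spaces of the corresponding functions on $\mathbb{R}^N$ vanishing on $\mathbb{R}^N\setminus\Omega$. $I$ is the self-adjoint operator on $L^2(\Omega)$ associated with $\mathcal{J}$; only the following weak notion of solution is used: $u\in\mathcal{D}(\Omega)$ is a solution of $(P)$ if for every $\varphi\in\mathcal{D}(\Omega)$ the integral $\int_\Omega f(x,u(x))\varphi(x)\,dx$ exists and $\mathcal{J}(u,\varphi)=\int_\Omega f(x,u(x))\varphi(x)\,dx$. Carathéodory: $f(\cdot,u)$ is measurable for every $u\in\mathbb{R}$ and $f(x,\cdot)$ is continuous for a.e. $x\in\Omega$. For measurable $u:\Omega\to\mathbb{R}$ with $\Omega$ satisfying $(D)$ (such functions being extended by $0$ outside $\Omega$): $u$ is symmetric in $x_1$ if $u(-x_1,x')=u(x_1,x')$ for a.e. $x=(x_1,x')\in\Omega$; $u$ is strictly decreasing in $|x_1|$ if for every $\lambda\in\mathbb{R}\setminus\{0\}$ and every compact set $K\subset\{x\in\Omega: x_1/\lambda>1\}$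 we have $\operatorname{ess\,inf}_{x\in K}[u(2\lambda-x_1,x_2,\dots,x_N)-u(x)]>0$. The essential infimum over a null set is $+\infty$. *)

(* Defs.v *)
From HB Require Import structures.
From mathcomp Require Import all_boot all_order all_algebra.
From mathcomp Require Import all_classical all_reals all_analysis ess_sup_inf.

Set Implicit Arguments.
Unset Strict Implicit.
Unset Printing Implicit Defensive.
Import Order.TTheory GRing.Theory Num.Theory.
Import numFieldNormedType.Exports.
Local Open Scope classical_set_scope.
Local Open Scope ring_scope.

(* R^N is 'rV[R]_n.+1 with N = n.+1, so that N >= 1. The norm that MathComp-Analysis
   puts on row vectors is the maximum norm; it is used below only through
   the topology and the bounded sets that it induces. *)

Section lebesgue.
Context (R : realType) (n : nat).
Implicit Types (a b : 'rV[R]_n.+1) (A : set 'rV[R]_n.+1).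
Local Open Scope ereal_scope.

Definition box a b : set 'rV[R]_n.+1 :=
  [set x | forall i, (a ord0 i <= x ord0 i <= b ord0 i)%R].

Definition box_vol a b : R := (\prod_(i < n.+1) (b ord0 i - a ord0 i))%R.

Definition box_cover A : set (nat -> 'rV[R]_n.+1 * 'rV[R]_n.+1) :=
  [set B : nat -> 'rV[R]_n.+1 * 'rV[R]_n.+1 | (forall k i, ((B k).1 ord0 i <= (B k).2 ord0 i)%R) /\
           A `<=` \bigcup_k box (B k).1 (B k).2].

Definition lebesgue_outer A : \bar R :=
  ereal_inf [set \sum_(k <oo) (box_vol (B k).1 (B k).2)%:E | B in box_cover A].

Lemma box_vol_ge0 a b : (forall i, (a ord0 i <= b ord0 i)%R) ->
  0 <= (box_vol a b)%:E.
Proof. by move=> ab; rewrite lee_fin prodr_ge0// => i _; rewrite subr_ge0. Qed.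

Lemma lebesgue_outer_ge0 A : 0 <= lebesgue_outer A.
Proof.
apply: le_ereal_inf_tmp => _ [B [B_le _] <-].
by apply: nneseries_ge0 => k _ _; exact: box_vol_ge0.
Qed.

Lemma lebesgue_outer0 : lebesgue_outer set0 = 0.
Proof.
apply/eqP; rewrite eq_le lebesgue_outer_ge0 andbT.
apply: ereal_inf_lbound; exists (fun=> (0%R, 0%R)); first by split.
apply: eseries0 => k _ _ /=.
by rewrite /box_vol (bigD1 ord0)//= subrr mul0r.
Qed.

Lemma le_lebesgue_outer : {homo lebesgue_outer : A B / A `<=` B >-> A <= B}.
Proof.
move=> A A' AA'; apply/ereal_inf_le_tmp => _ [B [B_le A'B] <-].
by exists B => //; split => //; exact: subset_trans A'B.
Qed.

Lemma lebesgue_outer_sigma_subadditive : sigma_subadditive lebesgue_outer.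
Proof.
move=> A; have [[i ioo]|] := pselect (exists i, lebesgue_outer (A i) = +oo).
  rewrite (eseries_pinfty _ _ ioo) ?leey// => k _.
  by rewrite -ltNye (lt_le_trans _ (lebesgue_outer_ge0 _)).
rewrite -forallNE => Aoo.
apply/lee_addgt0Pr => _/posnumP[e].
rewrite (le_trans _ (epsilon_trick _ _ _))//; last first.
  by move=> k; exact: lebesgue_outer_ge0.
pose v (B : nat -> 'rV[R]_n.+1 * 'rV[R]_n.+1) k := (box_vol (B k).1 (B k).2)%:E.
pose P k B := box_cover (A k) B /\
  \sum_(j <oo) v B j <= lebesgue_outer (A k) + (e%:num / (2 ^ k.+1)%:R)%:E.
have [G PG] : {G & forall k, P k (G k)}.
  apply: (@choice _ _ P) => k; rewrite /P.
  have fA : lebesgue_outer (A k) \is a fin_num.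
    by rewrite ge0_fin_numE ?lebesgue_outer_ge0// ltey; apply/eqP/Aoo.
  have en1 : (0 < e%:num / (2 ^ k.+1)%:R :> R)%R by [].
  have [_ [B cB <-] ltB] := lb_ereal_inf_adherent en1 fA.
  by exists B; split => //; exact/ltW.
have vG_ge0 k j : 0 <= v (G k) j by apply: box_vol_ge0; exact: (PG k).1.1.
pose w (p : nat * nat) := v (G p.1) p.2.
apply: (@le_trans _ _ (\esum_(p in setT) w p)).
  apply: ereal_inf_lbound => /=.
  have /card_esym/ppcard_eqP[f] := card_nat2.
  exists (fun k => G (f k).1 (f k).2).
    split=> [k|]; first exact: (PG (f k).1).1.1.
    move=> t [i _ Ait]; have [j _ tij] := (PG i).1.2 _ Ait.
    by exists (f^-1%FUN (i, j)) => //=; rewrite invK ?inE.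
  have w_ge0 k : 0 <= w (f k) by exact: vG_ge0.
  rewrite (_ : \sum_(_ <= _ <oo) _ = \sum_(k <oo) w (f k))//.
  rewrite -(esum_pred_image w f xpredT) ?[fun=> _]set_true//.
  by rewrite image_eq.
rewrite (_ : esum _ _ = \sum_(i <oo) \sum_(j <oo) v (G i) j); last first.
  pose I (i : nat) : set (nat * nat) := [set (i, j) | j in setT].
  rewrite (_ : setT = \bigcup_k I k); last first.
    by rewrite predeqE => -[a b]; split => // _; exists a => //; exists b.
  rewrite esum_bigcupT /=; last 2 first.
    - apply/trivIsetP => i j _ _ ij.
      rewrite predeqE => -[k m] /=; split => //= -[] [_] _ [<- _].
      by move=> [m' _] [] /esym/eqP; rewrite (negbTE ij).
    - by move=> p; exact: vG_ge0.
  rewrite -(image_id [set: nat]) -fun_true esum_pred_image//; last first.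
    by move=> k _; apply: esum_ge0 => p _; exact: vG_ge0.
  apply: eq_eseriesr => /= j _.
  rewrite -(esum_pred_image w (pair j) predT)//=; last 2 first.
    by move=> k _; exact: vG_ge0.
    by move=> ? ? _ _; exact: (@can_inj _ _ _ snd).
  by congr esum; rewrite predeqE => -[a b]; split; move=> [i _ <-]; exists i.
by apply: lee_nneseries => [k _ _|k _]; [exact: nneseries_ge0|exact: (PG k).2].
Qed.

HB.instance Definition _ := isOuterMeasure.Build R 'rV[R]_n.+1 lebesgue_outer
  lebesgue_outer0 lebesgue_outer_ge0 le_lebesgue_outer
  lebesgue_outer_sigma_subadditive.

(* R^N with the sigma-algebra of Lebesgue (not only Borel) measurable sets. *)
Definition lebRN := caratheodory_type lebesgue_outer.

HB.instance Definition _ := Measurable.on lebRN.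

Definition leb : set lebRN -> \bar R := lebesgue_outer.

HB.instance Definition _ := isMeasure.Build _ lebRN R leb
  (@caratheodory_measure0 _ _ lebesgue_outer)
  (@caratheodory_measure_ge0 _ _ lebesgue_outer)
  (@caratheodory_measure_sigma_additive _ _ lebesgue_outer).

End lebesgue.

Arguments leb {R n}.

Section coordinates.
Context {R : realType} {n : nat}.
Implicit Types x : 'rV[R]_n.+1.

Definition pt (s : R) (z' : 'rV[R]_n) : 'rV[R]_n.+1 := row_mx s%:M z'.

Definition fst_coord x : R := x ord0 ord0.

Definition other_coords x : 'rV[R]_n := @rsubmx R 1 1 n x.

Definition enorm x : R := Num.sqrt (\sum_(i < n.+1) x ord0 i ^+ 2).

Definition eball1 : set 'rV[R]_n.+1 := [set x | enorm x < 1].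

End coordinates.

(* J and f are total functions: only the values of J off 0 and those of f on
   Omega * R are ever constrained or relevant (bilin multiplies J 0 by 0). *)

Section kernel.
Context {R : realType} {n : nat}.
Implicit Types (J u v : 'rV[R]_n.+1 -> R).
Local Open Scope ereal_scope.

Definition J1 J :=
  \int[leb]_(z in ~` eball1) (J z)%:E
    + \int[leb]_(z in eball1) (enorm z ^+ 2 * J z)%:E < +oo /\
  \int[leb]_(z in [set~ 0%R]) (J z)%:E = +oo.

Definition J2 J := forall (z' : 'rV[R]_n) (s t : R),
  (`|s| < `|t|)%R -> pt s z' <> 0%R -> (J (pt s z') > J (pt t z'))%R.

(* When the two energies of u and v are finite the integrand is integrable on
   R^N * R^N, so that the iterated integral is the double integral. *)
Definition bilin J u v : \bar R :=
  (2^-1)%:E * \int[leb]_y \int[leb]_x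
    ((u x - u y) * (v x - v y) * J (x - y))%:E.

Definition energy_space J (Omega : set 'rV[R]_n.+1) : set ('rV[R]_n.+1 -> R) :=
  [set u | [/\ measurable_fun [set: lebRN R n] u, bilin J u u < +oo &
               {ae leb, forall x, ~ Omega x -> u x = 0%R}]].

Definition Linfty (Omega : set 'rV[R]_n.+1) : set ('rV[R]_n.+1 -> R) :=
  [set u | u \in Lfun leb +oo /\ {ae leb, forall x, ~ Omega x -> u x = 0%R}].

Definition solution J (Omega : set 'rV[R]_n.+1) (f : 'rV[R]_n.+1 -> R -> R) u :=
  energy_space J Omega u /\
  forall phi, energy_space J Omega phi ->
    leb.-integrable Omega (fun x => (f x (u x) * phi x)%:E) /\
    bilin J u phi = \int[leb]_(x in Omega) (f x (u x) * phi x)%:E.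

End kernel.

Section domain.
Context {R : realType} {n : nat}.
Implicit Types (Omega K : set 'rV[R]_n.+1) (u : 'rV[R]_n.+1 -> R).

Definition condD Omega :=
  [/\ open Omega, bounded_set Omega &
      forall (x : 'rV[R]_n.+1) (s : R), Omega x -> -1 <= s <= 1 ->
        Omega (pt (s * fst_coord x) (other_coords x))].

Definition caratheodory_fun Omega (f : 'rV[R]_n.+1 -> R -> R) :=
  (forall u : R, measurable_fun (Omega : set (lebRN R n)) (f^~ u)) /\
  {ae leb, forall x, Omega x -> continuous (f x)}.

Definition F1 Omega (f : 'rV[R]_n.+1 -> R -> R) :=
  caratheodory_fun Omega f /\
  forall K : set R, bounded_set K -> exists2 L : R, 0 < L &
    forall u v : R, K u -> K v ->
      (ereal_sup [set `|f x u - f x v|%:E | x in Omega] <= (L * `|u - v|)%:E)%E.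

Definition F2 Omega (f : 'rV[R]_n.+1 -> R -> R) :=
  forall (u : R) (x : 'rV[R]_n.+1) (s : R), Omega x -> -1 <= s <= 1 ->
    f (pt (s * fst_coord x) (other_coords x)) u >= f x u.

(* The value +oo off K makes this the essential infimum over K, and +oo when K is null. *)
Definition ess_inf_on K u : \bar R :=
  ess_inf leb (fun x : lebRN R n => if x \in K then (u x)%:E else +oo%E).

(* When Omega satisfies condD the reflected points below lie in Omega, so the
   values of u outside Omega do not matter. *)
Definition symmetric_x1 Omega u :=
  {ae leb, forall x, Omega x -> u (pt (- fst_coord x) (other_coords x)) = u x}.

Definition strictly_decreasing_x1 Omega u :=
  forall (lambda : R) K, lambda != 0 -> compact K ->
    K `<=` [set x | Omega x /\ fst_coord x / lambda > 1] ->
    (0 < ess_inf_on K (fun x =>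
           (u (pt (2 * lambda - fst_coord x) (other_coords x)) - u x)%R))%E.

End domain.

(* Main.v *)
Require Import Defs.
From HB Require Import structures.
From mathcomp Require Import all_boot all_order all_algebra.
From mathcomp Require Import all_classical all_reals all_analysis ess_sup_inf.
From mathcomp Require Import measurable_realfun ring lra.

Set Implicit Arguments.
Unset Strict Implicit.
Unset Printing Implicit Defensive.
Import Order.TTheory GRing.Theory Num.Theory.
Import numFieldNormedType.Exports.
Local Open Scope classical_set_scope.
Local Open Scope ring_scope.

(** The proof is the method of moving planes, for a nonlocal operator.

    Let refl l be the reflection in the hyperplane x_1 = l and let
    reflection_gap l u = u o refl l - u. Everything follows from the claim that, if u
    is not zero, this gap is nonnegative on the half space x_1 > l for every l > 0, and
    bounded below by a positive constant near every point of Omega with x_1 > l.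
    Letting l tend to 0, for u and for its mirror image u o refl 0, gives the symmetry;
    a point of Omega is the mirror image of a point farther to the right, which
    gives the positivity.

    The kernel is first replaced by an almost everywhere equal one, Borel and
    even both in z and in z_1 (good_kernel_exists), so that all energies are integrals
    over R^N x R^N that the reflections preserve. By (J2), of two points on one side of the
    hyperplane, the first interacts more strongly with the second than with the
    mirror image of the second. After averaging over the four pairs made of two points and of
    their mirror images, an inequality between energies becomes an algebraic one between
    the values at two points of the half space (quad_le_Rintegral). For an odd h
    (refl_odd l h) with negative part phi on the half space, this gives
    energy h phi <= - energy phi phi, and even
    energy h phi <= - gain, where the gain is the additional interaction of the points where
    h < 0 with those where h > 0 (half_neg_form_le, half_neg_form_gain).

    Subtracting the equations of u o refl l and of u, (F1) and (F2) give
    energy w phi >= - 2 L int |w| phi for the gap w (gap_form_ge). Two maximum principles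
    result. Since J has infinite mass, the Poincare constant of small sets is as large
    as desired (poincare), so that w >= 0 on the half space as soon as w < 0 only on a set of
    small measure (small_volume_maximum_principle). If w >= 0 without vanishing
    identically, the gain is tested with h = w - eps b, where b is an odd barrier around a
    given point: it is at least kappa int phi, whereas b and the right-hand side cost
    O(eps) int phi; so w >= eps b for small eps (strong_maximum_principle). No
    regularity of u enters: energy b phi <= C int phi since b is semiconvex where it is
    positive (barrier_form_le).

    The set of all l > 0 for which the gap is nonnegative contains all large l; it is closed since
    reflections depend continuously on l in measure (gap_nonneg_closed), and open since the
    strong maximum principle leaves only a set of small measure on which a neighbouring
    gap can be negative (gap_nonneg_open), unless the gap vanishes. The latter happens
    for some l > 0 only if u = 0 (gap_zero_trivial). *)

(** * Lebesgue outer measure, boxes and coordinate reflections *)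

Section lebesgue_outer.
Context (R : realType) (n : nat).
Local Notation V := 'rV[R]_n.+1.
Local Notation mu := (@lebesgue_outer R n).
Implicit Types (a b c x h : V) (A X : set V) (i : 'I_n.+1).
Local Open Scope ereal_scope.

Lemma lebesgue_outer_box_le a b : (forall i, (a ord0 i <= b ord0 i)%R) ->
  mu (box a b) <= (box_vol a b)%:E.
Proof.
move=> ab; apply: ereal_inf_lbound.
exists (fun k => if k is 0%N then (a, b) else (a, a)).
  split=> [[|k]//|x abx]; by exists 0%N.
rewrite nneseries_recl//=; last first.
  by move=> [|k] _ /=; apply: box_vol_ge0.
rewrite eseries_cond/= eseries0 ?adde0// => -[|k]//= _ _.
by rewrite /box_vol (bigD1 ord0)//= subrr mul0r.
Qed.

Definition set_coord x i (t : R) : V := \row_j (if j == i then t else x ord0 j).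

Lemma set_coordE x i t j :
  set_coord x i t ord0 j = if j == i then t else x ord0 j.
Proof. by rewrite mxE. Qed.

Lemma box_volE a b i : box_vol a b =
  ((b ord0 i - a ord0 i) * \prod_(j < n.+1 | j != i) (b ord0 j - a ord0 j))%R.
Proof. by rewrite /box_vol (bigD1 i). Qed.

Lemma box_vol_set_coordl a b i t : box_vol (set_coord a i t) b =
  ((b ord0 i - t) * \prod_(j < n.+1 | j != i) (b ord0 j - a ord0 j))%R.
Proof.
rewrite (box_volE _ _ i) set_coordE eqxx; congr (_ * _)%R.
by apply: eq_bigr => j /negbTE ji; rewrite set_coordE ji.
Qed.

Lemma box_vol_set_coordr a b i t : box_vol a (set_coord b i t) =
  ((t - a ord0 i) * \prod_(j < n.+1 | j != i) (b ord0 j - a ord0 j))%R.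
Proof.
rewrite (box_volE _ _ i) set_coordE eqxx; congr (_ * _)%R.
by apply: eq_bigr => j /negbTE ji; rewrite set_coordE ji.
Qed.

(** A hyperplane cuts each box of a covering into two boxes whose volumes add up. *)
Lemma caratheodory_halfspace i (t : R) :
  mu.-caratheodory [set x : V | (x ord0 i <= t)%R].
Proof.
apply: le_caratheodory_measurable => X.
apply: le_ereal_inf_tmp => _ [B [B_le XB] <-].
(* the level t, moved into the side of the k-th box if it lies outside *)
pose m k := Num.max ((B k).1 ord0 i) (Num.min ((B k).2 ord0 i) t).
have mB k : ((B k).1 ord0 i <= m k <= (B k).2 ord0 i)%R.
  rewrite /m le_max lexx/= ge_max B_le/=.
  by rewrite ge_min lexx.
apply: (@le_trans _ _
  (\sum_(k <oo) (box_vol (B k).1 (set_coord (B k).2 i (m k)))%:E +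
   \sum_(k <oo) (box_vol (set_coord (B k).1 i (m k)) (B k).2)%:E)); last first.
  rewrite -nneseriesD; last 2 first.
  - move=> k _ _; apply: box_vol_ge0 => j; rewrite set_coordE; case: ifP => [/eqP->|_].
      by case/andP: (mB k).
    exact: B_le.
  - move=> k _ _; apply: box_vol_ge0 => j; rewrite set_coordE; case: ifP => [/eqP->|_].
      by case/andP: (mB k).
    exact: B_le.
  apply: lee_nneseries => [k _ _|k *].
    rewrite -EFinD lee_fin addr_ge0//.
      rewrite -lee_fin; apply: box_vol_ge0 => j; rewrite set_coordE; case: ifP => [/eqP->|_].
        by case/andP: (mB k).
      exact: B_le.
    rewrite -lee_fin; apply: box_vol_ge0 => j; rewrite set_coordE; case: ifP => [/eqP->|_].
      by case/andP: (mB k).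
    exact: B_le.
  rewrite -EFinD lee_fin box_vol_set_coordl box_vol_set_coordr (box_volE _ _ i).
  by rewrite -mulrDl addrC addrA subrK.
apply: leeD.
- apply: ereal_inf_lbound.
  exists (fun k => ((B k).1, set_coord (B k).2 i (m k))) => //; split=> /=.
    move=> k j; rewrite set_coordE; case: ifP => [/eqP->|_]; last exact: B_le.
    by case/andP: (mB k).
  move=> x [/XB[k _ Bkx] /= xt]; exists k => //= j.
  rewrite set_coordE; case: ifP => [/eqP->|_]; last exact: Bkx.
  case/andP: (Bkx i) => -> xb; by rewrite /m le_max le_min xt xb orbT.
- apply: ereal_inf_lbound.
  exists (fun k => (set_coord (B k).1 i (m k), (B k).2)) => //; split=> /=.
    move=> k j; rewrite set_coordE; case: ifP => [/eqP->|_]; last exact: B_le.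
    by case/andP: (mB k).
  move=> x [/XB[k _ Bkx] /= xt]; exists k => //= j.
  rewrite set_coordE; case: ifP => [/eqP->|_]; last exact: Bkx.
  have /andP[ax xb] := Bkx i.
  have tx : (t <= x ord0 i)%R by rewrite ltW// ltNge; apply/negP.
  by rewrite xb andbT /m ge_max ax ge_min tx orbT.
Qed.

(** These maps carry boxes to boxes of the same volume, so the box coverings that define
    the measure show at once that it is invariant; reflections and translations suffice here. *)
Definition box_isometry (tau : V -> V) := exists (s : 'I_n.+1 -> bool) (c : V),
  forall x i, tau x ord0 i = ((-1) ^+ s i * x ord0 i + c ord0 i)%R.

Lemma box_isometry_inv tau : box_isometry tau ->
  exists tau', [/\ box_isometry tau', cancel tau tau' & cancel tau' tau].
Proof.
move=> [s [c tauE]].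
exists (fun x => \row_i ((-1) ^+ s i * (x ord0 i - c ord0 i))%R); split.
- exists s, (\row_i (- ((-1) ^+ s i * c ord0 i)))%R => x i.
  by rewrite !mxE mulrBr.
- move=> x; apply/rowP => i; rewrite mxE tauE addrK mulrA.
  by rewrite -expr2 sqrr_sign mul1r.
- move=> x; apply/rowP => i; rewrite tauE mxE mulrA.
  by rewrite -expr2 sqrr_sign mul1r subrK.
Qed.

Lemma lebesgue_outer_isometry_le tau A : box_isometry tau ->
  mu (tau @^-1` A) <= mu A.
Proof.
move=> [s [c tauE]]; apply: le_ereal_inf_tmp => _ [B [B_le AB] <-].
apply: ereal_inf_lbound.
pose L (a b : V) : V := \row_i (if s i then c ord0 i - b ord0 i else a ord0 i - c ord0 i)%R.
pose U (a b : V) : V := \row_i (if s i then c ord0 i - a ord0 i else b ord0 i - c ord0 i)%R.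
exists (fun k => (L (B k).1 (B k).2, U (B k).1 (B k).2)).
  split=> [k i|x /= /AB[k _ Bkx]].
    by rewrite /L /U !mxE; have := B_le k i; case: ifP => _; lra.
  exists k => //= i; rewrite /L /U !mxE; have := Bkx i; rewrite tauE.
  case: (s i); rewrite ?expr1 ?expr0; move=> /andP[? ?]; apply/andP; split; lra.
congr (limn _); apply/funext => m; apply: eq_bigr => k _; congr (_%:E).
rewrite /box_vol; apply: eq_bigr => i _ /=; rewrite /L /U !mxE.
by case: ifP => _; ring.
Qed.

Lemma lebesgue_outer_isometry tau A : box_isometry tau ->
  mu (tau @^-1` A) = mu A.
Proof.
move=> tauP; apply/eqP; rewrite eq_le lebesgue_outer_isometry_le//=.
have [tau' [tauP' tauK tauK']] := box_isometry_inv tauP.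
have /(lebesgue_outer_isometry_le (tau @^-1` A)) := tauP'.
by rewrite -comp_preimage (_ : tau \o tau' = id)//; apply/funext => x /=.
Qed.

End lebesgue_outer.

(** * Borel sets and invariance of integrals *)

Section lebesgue_measurable.
Context (R : realType) (n : nat).
Local Notation V := 'rV[R]_n.+1.
Local Notation T := (lebRN R n).
Local Notation mu := (@leb R n).
Implicit Types (a b : V) (A : set V) (i : 'I_n.+1).
Local Open Scope ereal_scope.

Definition halfspaces : set (set V) :=
  [set A | exists i t, A = [set x : V | (x ord0 i <= t)%R]].

(** Kernels of differences have to be measurable on the product of two copies of R^N. The
    difference map is measurable into the Borel sets, but not into the Lebesgue sets
    for the product sigma-algebra, hence the need for both. *)
Definition borRN := g_sigma_algebraType halfspaces.

Lemma measurable_fun_bor d (X : measurableType d) (f : X -> borRN) :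
  (forall i, measurable_fun [set: X] (fun x => f x ord0 i)) ->
  measurable_fun [set: X] f.
Proof.
move=> mf; apply: (@measurability _ _ _ borRN setT f halfspaces erefl) => // _ [_ [i [t ->]] <-].
rewrite setTI; have := mf i measurableT `]-oo, t]%classic (measurable_itv _).
rewrite setTI; congr measurable; apply/seteqP; split=> x /=; by rewrite in_itv.
Qed.

Lemma measurable_coord_halfspace d (X : measurableType d) (f : X -> V) i :
  (forall t, measurable [set x | (f x ord0 i <= t)%R]) ->
  measurable_fun [set: X] (fun x => f x ord0 i).
Proof.
move=> mf; apply: (measurability _ (RGenOInfty.measurableE R)) => //.
move=> _ [_ [t ->] <-]; rewrite setTI; have := measurableC (mf t).
congr measurable; apply/seteqP; split=> x /=; rewrite in_itv/= andbT.
  by move/negP; rewrite -ltNge.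
by rewrite ltNge => /negP.
Qed.

Lemma bor_measurable_coord i : measurable_fun [set: borRN] (fun x : borRN => x ord0 i).
Proof.
apply: measurable_coord_halfspace => t; apply: sub_sigma_algebra.
by exists i, t.
Qed.

Lemma leb_measurable_coord i : measurable_fun [set: T] (fun x : T => x ord0 i).
Proof. by apply: measurable_coord_halfspace => t; exact: caratheodory_halfspace. Qed.

Lemma leb_measurable_id_bor : measurable_fun [set: T] (id : T -> borRN).
Proof. by apply: measurable_fun_bor => i; exact: leb_measurable_coord. Qed.

Lemma bor_leb_measurable A : measurable (A : set borRN) -> measurable (A : set T).
Proof. by move=> mA; rewrite -[A]setTI; exact: leb_measurable_id_bor. Qed.

Lemma bor_leb_measurable_fun d (Y : measurableType d) (f : V -> Y) :
  measurable_fun [set: borRN] (f : borRN -> Y) -> measurable_fun [set: T] (f : T -> Y).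
Proof.
by move=> mf; apply: (measurableT_comp mf leb_measurable_id_bor).
Qed.

Lemma bor_measurable_box a b : measurable (box a b : set borRN).
Proof.
rewrite (_ : box a b = \bigcap_(i in [set: 'I_n.+1])
    ((fun x : borRN => x ord0 i) @^-1` `[a ord0 i, b ord0 i]%classic)).
  apply: fin_bigcap_measurable => // i _.
  by rewrite -[_ @^-1` _]setTI; apply: bor_measurable_coord => //; exact: measurable_itv.
apply/seteqP; split=> x /= xab i; have := xab i; by rewrite /= in_itv//=; exact.
Qed.

Lemma leb_measurable_box a b : measurable (box a b : set T).
Proof. by apply: bor_leb_measurable; exact: bor_measurable_box. Qed.

(** Measurability of the preimage, even of sets that are not Borel: the Caratheodory condition is
    invariant since every test set X is itself a preimage. *)
Lemma leb_measurable_isometry tau : box_isometry tau ->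
  measurable_fun [set: T] (tau : T -> T).
Proof.
move=> tauP _ A mA; rewrite setTI.
suff : (@lebesgue_outer R n).-caratheodory (tau @^-1` A) by [].
have {}mA : (@lebesgue_outer R n).-caratheodory A by [].
move=> X; have [tau' [tauP' tauK tauK']] := box_isometry_inv tauP.
have XE : X = tau @^-1` (tau' @^-1` X).
  by rewrite -comp_preimage (_ : tau' \o tau = id)//; apply/funext => x /=.
rewrite XE preimage_setC -!preimage_setI !(lebesgue_outer_isometry _ tauP).
exact: mA.
Qed.

Lemma leb_isometry tau A : box_isometry tau -> mu (tau @^-1` A) = mu A.
Proof. exact: lebesgue_outer_isometry. Qed.

Lemma leb_ge0_integral_isometry tau (f : T -> \bar R) : box_isometry tau ->
  measurable_fun [set: T] f -> (forall x, 0 <= f x) ->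
  \int[mu]_x f (tau x) = \int[mu]_x f x.
Proof.
move=> tauP mf f0; have mtau := leb_measurable_isometry tauP.
rewrite -[LHS](_ : \int[pushforward mu (tau : T -> T)]_x f x = _).
  by apply: eq_measure_integral => A mA _; exact: leb_isometry.
by rewrite ge0_integral_pushforward// => y _; exact: f0.
Qed.

Lemma leb_integral_isometry tau (f : T -> \bar R) : box_isometry tau ->
  measurable_fun [set: T] f ->
  \int[mu]_x f (tau x) = \int[mu]_x f x.
Proof.
move=> tauP mf; rewrite -[fun x => f (tau x)]/(f \o tau) integralE [RHS]integralE.
rewrite funepos_comp funeneg_comp; congr (_ - _).
  exact: (leb_ge0_integral_isometry tauP (measurable_funepos mf)).
exact: (leb_ge0_integral_isometry tauP (measurable_funeneg mf)).
Qed.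

Lemma leb_integrable_isometry tau (f : T -> \bar R) : box_isometry tau ->
  mu.-integrable setT f -> mu.-integrable setT (fun x => f (tau x)).
Proof.
move=> tauP /integrableP[mf foo]; apply/integrableP; split.
  exact: (measurableT_comp mf (leb_measurable_isometry tauP)).
rewrite (leb_integral_isometry (f := fun x => `|f x|) tauP)//.
exact: measurableT_comp.
Qed.

Lemma ae_isometry tau (P : V -> Prop) : box_isometry tau ->
  {ae mu, forall x, P x} -> {ae mu, forall x, P (tau x)}.
Proof.
move=> tauP [N [mN N0 PN]]; exists (tau @^-1` N); split.
- by rewrite -[_ @^-1` _]setTI; exact: (leb_measurable_isometry tauP).
- by rewrite leb_isometry.
- by move=> x nPx; exact: (PN (tau x)).
Qed.

Definition cube (m : nat) : set V := box (const_mx (- m%:R)%R) (const_mx m%:R).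

Lemma cubeP m x : cube m x <-> forall i, (`|x ord0 i| <= m%:R)%R.
Proof.
by split=> xm i; have := xm i; rewrite /= !mxE ler_norml.
Qed.

Lemma le_cube m1 m2 : (m1 <= m2)%N -> cube m1 `<=` cube m2.
Proof.
move=> m12 x /cubeP xm; apply/cubeP => i; rewrite (le_trans (xm i))//.
by rewrite ler_nat.
Qed.

Lemma bigcup_cube : \bigcup_m cube m = setT.
Proof.
apply/seteqP; split=> // x _.
exists (\max_i (Num.trunc `|x ord0 i|).+1)%N => //; apply/cubeP => i.
apply: (@le_trans _ _ ((Num.trunc `|x ord0 i|).+1)%:R%R).
  by rewrite ltW// truncnS_gt.
rewrite ler_nat; exact: (leq_bigmax (F := fun i => (Num.trunc `|x ord0 i|).+1)).
Qed.

Lemma leb_measurable_cube m : measurable (cube m : set T).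
Proof. exact: leb_measurable_box. Qed.

Lemma leb_cube_lty m : mu (cube m) < +oo.
Proof.
apply: le_lt_trans (ltry (box_vol _ _)); apply: lebesgue_outer_box_le => i.
by rewrite !mxE ge0_cp.
Qed.

Lemma leb_sigma_finite : sigma_finite [set: T] mu.
Proof.
exists cube; first by rewrite bigcup_cube.
by move=> m; split; [exact: leb_measurable_cube|exact: leb_cube_lty].
Qed.

HB.instance Definition _ := Measure_isSigmaFinite.Build _ T R mu leb_sigma_finite.

End lebesgue_measurable.

(** * Null sets and Borel representatives *)

Section regularity.
Context (R : realType) (n : nat).
Local Notation V := 'rV[R]_n.+1.
Local Notation T := (lebRN R n).
Local Notation mu := (@leb R n).
Local Notation borRN := (borRN R n).
Implicit Types (a b x y z : V) (A : set V) (i : 'I_n.+1).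
Local Open Scope ereal_scope.

Lemma le_leb A B : A `<=` B -> mu A <= mu B.
Proof. exact: le_lebesgue_outer. Qed.

Lemma leb_ge0 A : 0 <= mu A. Proof. exact: lebesgue_outer_ge0. Qed.

Lemma leb_subadd A B : mu (A `|` B) <= mu A + mu B.
Proof. exact: (outer_measureU2 (@lebesgue_outer R n)). Qed.

Lemma leb_null_measurable A : mu A = 0 -> measurable (A : set T).
Proof.
move=> A0; apply: le_caratheodory_measurable => X.
rewrite [Y in Y + _](_ : _ = 0); last first.
  apply/eqP; rewrite eq_le lebesgue_outer_ge0 andbT -[leRHS]A0.
  by apply: le_lebesgue_outer; exact: subIsetr.
by rewrite add0e; apply: le_lebesgue_outer; exact: subIsetl.
Qed.

Lemma leb_negligibleP A : mu.-negligible A <-> mu A = 0.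
Proof.
split=> [[N [mN N0 AN]]|A0].
  by apply/eqP; rewrite eq_le leb_ge0 andbT -N0; exact: le_leb.
by exists A; split => //; exact: leb_null_measurable.
Qed.

#[export] Instance leb_ae_filter : Filter (almost_everywhere mu).
Proof. exact: ae_filter_ringOfSetsType. Qed.

Lemma aeP (P : V -> Prop) : {ae mu, forall x, P x} <-> mu [set x | ~ P x] = 0.
Proof. exact: leb_negligibleP. Qed.

Lemma leb_bigcup0 (F : nat -> set V) : (forall k, mu (F k) = 0) ->
  mu (\bigcup_k F k) = 0.
Proof.
by move=> F0; apply/leb_negligibleP/negligible_bigcup => k; apply/leb_negligibleP.
Qed.

Lemma leb_bigcup0_count (I : countType) (F : I -> set V) :
  (forall k, mu (F k) = 0) -> mu (\bigcup_k F k) = 0.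
Proof.
move=> F0; rewrite (_ : \bigcup_k F k =
    \bigcup_m (if unpickle m is Some k then F k else set0)).
  apply: leb_bigcup0 => m; case: unpickle => [k//|]; exact: measure0.
apply/seteqP; split=> x [k _ Fkx]; first by exists (pickle k) => //; rewrite pickleK.
by move: Fkx; case: unpickle => // j Fj; exists j.
Qed.

Lemma box_cover_adherent A (e : R) : mu A < +oo -> (0 < e)%R ->
  exists2 B, box_cover A B & \sum_(k <oo) (box_vol (B k).1 (B k).2)%:E <= mu A + e%:E.
Proof.
move=> Aoo e0; have fA : mu A \is a fin_num by rewrite ge0_fin_numE ?leb_ge0.
have [_ [B cB <-] ltB] := lb_ereal_inf_adherent e0 fA.
by exists B => //; exact: ltW.
Qed.

Lemma bor_hull_fin A : measurable (A : set T) -> mu A < +oo ->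
  exists C, [/\ measurable (C : set borRN), A `<=` C & mu (C `\` A) = 0].
Proof.
move=> mA Aoo.
have inv0 k : (0 < k.+1%:R^-1 :> R)%R by rewrite invr_gt0.
pose B k := sval (cid2 (box_cover_adherent Aoo (inv0 k))).
have cB k : box_cover A (B k) /\ \sum_(j <oo) (box_vol (B k j).1 (B k j).2)%:E <=
    mu A + (k.+1%:R^-1)%:E by rewrite /B; case: cid2.
pose U k := \bigcup_j box (B k j).1 (B k j).2.
have mU k : measurable (U k : set borRN).
  by apply: bigcupT_measurable => j; exact: bor_measurable_box.
have AU k : A `<=` U k by exact: (cB k).1.2.
have UA k : mu (U k) <= mu A + (k.+1%:R^-1)%:E.
  apply: le_trans (cB k).2; apply: ereal_inf_lbound; exists (B k) => //.
  by split; first exact: (cB k).1.1.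
exists (\bigcap_k U k); split.
- by apply: bigcap_measurable => //; exists 0%N.
- by move=> x Ax k _; exact: AU.
- have mC : measurable ((\bigcap_k U k) : set T).
    by apply: bor_leb_measurable; apply: bigcap_measurable => //; exists 0%N.
  have CA : mu (\bigcap_k U k) <= mu A.
    apply/lee_addgt0Pr => e e0.
    have [k ke] : exists k, (k.+1%:R^-1 < e :> R)%R.
      exists (Num.trunc e^-1); rewrite invf_plt ?posrE//; exact: truncnS_gt.
    apply: (le_trans _ (leeD2l _ (_ : (k.+1%:R^-1)%:E <= e%:E))); last by rewrite lee_fin ltW.
    by apply: (le_trans _ (UA k)); apply: le_leb => x; apply.
  have ACA : A `<=` \bigcap_k U k by move=> x Ax k _; exact: AU.
  rewrite [LHS](measureD mC mA); last exact: (le_lt_trans CA).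
  rewrite (setIidr ACA); apply/eqP; rewrite eq_le.
  rewrite leeBlDr ?add0e ?CA/=; last by rewrite ge0_fin_numE ?leb_ge0.
  by rewrite leeBrDr ?add0e ?le_leb// ge0_fin_numE ?leb_ge0.
Qed.

(** The intersection of box coverings with measures tending to that of A is a Borel set that
    exceeds A by a null set only; cutting A by cubes removes the assumption of finite measure. *)
Lemma bor_hull A : measurable (A : set T) ->
  exists C, [/\ measurable (C : set borRN), A `<=` C & mu (C `\` A) = 0].
Proof.
move=> mA.
have mAm m : measurable ((A `&` cube m) : set T).
  by apply: measurableI => //; exact: leb_measurable_cube.
have Amoo m : mu (A `&` cube m) < +oo.
  by apply: le_lt_trans (leb_cube_lty R n m); apply: le_leb; exact: subIsetr.
have [C CP] := choice (fun m => bor_hull_fin (mAm m) (Amoo m)).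
exists (\bigcup_m C m); split.
- by apply: bigcupT_measurable => m; have [] := CP m.
- move=> x Ax; have [m _ xm] : (\bigcup_m cube m) x by rewrite bigcup_cube.
  by exists m => //; have [_ + _] := CP m; apply; split.
- apply/eqP; rewrite eq_le leb_ge0 andbT.
  rewrite -(@leb_bigcup0 (fun m => C m `\` (A `&` cube m))); last by move=> m; have [] := CP m.
  apply: le_leb => x [[m _ Cmx] nAx]; exists m => //; split => // -[]//.
Qed.

(** The value of f is the supremum of the rationals q with q < f; replacing each set where
    q < f by a Borel hull changes this supremum on a null set. *)
Lemma borel_version (f : V -> R) : measurable_fun [set: T] (f : T -> R) ->
  (forall x, (0 <= f x)%R) ->
  exists g : V -> R, [/\ measurable_fun [set: borRN] (g : borRN -> R),
    (forall x, (0 <= g x)%R) & mu [set x | g x <> f x] = 0].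
Proof.
move=> mf f0.
have mfq (q : rat) : measurable ([set x | ratr q < f x]%R : set T).
  have := mf measurableT `]ratr q, +oo[%classic (measurable_itv _).
  by rewrite setTI; congr measurable; apply/seteqP; split=> x /=; rewrite in_itv/= andbT.
have [C CP] := choice (fun q => bor_hull (mfq q)).
(* negative rationals are replaced by 0, the default value as f is nonnegative *)
pose h m (x : V) : \bar R :=
  if unpickle m is Some q then (Num.max 0 (ratr q) * \1_(C q) x)%:E else 0.
have mh m : measurable_fun [set: borRN] (h m : borRN -> \bar R).
  rewrite /h; case: unpickle => [q|]; last exact: measurable_cst.
  apply/measurable_EFinP; apply: measurable_funM; first exact: measurable_cst.
  by apply: measurable_indic; have [] := CP q.
pose g (x : V) : R := fine (esups (h ^~ x) 0%N).
exists g; split.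
- apply: measurableT_comp; first exact: fine_measurable.
  exact: (measurable_fun_esups mh 0%N).
- move=> x; apply: fine_ge0; apply: (@le_trans _ _ (h 0%N x)).
    by rewrite /h; case: unpickle => // q; rewrite lee_fin mulr_ge0// le_max lexx.
  by apply: ereal_sup_ubound; exists 0%N.
- apply/eqP; rewrite eq_le leb_ge0 andbT.
  rewrite -(@leb_bigcup0_count rat (fun q => C q `\` [set x | ratr q < f x]%R)); last first.
    by move=> q; have [] := CP q.
  apply: le_leb => x /= gf; apply: contrapT => nx; apply: gf.
  have Cx q : C q x -> (ratr q < f x)%R.
    by move=> Cqx; apply: contrapT => nq; apply: nx; exists q.
  rewrite /g [X in fine X](_ : _ = (f x)%:E)//; apply/eqP; rewrite eq_le; apply/andP; split.
    apply: ge_ereal_sup => _ [m _ <-]; rewrite /h; case: unpickle => [q|]; last by rewrite lee_fin.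
    rewrite lee_fin indicE; case: (boolP (x \in C q)) => [|_]; last by rewrite mulr0.
    by rewrite inE => /Cx fx; rewrite mulr1 ge_max f0 ltW.
  apply/lee_addgt0Pr => e e0.
  have fex : (f x - e < f x)%R by rewrite ltrBlDr ltrDl.
  have [q] := rat_in_itvoo fex; rewrite in_itv/= => /andP[qe qf].
  have Cqx : C q x by have [_ + _] := CP q; apply.
  rewrite -leeBlDr// -EFinB; apply: (@le_trans _ _ (h (pickle q) x)).
    rewrite /h pickleK lee_fin indicE mem_set// mulr1 le_max (ltW qe) orbT//.
  by apply: ereal_sup_ubound; exists (pickle q).
Qed.

End regularity.

(** * Continuity of translations in measure *)

Section translations.
Context (R : realType) (n : nat).
Local Notation V := 'rV[R]_n.+1.
Local Notation T := (lebRN R n).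
Local Notation mu := (@leb R n).
Implicit Types (a b x y z h : V) (A : set V) (i : 'I_n.+1).
Local Open Scope ereal_scope.

Lemma isometry_translate h : box_isometry (fun x : V => x + h)%R.
Proof. by exists (fun=> false), h => x i; rewrite mxE expr0 mul1r. Qed.

Lemma isometry_sub h : box_isometry (fun x : V => x - h)%R.
Proof. exact: isometry_translate. Qed.

Lemma isometry_subl h : box_isometry (fun x : V => h - x)%R.
Proof. by exists (fun=> true), h => x i; rewrite !mxE expr1 mulN1r addrC. Qed.

Lemma isometry_opp : box_isometry (@GRing.opp V).
Proof. by exists (fun=> true), 0%R => x i; rewrite !mxE expr1 mulN1r addr0. Qed.

Lemma leb_bigsetU_le N (F : nat -> set V) (e : R) :
  (forall k, (k < N)%N -> mu (F k) <= e%:E) ->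
  mu (\big[setU/set0]_(k < N) F k) <= (N%:R * e)%:E.
Proof.
move=> Fe; apply: (le_trans (outer_measure_subadditive (@lebesgue_outer R n) F N)).
apply: (@le_trans _ _ (\sum_(k < N) e%:E)); first by apply: lee_sum => k _; exact: Fe.
by rewrite sumEFin sumr_const card_ord mulr_natl.
Qed.

(** A shifted box leaves the box only through thin slabs along the faces. *)
Lemma leb_box_shift a b (e : R) : (forall i, a ord0 i <= b ord0 i)%R -> (0 < e)%R ->
  exists2 d : R, (0 < d)%R & forall h, (forall i, `|h ord0 i| < d)%R ->
    mu (box a b `\` [set y | box a b (y + h)%R]) <= e%:E.
Proof.
move=> ab e0.
pose P i := (\prod_(j < n.+1 | j != i) (b ord0 j - a ord0 j))%R.
have P0 i : (0 <= P i)%R by apply: prodr_ge0 => j _; rewrite subr_ge0.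
pose S := (1 + \sum_i (P i + P i))%R.
have S0 : (0 < S)%R.
  by rewrite ltr_wpDr// sumr_ge0// => i _; rewrite addr_ge0.
exists (e / S)%R; first by rewrite divr_gt0.
move=> h hd.
pose G i : set V := box a (set_coord b i (a ord0 i + `|h ord0 i|)%R) `|`
  box (set_coord a i (b ord0 i - `|h ord0 i|)%R) b.
have G_le i : mu (G i) <= ((e / S) * (P i + P i))%:E.
  rewrite mulrDr EFinD; apply: (le_trans (leb_subadd _ _)); apply: leeD.
    apply: le_trans (lebesgue_outer_box_le _) _.
      move=> j; rewrite set_coordE; case: eqP => [->|//].
      by rewrite lerDl.
    rewrite box_vol_set_coordr lee_fin -/(P i) ler_wpM2r// addrAC subrr add0r.
    exact/ltW.
  apply: le_trans (lebesgue_outer_box_le _) _.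
    move=> j; rewrite set_coordE; case: eqP => [->|//].
    by rewrite gerBl.
  rewrite box_vol_set_coordl lee_fin -/(P i) ler_wpM2r// opprB addrC subrK.
  exact/ltW.
apply: (@le_trans _ _ (mu (\big[setU/set0]_(i < n.+1) G (inord i)))).
  apply: le_leb => y [yab ny].
  have [i ni] : exists i, ~ (a ord0 i <= (y + h)%R ord0 i <= b ord0 i)%R.
    by apply/existsNP => H; apply: ny => i; exact: H.
  have Gi : G i y.
    have := yab i; move: ni; rewrite mxE => ni /andP[ai bi].
    have hi := ler_norm (h ord0 i); have hi' : (- h ord0 i <= `|h ord0 i|)%R by rewrite -normrN ler_norm.
    have [ay|ay] := leP (y ord0 i) (a ord0 i + `|h ord0 i|)%R.
      left => j; rewrite set_coordE; case: eqP => [->|_]; last exact: yab.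
      by rewrite ai ay.
    right => j; rewrite set_coordE; case: eqP => [->|_]; last exact: yab.
    rewrite bi andbT leNgt; apply/negP => yb; apply: ni; apply/andP; split; lra.
  rewrite -(bigcup_mkord n.+1 (fun k => G (inord k))); exists i => /=; first exact: ltn_ord.
  by rewrite inord_val.
apply: le_trans (outer_measure_subadditive (@lebesgue_outer R n) (fun k => G (inord k)) n.+1) _.
apply: (@le_trans _ _ (\sum_(i < n.+1) ((e / S) * (P i + P i))%:E)).
  by apply: lee_sum => i _; rewrite inord_val; exact: G_le.
rewrite sumEFin lee_fin -mulr_sumr mulrAC ler_pdivrMr// ler_wpM2l ?(ltW e0)//.
by rewrite /S lerDr.
Qed.

Lemma shift_uniform_fin (P : nat -> V -> Prop) N :
  (forall k, (k < N)%N -> exists2 d : R, (0 < d)%R &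
    forall h, (forall i, `|h ord0 i| < d)%R -> P k h) ->
  exists2 d : R, (0 < d)%R & forall h, (forall i, `|h ord0 i| < d)%R ->
    forall k, (k < N)%N -> P k h.
Proof.
elim: N => [|N IH] H; first by exists 1%R.
have [|d1 d10 d1P] := IH; first by move=> k kN; apply: H; exact: ltnW.
have [d2 d20 d2P] := H N (ltnSn N).
exists (Num.min d1 d2); first by rewrite lt_min d10.
move=> h hd k; rewrite ltnS leq_eqVlt => /predU1P[->|kN].
  by apply: d2P => i; apply: lt_le_trans (hd i) _; rewrite ge_min lexx orbT.
by apply: d1P => // i; apply: lt_le_trans (hd i) _; rewrite ge_min lexx.
Qed.

(** Up to small measure, A is a finite union of boxes. *)
Lemma leb_shift_continuous A (e : R) : measurable (A : set T) -> mu A < +oo ->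
  (0 < e)%R ->
  exists2 d : R, (0 < d)%R & forall h, (forall i, `|h ord0 i| < d)%R ->
    mu (A `\` [set y | A (y + h)%R]) <= e%:E.
Proof.
move=> mA Aoo e0.
have e40 : (0 < e / 4)%R by rewrite divr_gt0.
have [B [B_le AB] BA] := box_cover_adherent Aoo e40.
pose U := \bigcup_k box (B k).1 (B k).2.
have mU : measurable (U : set T).
  by apply: bigcupT_measurable => k; exact: leb_measurable_box.
have UA : mu U <= mu A + (e / 4)%:E.
  by apply: le_trans BA; apply: ereal_inf_lbound; exists B => //; split.
have Uoo : mu U < +oo by apply: (le_lt_trans UA); rewrite lte_add_pinfty// ltry.
have UDA : mu (U `\` A) <= (e / 4)%:E.
  rewrite [leLHS](measureD mU mA)// (setIidr AB) leeBlDl//.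
  by rewrite ge0_fin_numE ?leb_ge0.
have volB0 k : 0 <= (box_vol (B k).1 (B k).2)%:E by exact: box_vol_ge0.
have [N NB] : exists N, \sum_(N <= k <oo) (box_vol (B k).1 (B k).2)%:E <= (e / 4)%:E.
  have : \sum_(0 <= k <oo) (box_vol (B k).1 (B k).2)%:E < +oo.
    by apply: le_lt_trans BA _; rewrite lte_add_pinfty// ltry.
  move=> Boo.
  have /fine_cvgP[H1 /cvgrPdist_le/(_ _ e40) H2] :=
    @nneseries_tail_cvg R (fun k => (box_vol (B k).1 (B k).2)%:E) xpredT Boo
      (fun k _ => volB0 k).
  have : \forall k \near \oo, \sum_(k <= i <oo) (box_vol (B i).1 (B i).2)%:E <= (e / 4)%:E.
    near=> k.
    have fk : \sum_(k <= i <oo) (box_vol (B i).1 (B i).2)%:E \is a fin_num by near: k.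
    have : (`|0 - fine (\sum_(k <= i <oo) (box_vol (B i).1 (B i).2)%:E)| <= e / 4)%R by near: k.
    rewrite sub0r normrN -(fineK fk) lee_fin; apply: le_trans; exact: ler_norm.
  by move=> [N _ NP]; exists N; apply: NP => /=.
pose e' := (e / 4 / N.+1%:R)%R.
have e'0 : (0 < e')%R by rewrite divr_gt0.
have [d d0 dP] := shift_uniform_fin (fun k (_ : (k < N)%N) =>
  leb_box_shift (B_le k) e'0).
exists d => // h hd.
apply: (@le_trans _ _ (mu
  (\big[setU/set0]_(k < N) (box (B k).1 (B k).2 `\` [set y | box (B k).1 (B k).2 (y + h)%R])
   `|` \bigcup_(k in ~` `I_N) box (B k).1 (B k).2
   `|` ((fun y => y + h)%R @^-1` (U `\` A))))).
  apply: le_leb => y [Ay nAy].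
  have [Uyh|nUyh] := pselect (U (y + h)%R); first by right.
  left; have [k _ Bk] := AB _ Ay.
  have [kN|kN] := ltnP k N; last by right; exists k => //=; apply/negP; rewrite -leqNgt.
  left; rewrite -(bigcup_mkord N
    (fun k => box (B k).1 (B k).2 `\` [set y | box (B k).1 (B k).2 (y + h)%R])).
  exists k => //=; split => // Bkh; apply: nUyh; by exists k.
apply: (le_trans (leb_subadd _ _)); rewrite (leb_isometry _ (isometry_translate h)).
apply: (le_trans (leeD (leb_subadd _ _) UDA)).
apply: (@le_trans _ _ ((e / 4)%:E + (e / 4)%:E + (e / 4)%:E)); last first.
  by rewrite -!EFinD lee_fin; lra.
apply: leeD => //; apply: leeD.
  apply: (@le_trans _ _ (N%:R * e')%:E).
    apply: (leb_bigsetU_le (F := fun k => box (B k).1 (B k).2 `\`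
      [set y | box (B k).1 (B k).2 (y + h)%R])) => k kN; exact: dP.
  rewrite lee_fin /e' mulrCA ler_piMr ?(ltW e40)// ler_pdivrMr// mul1r ler_nat//.
apply: le_trans (outer_measure_sigma_subadditive_tail (@lebesgue_outer R n) N _) _.
apply: le_trans NB; apply: lee_nneseries => [k _ _|k *]; first exact: lebesgue_outer_ge0.
exact: lebesgue_outer_box_le.
Unshelve. all: by end_near. Qed.

End translations.

Section continuity_in_measure.
Context (R : realType) (n : nat).
Local Notation V := 'rV[R]_n.+1.
Local Notation T := (lebRN R n).
Local Notation mu := (@leb R n).
Implicit Types (a b x y z h : V) (A : set V) (i : 'I_n.+1).
Local Open Scope ereal_scope.

Lemma measurable_fun_ltc (g : V -> R) (c : R) : measurable_fun [set: T] (g : T -> R) ->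
  measurable ([set y | c < g y]%R : set T).
Proof.
move=> mg; have := mg measurableT `]c, +oo[%classic (measurable_itv _).
by rewrite setTI; congr measurable; apply/seteqP; split=> x /=; rewrite in_itv/= andbT.
Qed.

Lemma cube_shift m y h : (forall i, `|h ord0 i| < 1)%R -> cube m y -> cube m.+1 (y + h)%R.
Proof.
move=> h1 /cubeP ym; apply/cubeP => i; rewrite mxE (le_trans (ler_normD _ _))//.
by rewrite -natr1 lerD// ltW.
Qed.

Lemma cube_large_values (g : V -> R) m (e : R) :
  measurable_fun [set: T] (g : T -> R) -> (0 < e)%R ->
  exists M : nat, mu (cube m `&` [set y | M%:R < `|g y|]%R) <= e%:E.
Proof.
move=> mg e0.
pose F k := cube m `&` [set y | k%:R < `|g y|]%R.
have mF k : measurable (F k : set T).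
  apply: measurableI; first exact: leb_measurable_cube.
  by apply: measurable_fun_ltc; exact: measurableT_comp.
have Foo : mu (F 0%N) < +oo.
  by apply: le_lt_trans (leb_cube_lty R n m); apply: le_leb; exact: subIsetl.
have capF : \bigcap_k F k = set0.
  apply/seteqP; split=> // y /(_ (Num.trunc `|g y|).+1 Logic.I) [_ /=].
  by rewrite ltNge ltW// truncnS_gt.
have ndF : nonincreasing_seq F.
  move=> k1 k2 k12; apply/subsetPset => y [ym yk]; split => //=.
  by apply: le_lt_trans yk; rewrite ler_nat.
have := @nonincreasing_cvg_mu _ T R mu F Foo mF.
rewrite capF measure0 => /(_ measurable0 ndF) /fine_cvgP[H1 /cvgrPdist_le/(_ _ e0) H2].
have : \forall k \near \oo, mu (F k) <= e%:E.
  near=> k.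
  have fk : mu (F k) \is a fin_num by near: k.
  have : (`|0 - fine (mu (F k))| <= e)%R by near: k.
  rewrite sub0r normrN -(fineK fk) lee_fin; apply: le_trans; exact: ler_norm.
by move=> [N _ NP]; exists N; apply: NP => /=.
Unshelve. all: by end_near. Qed.

(** Apart from a small set where |g| is large, if g jumps by more than eta between y and y + h, then some level q, out of finitely many with spacing
    eta / 2, lies between the two values, so y lies in the difference of a superlevel set
    and its translate. *)
Lemma leb_translation_continuous (g : V -> R) m (eta e : R) :
  measurable_fun [set: T] (g : T -> R) -> (0 < eta)%R -> (0 < e)%R ->
  exists2 d : R, (0 < d)%R & forall h, (forall i, `|h ord0 i| < d)%R ->
    mu (cube m `&` [set y | eta < `|g (y + h) - g y|]%R) <= e%:E.
Proof.
move=> mg eta0 e0.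
have e20 : (0 < e / 2)%R by rewrite divr_gt0.
have [M ME] := cube_large_values m mg e20.
pose s := (eta / 2)%R.
have s0 : (0 < s)%R by rewrite divr_gt0.
have etaE : eta = (s + s)%R by rewrite /s -splitr.
(* the levels q 0, ..., q (N - 1) reach from below -M to above M *)
pose N := (Num.trunc ((M%:R + M%:R) / s : R)%R).+3.
pose q j : R := (- M%:R + (j%:R - 1) * s)%R.
pose A j := cube m.+1 `&` [set y | q j < g y]%R.
have mA j : measurable (A j : set T).
  by apply: measurableI; [exact: leb_measurable_cube|exact: measurable_fun_ltc].
have Aoo j : mu (A j) < +oo.
  by apply: le_lt_trans (leb_cube_lty R n m.+1); apply: le_leb; exact: subIsetl.
pose e' := (e / 4 / N%:R)%R.
have e'0 : (0 < e')%R by rewrite !divr_gt0// ltr0n.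
have [d d0 dP] := shift_uniform_fin (fun k (_ : (k < N)%N) =>
  leb_shift_continuous (mA k) (Aoo k) e'0).
exists (Num.min d 1%R); first by rewrite lt_min d0 ltr01.
move=> h hd.
have h1 i : (`|h ord0 i| < 1)%R by apply: lt_le_trans (hd i) _; rewrite ge_min lexx orbT.
have {}hd i : (`|h ord0 i| < d)%R by apply: lt_le_trans (hd i) _; rewrite ge_min lexx.
have hdN i : (`|(- h)%R ord0 i| < d)%R by rewrite mxE normrN.
(* F j and G j: level j is crossed downwards or upwards *)
pose F j := A j `\` [set y | A j (y + h)%R].
pose G j := (fun y => y + h)%R @^-1` (A j `\` [set y | A j (y - h)%R]).
have muF : mu (\big[setU/set0]_(j < N) F j) <= (e / 4)%:E.
  apply: (@le_trans _ _ (N%:R * e')%:E).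
    by apply: leb_bigsetU_le => k kN; exact: dP.
  by rewrite lee_fin /e' mulrCA divff ?mulr1// pnatr_eq0.
have muG : mu (\big[setU/set0]_(j < N) G j) <= (e / 4)%:E.
  apply: (@le_trans _ _ (N%:R * e')%:E).
    apply: leb_bigsetU_le => k kN; rewrite /G (leb_isometry _ (isometry_translate h)).
    exact: dP.
  by rewrite lee_fin /e' mulrCA divff ?mulr1// pnatr_eq0.
apply: (@le_trans _ _ (mu ((cube m `&` [set y | M%:R < `|g y|]%R) `|`
  (\big[setU/set0]_(j < N) F j `|` \big[setU/set0]_(j < N) G j)))); last first.
  apply: (le_trans (leb_subadd _ _)).
  apply: (le_trans (leeD ME (leb_subadd _ _))).
  apply: (le_trans (leeD2l _ (leeD muF muG))).
  by rewrite -!EFinD lee_fin; lra.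
apply: le_leb => y [ym /= yg].
have [gM|gM] := ltP M%:R%R `|g y|%R; [by left|right].
have ym1 : cube m.+1 y by exact: (le_cube (leqnSn m)).
have yh1 : cube m.+1 (y + h)%R by exact: cube_shift.
have /andP[gM1 gM2] : (- M%:R <= g y <= M%:R)%R by rewrite -ler_norml.
pose r := ((g y + M%:R) / s)%R.
have r0 : (0 <= r)%R by rewrite divr_ge0 ?(ltW s0)//; lra.
pose t := Num.trunc r.
have /andP[tr rt] : (t%:R <= r < t.+1%:R)%R by exact: truncn_itv.
have tN : (t.+2 < N)%N.
  rewrite /N !ltnS; apply: le_truncn; rewrite ler_pM2r ?invr_gt0//; lra.
have gE : g y = (- M%:R + r * s)%R by rewrite /r divfK ?gt_eqF// addrC addrK.
have [up|down] := ltP (g y) (g (y + h)%R).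
- right; rewrite -(bigcup_mkord N G); exists t.+2 => //=.
  have {}yg : (eta < g (y + h) - g y)%R by rewrite gtr0_norm ?subr_gt0 in yg.
  have qg : (g y <= q t.+2 < g (y + h))%R.
    have : (r * s <= t.+1%:R * s)%R by rewrite ler_wpM2r ?(ltW s0) ?(ltW rt).
    have : (t%:R * s <= r * s)%R by rewrite ler_wpM2r ?(ltW s0).
    rewrite /q -[t.+2%:R]natr1 -natr1 addrK mulrDl mul1r; move: yg; rewrite gE etaE.
    move=> ? ? ?; apply/andP; split; lra.
  case/andP: qg => qg1 qg2; rewrite /G; split; first by split.
  by rewrite /= addrK => -[_ /=]; rewrite ltNge qg1.
- left; rewrite -(bigcup_mkord N F); exists t => /=; first by apply: leq_ltn_trans tN; rewrite leqW.
  have {}yg : (eta < g y - g (y + h))%R by rewrite ler0_norm ?subr_le0// opprB in yg.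
  have qg : (g (y + h) <= q t < g y)%R.
    have : (r * s < t.+1%:R * s)%R by rewrite ltr_pM2r.
    have : (t%:R * s <= r * s)%R by rewrite ler_wpM2r ?(ltW s0).
    rewrite /q -natr1 !mulrDl mulNr !mul1r; move: yg; rewrite gE etaE.
    move=> ? ? ?; apply/andP; split; lra.
  case/andP: qg => qg1 qg2; rewrite /F; split; first by split.
  by move=> -[_ /=]; rewrite ltNge qg1.
Qed.

(** Infinitely many disjoint translates of equal measure fit into a cube only if they are null. *)
Lemma leb_disjoint_translates i A : measurable (A : set T) ->
  (forall x (t : R), (0 < t)%R -> A x -> ~ A (x + t *: delta_mx ord0 i)%R) ->
  mu A = 0.
Proof.
move=> mA disjA.
suff bounded m : mu (A `&` cube m) = 0.
  apply/eqP; rewrite eq_le leb_ge0 andbT -(leb_bigcup0 bounded).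
  by apply: le_leb; rewrite -setI_bigcupr bigcup_cube setIT.
pose B := A `&` cube m.
have mB : measurable (B : set T) by apply: measurableI => //; exact: leb_measurable_cube.
(* distinct steps smaller than 1 keep the translates inside a larger cube *)
pose t k : R := (k.+2%:R^-1)%R.
have t01 k : (0 < t k < 1)%R by rewrite invr_gt0 ltr0n/= invf_lt1// ltr1n.
pose F k := (fun x => x - t k *: delta_mx ord0 i)%R @^-1` B.
have mF k : measurable (F k : set T).
  rewrite -[F k]setTI; exact: (leb_measurable_isometry (isometry_sub _)).
have muF k : mu (F k) = mu B by rewrite (leb_isometry _ (isometry_sub _)).
have tF : trivIset setT F.
  suff H k1 k2 : (k1 < k2)%N -> F k1 `&` F k2 = set0.
    apply/trivIsetP => k1 k2 _ _; rewrite neq_ltn => /orP[]; [exact: H|rewrite setIC; exact: H].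
  move=> k12; apply/seteqP; split=> // x [[Ax1 _] [Ax2 _]].
  apply: (disjA _ (t k1 - t k2)%R _ Ax1).
    by rewrite subr_gt0 ltf_pV2 ?posrE// ltr_nat.
  by move: Ax2; rewrite scalerBl addrA subrK.
have FC : \bigcup_k F k `<=` cube m.+1.
  move=> x [k _ [_ xm]]; rewrite -(subrK (t k *: delta_mx ord0 i) x).
  apply: cube_shift => // j; rewrite !mxE/=; case/andP: (t01 k) => t0 t1.
  by case: (j == i); rewrite ?mulr1 ?mulr0 ?normr0// gtr0_norm.
have Sle : \sum_(k <oo) mu (F k) <= mu (cube m.+1).
  rewrite -(measure_semi_bigcup _ mF tF); first by apply: le_leb.
  exact: bigcupT_measurable.
apply/eqP; rewrite -measure_le0; apply: contraT; rewrite -ltNge => B0.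
have Boo : mu B < +oo.
  by apply: le_lt_trans (leb_cube_lty R n m); apply: le_leb; exact: subIsetr.
have fB : mu B \is a fin_num by rewrite ge0_fin_numE ?leb_ge0.
have fC : mu (cube m.+1) \is a fin_num.
  by rewrite ge0_fin_numE ?leb_ge0//; exact: leb_cube_lty.
pose N := (Num.trunc (fine (mu (cube m.+1)) / fine (mu B))%R).+1.
have NB : (\sum_(0 <= k < N) mu (F k))%R <= mu (cube m.+1).
  by apply: le_trans Sle; apply: nneseries_lim_ge => k _ _; exact: leb_ge0.
exfalso; move: NB; apply/negP; rewrite -ltNge.
rewrite (eq_bigr (fun=> (fine (mu B))%:E)); last by move=> k _; rewrite muF fineK.
rewrite sumEFin sumr_const_nat subn0 -(fineK fC) lte_fin -mulr_natl -ltr_pdivrMr.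
  exact: truncnS_gt.
by rewrite fine_gt0// B0 Boo.
Qed.

(** A point is disjoint from its translates. *)
Lemma leb_set1 x : mu [set x] = 0.
Proof.
apply/eqP; rewrite eq_le leb_ge0 andbT.
have mx : measurable (box x x : set T) by exact: leb_measurable_box.
rewrite -(@leb_disjoint_translates ord0 (box x x))//.
  by apply: le_leb => y -> j; rewrite lexx.
move=> y t t0 yx yxt; have := yxt ord0; have := yx ord0.
by rewrite !mxE/= mulr1 => /andP[? ?] /andP[? ?]; lra.
Qed.

Lemma nbhs_rVP x (U : set V) : nbhs x U <->
  exists2 d : R, (0 < d)%R & forall y, (forall i, `|y ord0 i - x ord0 i| < d)%R -> U y.
Proof.
split.
  move=> /nbhs_ballP[d d0 dU]; exists d => // y yd; apply: dU.
  by split => // i j; rewrite ord1 -ball_normE /ball_/= distrC.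
move=> [d d0 dU]; apply/nbhs_ballP; exists d => // y [_ yd]; apply: dU => i.
by have := yd ord0 i; rewrite -ball_normE /ball_/= distrC.
Qed.

End continuity_in_measure.

(** * Open sets and reflections *)

Section open_sets.
Context (R : realType) (n : nat).
Local Notation V := 'rV[R]_n.+1.
Local Notation T := (lebRN R n).
Local Notation mu := (@leb R n).
Local Notation borRN := (borRN R n).
Implicit Types (a b x y z h : V) (A U : set V) (i : 'I_n.+1).
Local Open Scope ereal_scope.

(** Every open set is a countable union of small boxes with
    corners on grids. *)
Definition grid_point (m : nat) (p : 'rV[int]_n.+1) : V :=
  \row_i ((p ord0 i)%:~R / m.+1%:R)%R.

Definition small_box x (m : nat) : set V := box x (x + const_mx (m.+1%:R^-1))%R.

Lemma mem_grid m x : exists p, small_box (grid_point m p) m x.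
Proof.
exists (\row_i Num.floor (x ord0 i * m.+1%:R)%R) => i; rewrite !mxE.
have /andP[fl1 fl2] := floor_itv (x ord0 i * m.+1%:R)%R.
rewrite ler_pdivrMr// fl1/= -[X in (_ <= _ + X)%R]mul1r -mulrDl ler_pdivlMr//.
by rewrite ltW// -[1%R]/(1%:~R) -intrD.
Qed.

Lemma small_box_sub x (d : R) : (0 < d)%R -> exists m, forall y z,
  small_box z m y -> forall i, (`|y ord0 i - z ord0 i| < d)%R.
Proof.
move=> d0; exists (Num.trunc d^-1) => y z yz i; have := yz i; rewrite !mxE => /andP[zy yz1].
rewrite ger0_norm ?subr_ge0//; apply: (@le_lt_trans _ _ ((Num.trunc d^-1).+1%:R^-1)%R).
  by rewrite lerBlDl.
by rewrite invf_plt ?posrE//; exact: truncnS_gt.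
Qed.

Lemma open_bor_measurable U : open U -> measurable (U : set borRN).
Proof.
move=> oU.
rewrite (_ : U = \bigcup_(mp : nat * 'rV[int]_n.+1)
   (if `[< small_box (grid_point mp.1 mp.2) mp.1 `<=` U >]
    then small_box (grid_point mp.1 mp.2) mp.1 else set0)).
  apply: countable_bigcupT_measurable; first exact: countableP.
  by move=> mp; case: ifP => _; [exact: bor_measurable_box|exact: measurable0].
apply/seteqP; split=> x.
  move=> Ux; have /nbhs_rVP[d d0 dU] : nbhs x U by exact: open_nbhs_nbhs.
  have [m mP] := small_box_sub x (divr_gt0 d0 (@ltr0n R 2)).
  have [p px] := mem_grid m x; exists (m, p) => //=.
  rewrite asboolT// => y yp; apply: dU => i.
  have := mP _ _ px i; have := mP _ _ yp i.
  move=> yg xg.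
  have -> : (y ord0 i - x ord0 i = (y ord0 i - grid_point m p ord0 i) -
    (x ord0 i - grid_point m p ord0 i))%R by ring.
  by rewrite (le_lt_trans (ler_normB _ _))// (splitr d) ltrD.
by move=> [mp _]; case: ifP => // /asboolP; apply.
Qed.

Lemma open_leb_measurable U : open U -> measurable (U : set T).
Proof. by move=> oU; apply: bor_leb_measurable; exact: open_bor_measurable. Qed.

(** A nonempty open set contains a box, and countably many translates of it cover the
    space. *)
Lemma open_null_leb U x : open U -> U x -> mu U = 0 -> mu [set: V] = 0.
Proof.
move=> oU Ux U0; have /nbhs_rVP[d d0 dU] : nbhs x U by exact: open_nbhs_nbhs.
have [m mP] := small_box_sub x d0.
have B0 : mu (small_box x m) = 0.
  apply/eqP; rewrite eq_le leb_ge0 andbT -U0; apply: le_leb => y yx.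
  by apply: dU => i; exact: mP.
apply/eqP; rewrite eq_le leb_ge0 andbT.
rewrite -(@leb_bigcup0_count R n 'rV[int]_n.+1 (fun p => small_box (grid_point m p) m)).
  by apply: le_leb => y _; have [p py] := mem_grid m y; exists p.
move=> p.
apply/eqP; rewrite eq_le leb_ge0 andbT -B0.
rewrite -(leb_isometry (small_box x m) (isometry_translate (x - grid_point m p)%R)).
apply: le_leb => y; move: (grid_point m p) => g yg i.
by have := yg i; rewrite !mxE; move: (m.+1%:R^-1)%R => c /andP[? ?]; apply/andP; split; lra.
Qed.

End open_sets.

Section reflections.
Context (R : realType) (n : nat).
Local Notation V := 'rV[R]_n.+1.
Implicit Types (x y z : V) (i : 'I_n.+1) (l s t : R).

Definition refl l x : V := set_coord x ord0 (2 * l - x ord0 ord0).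

Lemma ptE s x i :
  pt s (other_coords x) ord0 i = if i == ord0 then s else x ord0 i.
Proof.
rewrite /pt mxE; case: splitP => [j ij|k ik].
  have -> : i = ord0 by apply: val_inj; rewrite /= ij (ord1 j).
  by rewrite mxE (ord1 j) eqxx mulr1n.
have -> : i = rshift 1 k by apply: val_inj; exact: ik.
by rewrite /other_coords mxE.
Qed.

Lemma pt_set_coord s x : pt s (other_coords x) = set_coord x ord0 s.
Proof. by apply/rowP => i; rewrite ptE set_coordE. Qed.

Lemma reflE l x i : refl l x ord0 i = if i == ord0 then 2 * l - x ord0 ord0 else x ord0 i.
Proof. exact: set_coordE. Qed.

Lemma refl_pt l x : refl l x = pt (2 * l - fst_coord x) (other_coords x).
Proof. by rewrite pt_set_coord. Qed.

Lemma refl0_pt x : refl 0 x = pt (- fst_coord x) (other_coords x).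
Proof. by rewrite refl_pt mulr0 sub0r. Qed.

Lemma reflK l : involutive (refl l).
Proof.
move=> x; apply/rowP => i; rewrite !reflE eqxx.
by case: eqP => [->|//]; rewrite opprB addrC subrK.
Qed.

Lemma isometry_refl l : box_isometry (refl l).
Proof.
exists (fun i => i == ord0), (\row_i if i == ord0 then 2 * l else 0) => x i.
rewrite reflE mxE; case: eqP => [->|_]; first by rewrite expr1 mulN1r addrC.
by rewrite expr0 mul1r addr0.
Qed.

Lemma refl_sub l x y : refl l x - refl l y = refl 0 (x - y).
Proof.
by apply/rowP => i; rewrite !(reflE, mxE); case: eqP => _; ring.
Qed.

Lemma refl_subl l x y : refl l x - y = refl 0 (x - refl l y).
Proof. by rewrite -{1}(reflK l y) refl_sub. Qed.

Lemma refl_refl0 l x : refl l (refl 0 x) = refl 0 (refl (- l) x).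
Proof. by apply/rowP => i; rewrite !reflE eqxx; case: eqP => // _; ring. Qed.

Lemma refl0N x : refl 0 (- x) = - refl 0 x.
Proof. by apply/rowP => i; rewrite !(reflE, mxE); case: eqP => // _; ring. Qed.

Lemma refl_fix l x : x ord0 ord0 = l -> refl l x = x.
Proof.
by move=> xl; apply/rowP => i; rewrite reflE; case: eqP => [->|//]; rewrite xl; ring.
Qed.

End reflections.
Arguments isometry_refl {R n} l.

(** * Normalization of the kernel *)

Section normalized_kernels.
Context (R : realType) (n : nat).
Local Notation V := 'rV[R]_n.+1.
Local Notation T := (lebRN R n).
Local Notation mu := (@leb R n).
Local Notation borRN := (borRN R n).
Implicit Types (x y z h : V) (A U : set V) (i : 'I_n.+1).

Definition sqn x : R := \sum_i x ord0 i ^+ 2.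

Lemma sqn_ge0 x : 0 <= sqn x.
Proof. by apply: sumr_ge0 => i _; exact: sqr_ge0. Qed.

Lemma enorm_sqr x : enorm x ^+ 2 = sqn x.
Proof. by rewrite /enorm sqr_sqrtr// sqn_ge0. Qed.

Lemma eball1E x : eball1 x <-> sqn x < 1.
Proof.
rewrite /eball1 /= -enorm_sqr.
have e0 : 0 <= enorm x by exact: sqrtr_ge0.
by rewrite expr_lt1.
Qed.

Lemma measurable_sqn : measurable_fun [set: T] (sqn : T -> R).
Proof.
apply: measurable_sum => i; apply: measurable_funX; exact: leb_measurable_coord.
Qed.

Lemma measurable_eball1 : measurable (@eball1 R n : set T).
Proof.
have := measurable_sqn measurableT (measurable_itv `]-oo, (1 : R)[).
rewrite setTI; congr measurable; apply/seteqP; split=> x /=.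
  by rewrite in_itv/= => ?; apply/eball1E.
by move/eball1E; rewrite in_itv.
Qed.

(** The last condition is (J2) seen as a property of pairs: reflecting one of two points on the
    same side of a hyperplane weakens their interaction. *)
Definition good_kernel (j : V -> R) :=
  [/\ measurable_fun [set: borRN] (j : borRN -> R), forall z, 0 <= j z,
      forall z, j (- z) = j z & forall z, j (refl 0 z) = j z] /\
  [/\ (\int[mu]_z (Num.min 1 (sqn z) * j z)%:E < +oo)%E,
      (\int[mu]_z (j z)%:E = +oo)%E &
      forall l x, l < x ord0 ord0 ->
        {ae mu, forall y, l < y ord0 ord0 -> j (x - refl l y) < j (x - y)}].

Lemma measurable_fun_punctured (J : V -> R) :
  measurable_fun ([set~ (0 : V)] : set T) (J : T -> R) ->
  measurable_fun [set: T] (J : T -> R).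
Proof.
move=> mJ; have m0 : measurable ([set 0] : set T).
  exact: leb_null_measurable (leb_set1 _).
rewrite -(setvU [set 0]); apply/measurable_funU => //; first exact: measurableC.
by split => //; exact: measurable_fun_set1.
Qed.

Context (J : V -> R).
Hypotheses (J_measurable : measurable_fun ([set~ (0 : V)] : set T) (J : T -> R))
    (J_ge0 : forall z : V, z != 0 -> 0 <= J z)
    (J_even : forall z : V, z != 0 -> J (- z) = J z)
    (J_J1 : J1 J) (J_J2 : J2 J).

Lemma J2_set_coord x s t : `|s| < `|t| -> set_coord x ord0 s <> 0 ->
  J (set_coord x ord0 t) < J (set_coord x ord0 s).
Proof. by rewrite -!pt_set_coord; exact: J_J2. Qed.

Lemma set_coord_id x : set_coord x ord0 (x ord0 ord0) = x.
Proof. by apply/rowP => i; rewrite set_coordE; case: eqP => [->|]. Qed.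

(** (J2) does not compare points with equal |z_1|. But for a rational q the set where J o refl 0 < q < J
    is null: each of its parts z_1 > 0 and z_1 < 0 is disjoint from its translates along x_1. *)
Lemma kernel_refl0 : mu [set z | J (refl 0 z) <> J z] = 0%E.
Proof.
have mJ := measurable_fun_punctured J_measurable.
have mJQ : measurable_fun [set: T] (fun z : T => J (refl 0 z)).
  exact: (measurableT_comp mJ (leb_measurable_isometry (isometry_refl 0))).
(* on each side of x_1 = 0 translating away decreases J and J o refl 0 *)
pose D (q : rat) : set V := [set z | J (refl 0 z) < ratr q < J z].
have mD q : measurable (D q : set T).
  rewrite (_ : D q = [set z | ratr q < J z] `&` [set z | - ratr q < - J (refl 0 z)]).
    apply: measurableI; first exact: measurable_fun_ltc mJ.
    by apply: measurable_fun_ltc; exact: measurable_funN.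
  apply/seteqP; split=> z; rewrite /D/= ltrN2; first by move=> /andP[].
  by move=> [-> ->].
have mx0 := @leb_measurable_coord R n ord0.
have D0p q : mu (D q `&` [set z | 0 < z ord0 ord0]) = 0%E.
  apply: (leb_disjoint_translates (i := ord0)).
    by apply: measurableI => //; exact: measurable_fun_ltc.
  move=> x t t0 [/andP[Jq qJ] /= x0] [/andP[_ +] _]; apply/negP; rewrite -leNgt.
  have -> : x + t *: delta_mx ord0 ord0 = set_coord x ord0 (x ord0 ord0 + t).
    apply/rowP => i; rewrite set_coordE !mxE eqxx/=; case: eqP => [->|_].
      by rewrite mulr1.
    by rewrite mulr0 addr0.
  apply/ltW/(lt_trans _ Jq); rewrite /refl mulr0 sub0r; apply: J2_set_coord.
    by rewrite normrN !gtr0_norm ?addr_gt0// ltrDl.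
  by move/rowP => /(_ ord0); rewrite set_coordE eqxx mxE => /eqP; rewrite oppr_eq0 gt_eqF.
have D0n q : mu (D q `&` [set z | 0 < - z ord0 ord0]) = 0%E.
  apply: (leb_disjoint_translates (i := ord0)).
    by apply: measurableI => //; apply: measurable_fun_ltc; exact: measurable_funN.
  move=> x t t0 [/andP[_ qJ] /= x0] [/andP[+ _] /=]; rewrite !mxE/= mulr1 => + xt.
  apply/negP; rewrite -leNgt; apply/ltW/(lt_trans qJ).
  have -> : refl 0 (x + t *: delta_mx ord0 ord0) = set_coord x ord0 (- (x ord0 ord0 + t)).
    apply/rowP => i; rewrite reflE set_coordE !mxE eqxx/=; case: eqP => _ /=; ring.
  rewrite -{1}(set_coord_id x); apply: J2_set_coord.
    rewrite normrN !ltr0_norm; lra.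
  by move/rowP => /(_ ord0); rewrite set_coordE eqxx mxE; lra.
have D0 q : mu (D q) = 0%E.
  apply/eqP; rewrite eq_le leb_ge0 andbT.
  rewrite (le_trans (_ : _ <= mu ((D q `&` [set z : V | 0 < z ord0 ord0]%R) `|`
      (D q `&` [set z : V | 0 < - z ord0 ord0]%R)))%E)//; last first.
    by rewrite (le_trans (leb_subadd _ _))// D0p D0n adde0.
  apply: le_leb => z Dz; have [z0|z0|z0] := ltgtP (z ord0 ord0) 0.
  - by right; split => //=; rewrite oppr_gt0.
  - by left.
  - by case/andP: Dz; rewrite (refl_fix z0) => /lt_trans/[apply]; rewrite ltxx.
apply/eqP; rewrite eq_le leb_ge0 andbT.
rewrite -(@leb_bigcup0_count R n rat (fun q => D q `|` refl 0 @^-1` (D q))); last first.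
  move=> q; apply/eqP; rewrite eq_le leb_ge0 andbT (le_trans (leb_subadd _ _))//.
  by rewrite (leb_isometry _ (isometry_refl 0)) D0 adde0.
apply: le_leb => z /= /eqP; rewrite neq_lt => /orP[] /rat_in_itvoo[q].
  by rewrite in_itv/= => qJ; exists q => //; left.
by rewrite in_itv/= => qJ; exists q => //; right; rewrite /D/= reflK.
Qed.

End normalized_kernels.

Section kernel_representative.
Context (R : realType) (n : nat).
Local Notation V := 'rV[R]_n.+1.
Local Notation T := (lebRN R n).
Local Notation mu := (@leb R n).
Local Notation borRN := (borRN R n).
Implicit Types (x y z h : V) (A U : set V) (i : 'I_n.+1).

Lemma ae_isometry2 (tau1 tau2 : V -> V) (P : V -> Prop) :
  box_isometry tau1 -> box_isometry tau2 ->
  {ae mu, forall x, P x} -> {ae mu, forall x, P (tau1 (tau2 x))}.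
Proof. by move=> t1 t2 /(ae_isometry t1)/(ae_isometry t2). Qed.

Lemma bor_measurable_refl l : measurable_fun [set: borRN] (refl l : borRN -> borRN).
Proof.
apply: measurable_fun_bor => i; under eq_fun do rewrite reflE.
case: eqP => _; last exact: bor_measurable_coord.
by apply: measurable_funB => //; exact: bor_measurable_coord.
Qed.

Lemma bor_measurable_opp : measurable_fun [set: borRN] (@GRing.opp V : borRN -> borRN).
Proof.
apply: measurable_fun_bor => i; under eq_fun do rewrite mxE.
by apply: measurable_funN; exact: bor_measurable_coord.
Qed.

Context (J : V -> R).
Hypotheses (J_measurable : measurable_fun ([set~ (0 : V)] : set T) (J : T -> R))
    (J_ge0 : forall z : V, z != 0 -> 0 <= J z)
    (J_even : forall z : V, z != 0 -> J (- z) = J z)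
    (J_J1 : J1 J) (J_J2 : J2 J).

(** The representative is the average of a Borel version of J over the four images of z
    under the sign changes, which J does not distinguish almost everywhere. *)
Lemma good_kernel_exists : exists2 j, good_kernel j & {ae mu, forall z, j z = J z}.
Proof.
have mJ := measurable_fun_punctured J_measurable.
have ae0 : {ae mu, forall z, z != 0}.
  apply/aeP; rewrite (_ : [set _ | _] = [set 0]); first exact: leb_set1.
  by apply/seteqP; split=> z /=; [move/negP; rewrite negbK => /eqP|move=> ->; rewrite eqxx].
have [g [mg g0 gJ]] := borel_version (measurableT_comp (@normr_measurable R setT) mJ)
  (fun x => normr_ge0 (J x)).
have {}gJ : {ae mu, forall z, g z = J z}.
  have : {ae mu, forall z, g z = `|J z|} by apply/aeP.
  move=> gJ'; near=> z; have -> : g z = `|J z| by near: z.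
  by rewrite ger0_norm// J_ge0//; near: z.
have JQ : {ae mu, forall z, J (refl 0 z) = J z}.
  by apply/aeP; exact: kernel_refl0.
pose j z := (g z + g (- z) + (g (refl 0 z) + g (- refl 0 z))) / 4.
have mj : measurable_fun [set: borRN] (j : borRN -> R).
  have mgQ := measurableT_comp mg (@bor_measurable_refl 0).
  have mgN := measurableT_comp mg bor_measurable_opp.
  have mgNQ := measurableT_comp mgN (@bor_measurable_refl 0).
  apply: measurable_funM => //; apply: measurable_funD; apply: measurable_funD => //.
have j0 z : 0 <= j z by rewrite divr_ge0// !addr_ge0.
have jJ : {ae mu, forall z, j z = J z}.
  have gN := ae_isometry (@isometry_opp R n) gJ.
  have gQ := ae_isometry (isometry_refl 0) gJ.
  have gNQ := ae_isometry2 (@isometry_opp R n) (isometry_refl 0) gJ.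
  near=> z.
  have z0 : z != 0 by near: z.
  have Q0 : refl 0 z != 0.
    apply: contra z0 => /eqP Q; rewrite -(reflK 0 z) Q; apply/eqP/rowP => i.
    by rewrite reflE !mxE mulr0 subrr if_same.
  have e1 : g z = J z by near: z.
  have e2 : g (- z) = J (- z) by near: z.
  have e3 : g (refl 0 z) = J (refl 0 z) by near: z.
  have e4 : g (- refl 0 z) = J (- refl 0 z) by near: z.
  have e5 : J (refl 0 z) = J z by near: z.
  rewrite /j e1 e2 e3 e4 !J_even// e5; lra.
have mjT := bor_leb_measurable_fun mj.
have mjE : measurable_fun [set: T] (fun z : T => (j z)%:E) by exact/measurable_EFinP.
have mJE : measurable_fun [set: T] (fun z : T => (J z)%:E) by exact/measurable_EFinP.
exists j => //; split; split => //.
- by move=> z; rewrite /j refl0N !opprK [g (- z) + _]addrC [g (- refl 0 z) + _]addrC.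
- by move=> z; rewrite /j reflK addrC.
- have mb := @measurable_eball1 R n.
  have msq := @measurable_sqn R n.
  have mF : measurable_fun [set: T] (fun z : T => (Num.min 1 (sqn z) * j z)%:E).
    apply/measurable_EFinP; apply: measurable_funM; last exact: mjT.
    by apply: measurable_minr; [exact: measurable_cst|exact: msq].
  have F0 z : (0 <= (Num.min 1 (sqn z) * j z)%:E)%E.
    by rewrite lee_fin mulr_ge0// le_min ler01 sqn_ge0.
  rewrite -(setvU (@eball1 R n)).
  rewrite ge0_integral_setU; [|exact: (measurableC mb)|exact: mb|by rewrite setvU|
    by move=> z _; exact: F0|by apply/disj_setPCr].
  have [Joo _] := J_J1; apply: le_lt_trans Joo; apply: leeD.
    apply: (@le_trans _ _ (\int[mu]_(z in ~` eball1) (j z)%:E)%E).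
      apply: ge0_le_integral.
      - exact: (measurableC mb).
      - by move=> z _; exact: F0.
      - exact: (measurable_funTS mF).
      - exact: (measurable_funTS mjE).
      - by move=> z _; rewrite lee_fin ler_piMl// ge_min lexx.
    rewrite le_eqVlt; apply/orP; left; apply/eqP; apply: ae_eq_integral.
    - exact: (measurableC mb).
    - exact: (measurable_funTS mjE).
    - exact: (measurable_funTS mJE).
    - by near=> z => _; congr EFin; near: z.
  have msqM (h : V -> R) : measurable_fun [set: T] (h : T -> R) ->
      measurable_fun [set: T] (fun z : T => (enorm z ^+ 2 * h z)%:E).
    move=> mh; apply/measurable_EFinP; apply: measurable_funM; last exact: mh.
    by under eq_fun do rewrite enorm_sqr; exact: msq.
  apply: (@le_trans _ _ (\int[mu]_(z in eball1) (enorm z ^+ 2 * j z)%:E)%E).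
    apply: ge0_le_integral.
    - exact: mb.
    - by move=> z _; exact: F0.
    - exact: (measurable_funTS mF).
    - exact: (measurable_funTS (msqM _ mjT)).
    - by move=> z _; rewrite lee_fin enorm_sqr ler_wpM2r// ge_min lexx orbT.
  rewrite le_eqVlt; apply/orP; left; apply/eqP; apply: ae_eq_integral.
  - exact: mb.
  - exact: (measurable_funTS (msqM _ mjT)).
  - exact: (measurable_funTS (msqM _ mJ)).
  - by near=> z => _; congr (_ * _)%:E; near: z.
- have [_ Joo] := J_J1; apply/eqP; rewrite -leye_eq -Joo.
  have m0 : measurable ([set~ (0 : V)] : set T).
    by apply: measurableC; exact: leb_null_measurable (leb_set1 _).
  rewrite (ae_eq_integral (fun z : T => (j z)%:E)).
  + apply: ge0_subset_integral.
    * exact: m0.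
    * exact: measurableT.
    * exact: mjE.
    * by move=> z _; rewrite lee_fin.
    * exact: subsetT.
  + exact: m0.
  + exact: (measurable_funTS mJE).
  + exact: (measurable_funTS mjE).
  + by near=> z => _; congr EFin; apply/esym; near: z.
- move=> l x lx.
  have ae1 := ae_isometry (isometry_subl x) jJ.
  have ae2 := ae_isometry2 (isometry_subl x) (isometry_refl l) jJ.
  have ae3 := ae_isometry (isometry_subl x) ae0.
  near=> y => ly.
  have -> : j (x - y) = J (x - y) by near: y.
  have -> : j (x - refl l y) = J (x - refl l y) by near: y.
  have xy : x - y != 0 by near: y.
  have -> : x - refl l y = set_coord (x - y) ord0 (x ord0 ord0 + y ord0 ord0 - 2 * l).
    by apply/rowP => i; rewrite set_coordE !(reflE, mxE); case: eqP => [->|_]; ring.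
  rewrite -[X in _ < J X](set_coord_id (x - y)); apply: J2_set_coord => //.
    rewrite !mxE [ltRHS]ger0_norm; last lra.
    by rewrite ltr_norml; apply/andP; split; lra.
  by rewrite set_coord_id; exact/eqP.
Unshelve. all: by end_near. Qed.

End kernel_representative.

(** * Integrals over the product space *)

Section ae_integrals.
Context d (X : measurableType d) (R : realType) (m : {measure set X -> \bar R}).

Lemma ae_le_Rintegral (f g : X -> R) :
  m.-integrable setT (EFin \o f) -> m.-integrable setT (EFin \o g) ->
  {ae m, forall x, f x <= g x} -> \int[m]_x f x <= \int[m]_x g x.
Proof.
move=> fi gi fg; rewrite -subr_ge0 -RintegralB//.
have di : m.-integrable setT (fun x => (g x - f x)%:E) by exact: (integrableB measurableT gi fi).
rewrite fine_ge0// (ae_eq_integral (fun x => `|(g x - f x)%:E|)%E)//.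
- by apply: integral_ge0 => x _; exact: abse_ge0.
- exact: measurable_int di.
- by apply: measurableT_comp => //; exact: measurable_int di.
- by apply: filterS fg => x fgx _; rewrite gee0_abs// lee_fin subr_ge0.
Qed.

Lemma ae_le_integrable (f g : X -> R) : measurable_fun setT f ->
  m.-integrable setT (EFin \o g) ->
  {ae m, forall x, `|f x| <= g x} -> m.-integrable setT (EFin \o f).
Proof.
move=> mf gi fg; apply/integrableP; split; first exact/measurable_EFinP.
have /integrableP[mg goo] := gi; apply: le_lt_trans goo.
apply: ae_ge0_le_integral => //.
- by apply: measurableT_comp => //; exact/measurable_EFinP.
- exact: measurableT_comp.
- by apply: filterS fg => x fgx _ /=; rewrite lee_fin (le_trans fgx)// ler_norm.
Qed.

Lemma ae_eq_Rintegral (f g : X -> R) : measurable_fun setT f -> measurable_fun setT g ->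
  {ae m, forall x, f x = g x} -> \int[m]_x f x = \int[m]_x g x.
Proof.
move=> mf mg fg; congr fine; apply: ae_eq_integral => //; [exact/measurable_EFinP..|].
by apply: filterS fg => x fgx _; rewrite /= fgx.
Qed.

Lemma ae_eq_integrable (f g : X -> R) : measurable_fun setT g ->
  {ae m, forall x, f x = g x} ->
  m.-integrable setT (EFin \o f) -> m.-integrable setT (EFin \o g).
Proof.
move=> mg fg fi; apply: (ae_le_integrable mg (integrable_norm fi)).
by apply: filterS fg => x fgx; rewrite /= fgx.
Qed.

(** Invariance is required of nonnegative functions only, so that it follows from
    the theorem of Tonelli; integrable functions inherit it. *)
Definition integral_preserving (theta : X -> X) := measurable_fun setT theta /\
  forall f : X -> \bar R, measurable_fun setT f -> (forall x, 0 <= f x)%E ->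
    (\int[m]_x f (theta x) = \int[m]_x f x)%E.

Lemma integral_preservingP theta (f : X -> \bar R) : integral_preserving theta ->
  measurable_fun setT f -> (\int[m]_x f (theta x) = \int[m]_x f x)%E.
Proof.
move=> [mt tP] mf; rewrite -[fun x => f (theta x)]/(f \o theta) integralE [RHS]integralE.
rewrite funepos_comp funeneg_comp; congr (_ - _)%E.
  exact: (tP _ (measurable_funepos mf)).
exact: (tP _ (measurable_funeneg mf)).
Qed.

Lemma integrable_preserving theta (f : X -> \bar R) : integral_preserving theta ->
  m.-integrable setT f -> m.-integrable setT (f \o theta).
Proof.
move=> tP /integrableP[mf foo]; apply/integrableP; split.
  exact: (measurableT_comp mf tP.1).
rewrite (integral_preservingP (f := fun x => `|f x|)%E tP)//.
exact: measurableT_comp.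
Qed.

Lemma ae_preserving theta (P : X -> Prop) : integral_preserving theta ->
  {ae m, forall x, P x} -> {ae m, forall x, P (theta x)}.
Proof.
move=> [mt tP] [N [mN N0 PN]]; exists (theta @^-1` N); split.
- by rewrite -[_ @^-1` _]setTI; exact: mt.
- have mtN : measurable (theta @^-1` N) by rewrite -[_ @^-1` _]setTI; exact: mt.
  rewrite -[_ @^-1` _]setIT -integral_indic//.
  rewrite -(setIT N) -integral_indic// in N0; rewrite -[RHS]N0.
  transitivity (\int[m]_x (\1_N (theta x))%:E)%E.
    by apply: eq_integral => x _; rewrite !indicE; congr (_%:R%:E)%E; apply/idP/idP; rewrite !inE.
  by apply: (tP (fun x => (\1_N x)%:E)%E) => //; exact/measurable_EFinP.
- by move=> x nPx; exact: (PN (theta x)).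
Qed.

End ae_integrals.

Section product.
Context (R : realType) (n : nat).
Local Notation V := 'rV[R]_n.+1.
Local Notation T := (lebRN R n).
Local Notation mu := (@leb R n).
Local Notation pi := (product_measure1 mu mu).
Implicit Types (x y z h : V).

#[export] Instance pi_ae_filter : Filter (almost_everywhere pi).
Proof. exact: ae_filter_ringOfSetsType. Qed.

Lemma pi_preserving_isometry (t1 t2 : V -> V) : box_isometry t1 -> box_isometry t2 ->
  integral_preserving pi (fun p : T * T => (t1 p.1 : T, t2 p.2 : T)).
Proof.
move=> i1 i2; have m1 := leb_measurable_isometry i1; have m2 := leb_measurable_isometry i2.
have mt : measurable_fun setT (fun p : T * T => (t1 p.1 : T, t2 p.2 : T)).
  apply: measurable_fun_pair; first exact: (measurableT_comp m1 measurable_fst).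
  exact: (measurableT_comp m2 measurable_snd).
split=> // f mf f0.
rewrite fubini_tonelli1//; last exact: (measurableT_comp mf mt).
rewrite fubini_tonelli1// /fubini_F.
have mF := measurable_fun_fubini_tonelli_F (m2 := mu) f mf f0.
rewrite -(leb_integral_isometry (f := fubini_F mu f) i1)// /fubini_F.
apply: eq_integral => x _ /=.
apply: (leb_integral_isometry (f := fun y => f (t1 x, y)) i2).
exact: (measurable_fun_pair2 _ mf).
Qed.

Lemma pi_preserving_swap : integral_preserving pi (fun p : T * T => (p.2, p.1)).
Proof.
have mt : measurable_fun setT (fun p : T * T => (p.2, p.1)).
  exact: measurable_fun_pair.
split=> // f mf f0.
rewrite fubini_tonelli1//; last exact: (measurableT_comp mf mt).
by rewrite [RHS]fubini_tonelli2.
Qed.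

Lemma ae_fst (P : V -> Prop) : {ae mu, forall x, P x} -> {ae pi, forall p, P p.1}.
Proof.
move=> [N [mN N0 PN]]; exists (N `*` setT); split.
- exact: measurableX.
- transitivity (mu N * mu setT)%E; last by rewrite N0 mul0e.
  exact: product_measure1E.
- by move=> p /PN.
Qed.

Lemma ae_snd (P : V -> Prop) : {ae mu, forall x, P x} -> {ae pi, forall p, P p.2}.
Proof.
move=> [N [mN N0 PN]]; exists (setT `*` N); split.
- exact: measurableX.
- transitivity (mu setT * mu N)%E; last by rewrite N0 mule0.
  exact: product_measure1E.
- by move=> p /PN.
Qed.

(** Strict monotonicity of the kernel holds for every x and almost every y; with measurability
    it then holds for almost every pair. *)
Lemma pi_null_sections (D : set (T * T)) : measurable D ->
  (forall x, mu [set y | D (x, y)] = 0%E) -> pi D = 0%E.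
Proof.
move=> mD D0; rewrite /product_measure1 integral0_eq// => x _ /=.
by rewrite -(D0 x); congr (lebesgue_outer _); apply/seteqP; split=> y; rewrite /xsection/= inE.
Qed.

End product.

(** * Energies and their symmetrization *)

Section energy.
Context (R : realType) (n : nat).
Local Notation V := 'rV[R]_n.+1.
Local Notation T := (lebRN R n).
Local Notation mu := (@leb R n).
Local Notation borRN := (borRN R n).
Local Notation pi := (product_measure1 mu mu).
Implicit Types (x y z h : V) (u v w phi : V -> R).

Definition kern (j : V -> R) (p : T * T) : R := j (p.1 - p.2).

Definition energy_density (j : V -> R) u v (p : T * T) : R :=
  (u p.1 - u p.2) * (v p.1 - v p.2) * kern j p.

Definition finite_energy (j : V -> R) u := measurable_fun [set: T] (u : T -> R) /\
  pi.-integrable setT (EFin \o energy_density j u u).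

Definition energy_form (j : V -> R) u v : R := \int[pi]_p energy_density j u v p.

Lemma measurable_fun_fst u : measurable_fun [set: T] (u : T -> R) ->
  measurable_fun [set: T * T] (fun p : T * T => u p.1).
Proof. by move=> mu_; exact: (measurableT_comp mu_ measurable_fst). Qed.

Lemma measurable_fun_snd u : measurable_fun [set: T] (u : T -> R) ->
  measurable_fun [set: T * T] (fun p : T * T => u p.2).
Proof. by move=> mu_; exact: (measurableT_comp mu_ measurable_snd). Qed.

Lemma measurable_sub_bor :
  measurable_fun [set: T * T] (fun p : T * T => (p.1 : V) - p.2 : borRN).
Proof.
apply: measurable_fun_bor => i; under eq_fun do rewrite 2!mxE.
apply: measurable_funB.
  exact: (measurable_fun_fst (@leb_measurable_coord R n i)).
exact: (measurable_fun_snd (@leb_measurable_coord R n i)).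
Qed.

Context (j : V -> R) (jG : good_kernel j).
Local Notation k := (kern j).
Local Notation E := (energy_density j).

Let mj : measurable_fun [set: borRN] (j : borRN -> R). Proof. by case: jG => -[]. Qed.
Let j0 z : 0 <= j z. Proof. by case: jG => -[_ + _ _ _]; apply. Qed.
Let jN z : j (- z) = j z. Proof. by case: jG => -[_ _ + _ _]; apply. Qed.
Let jQ z : j (refl 0 z) = j z. Proof. by case: jG => -[_ _ _ + _]; apply. Qed.

Lemma kern_ge0 p : 0 <= k p. Proof. exact: j0. Qed.

Lemma measurable_kern : measurable_fun [set: T * T] k.
Proof. exact: (measurableT_comp mj measurable_sub_bor). Qed.

Lemma kern_refl2 l x y : k (refl l x, refl l y) = k (x, y).
Proof. by rewrite /kern/= refl_sub jQ. Qed.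

Lemma kern_refl l x y : k (refl l x, y) = k (x, refl l y).
Proof. by rewrite /kern/= refl_subl jQ. Qed.

Lemma measurable_energy_density u v : measurable_fun [set: T] (u : T -> R) ->
  measurable_fun [set: T] (v : T -> R) -> measurable_fun setT (E u v).
Proof.
move=> mu_ mv; apply: measurable_funM; last exact: measurable_kern.
by apply: measurable_funM; apply: measurable_funB;
  do [exact: measurable_fun_fst|exact: measurable_fun_snd].
Qed.

Lemma energy_density_ge0 u p : 0 <= E u u p.
Proof. by rewrite mulr_ge0 ?kern_ge0// -expr2 sqr_ge0. Qed.

(** By 2 |a b| <= a^2 + b^2. *)
Lemma integrable_energy_density u v : finite_energy j u -> finite_energy j v ->
  pi.-integrable setT (EFin \o E u v).
Proof.
move=> [mu_ iu] [mv iv]; apply: (le_integrable measurableT _ _ (integrableD measurableT iu iv)).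
  by apply/measurable_EFinP; exact: measurable_energy_density.
move=> p _ /=; rewrite lee_fin [leRHS]ger0_norm ?addr_ge0 ?energy_density_ge0//.
rewrite /energy_density -mulrDl normrM (ger0_norm (kern_ge0 _)) ler_wpM2r ?kern_ge0//.
move: (_ - _) (_ - _) => a b; have := sqr_ge0 (a + b); have := sqr_ge0 (a - b).
by rewrite ler_norml => ? ?; apply/andP; split; nra.
Qed.

Lemma finite_energy_lincomb a b u v : finite_energy j u -> finite_energy j v ->
  finite_energy j (fun x => a * u x + b * v x).
Proof.
move=> eu ev; have iuv := integrable_energy_density eu ev.
have [mu_ iu] := eu; have [mv iv] := ev; split.
  by apply: measurable_funD; exact: measurable_funM.
have := integrableD measurableT (integrableZl measurableT (a ^+ 2) iu)
  (integrableD measurableT (integrableZl measurableT (2 * (a * b)) iuv)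
    (integrableZl measurableT (b ^+ 2) iv)).
apply: eq_integrable => // p _ /=; rewrite /energy_density -!EFinM -!EFinD; congr EFin.
ring.
Qed.

Lemma energy_form_lincomb a b u v w : finite_energy j u -> finite_energy j v ->
  finite_energy j w -> energy_form j (fun x => a * u x + b * v x) w =
  a * energy_form j u w + b * energy_form j v w.
Proof.
move=> eu ev ew; have iu := integrable_energy_density eu ew.
have iv := integrable_energy_density ev ew.
rewrite /energy_form -!RintegralZl// -RintegralD//; last 2 first.
- exact: (integrableZl measurableT a iu).
- exact: (integrableZl measurableT b iv).
by apply: eq_Rintegral => p _; rewrite /energy_density; ring.
Qed.

Lemma finite_energy_refl l u : finite_energy j u -> finite_energy j (u \o refl l).
Proof.
move=> [mu_ iu]; split; first exact: (measurableT_comp mu_ (leb_measurable_isometry (isometry_refl l))).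
have := integrable_preserving (pi_preserving_isometry (isometry_refl l) (isometry_refl l)) iu.
by apply: eq_integrable => // p _ /=; rewrite /energy_density/= kern_refl2; case: p.
Qed.

Lemma energy_form_refl l u v : finite_energy j u -> finite_energy j v ->
  energy_form j (u \o refl l) (v \o refl l) = energy_form j u v.
Proof.
move=> eu ev; have /(measurable_int pi) mE := integrable_energy_density eu ev.
congr fine; rewrite -(integral_preservingP (pi_preserving_isometry (isometry_refl l) (isometry_refl l)) mE).
by apply: eq_integral => -[x y] _ /=; rewrite /energy_density/= kern_refl2.
Qed.

Lemma ae_eq_energy_form u u' v : measurable_fun [set: T] (u : T -> R) ->
  measurable_fun [set: T] (u' : T -> R) -> measurable_fun [set: T] (v : T -> R) ->
  {ae mu, forall x, u x = u' x} -> energy_form j u v = energy_form j u' v.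
Proof.
move=> mu_ mu' mv uu'; apply: ae_eq_Rintegral.
- exact: measurable_energy_density.
- exact: measurable_energy_density.
have uu1 := ae_fst uu'; have uu2 := ae_snd uu'.
near=> p; rewrite /energy_density.
have -> : u p.1 = u' p.1 by near: p.
by have -> : u p.2 = u' p.2 by near: p.
Unshelve. all: by end_near. Qed.

Lemma energy_formC u v : energy_form j u v = energy_form j v u.
Proof. by apply: eq_Rintegral => p _; rewrite /energy_density [_ * (v _ - _)]mulrC. Qed.

Lemma ae_eq_finite_energy u u' : measurable_fun [set: T] (u' : T -> R) ->
  {ae mu, forall x, u x = u' x} -> finite_energy j u -> finite_energy j u'.
Proof.
move=> mu' uu' [mu_ iu]; split=> //; apply: (ae_eq_integrable _ _ iu).
  exact: measurable_energy_density.
have uu1 := ae_fst uu'; have uu2 := ae_snd uu'.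
near=> p; rewrite /energy_density.
have -> : u p.1 = u' p.1 by near: p.
by have -> : u p.2 = u' p.2 by near: p.
Unshelve. all: by end_near. Qed.

Lemma ae_kern_lt l : {ae pi, forall p : T * T, l < p.1 ord0 ord0 -> l < p.2 ord0 ord0 ->
  k (p.1, refl l p.2) < k p}.
Proof.
have mc := @leb_measurable_coord R n ord0.
pose D := [set p : T * T | l < p.1 ord0 ord0] `&` [set p : T * T | l < p.2 ord0 ord0] `&`
  [set p : T * T | k p <= k (p.1, refl l p.2)].
have mk2 : measurable_fun [set: T * T] (fun p : T * T => k (p.1, refl l p.2 : T)).
  apply: (measurableT_comp measurable_kern); apply: measurable_fun_pair => //.
  exact: (measurableT_comp (leb_measurable_isometry (isometry_refl l)) measurable_snd).
have mD : measurable D.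
  apply: measurableI; first apply: measurableI.
  - have := measurable_fun_fst mc measurableT (measurable_itv `]l, +oo[).
    by rewrite setTI; congr measurable; apply/seteqP; split=> p /=; rewrite in_itv/= andbT.
  - have := measurable_fun_snd mc measurableT (measurable_itv `]l, +oo[).
    by rewrite setTI; congr measurable; apply/seteqP; split=> p /=; rewrite in_itv/= andbT.
  - have := measurable_funB mk2 measurable_kern measurableT (measurable_itv `[0, +oo[).
    rewrite setTI; congr measurable; apply/seteqP; split=> p /=; rewrite in_itv/= andbT.
      by rewrite subr_ge0.
    by rewrite subr_ge0.
exists D; split => //.
  apply: pi_null_sections => // x; have [lx|xl] := ltP l (x ord0 ord0); last first.
    rewrite (_ : [set _ | _] = set0) ?measure0//.
    by apply/seteqP; split=> y //= -[[/= + _] _]; rewrite ltNge xl.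
  have [_ [_ _ /(_ l x lx) /aeP]] := jG.
  move=> H; apply/eqP; rewrite eq_le leb_ge0 andbT -[leRHS]H.
  by apply: le_leb => y [[/= _ ly]]; rewrite /kern/= leNgt => /negP H1 H2; exact/H1/H2.
move=> p /= /not_implyP[l1] /not_implyP[l2] /negP; rewrite -leNgt => kp.
by split.
Qed.

Lemma ae_kern_le l : {ae pi, forall p : T * T, l <= p.1 ord0 ord0 -> l <= p.2 ord0 ord0 ->
  k (p.1, refl l p.2) <= k p}.
Proof.
apply: filterS (ae_kern_lt l) => -[x y] /= H.
rewrite le_eqVlt => /predU1P[lx _|lx]; first by rewrite -kern_refl refl_fix.
rewrite le_eqVlt => /predU1P[ly|ly]; first by rewrite refl_fix.
exact/ltW/H.
Qed.

(** Four times the average over the group generated by the reflections of the two variables. *)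
Definition quad l (A : T * T -> R) (p : T * T) : R :=
  A p + A (refl l p.1, p.2) + A (p.1, refl l p.2) + A (refl l p.1, refl l p.2).

Let Q1 l (p : T * T) : T * T := (refl l p.1 : T, p.2).
Let Q2 l (p : T * T) : T * T := (p.1, refl l p.2 : T).
Let Q12 l (p : T * T) : T * T := (refl l p.1 : T, refl l p.2 : T).

Lemma isometry_id : box_isometry (@id V).
Proof. by exists (fun=> false), 0 => x i; rewrite mxE expr0 mul1r addr0. Qed.

Let Q1P l : integral_preserving pi (Q1 l).
Proof. exact: (pi_preserving_isometry (isometry_refl l) isometry_id). Qed.
Let Q2P l : integral_preserving pi (Q2 l).
Proof. exact: (pi_preserving_isometry isometry_id (isometry_refl l)). Qed.
Let Q12P l : integral_preserving pi (Q12 l).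
Proof. exact: (pi_preserving_isometry (isometry_refl l) (isometry_refl l)). Qed.

Lemma integrable_quad l A : pi.-integrable setT (EFin \o A) ->
  pi.-integrable setT (EFin \o quad l A).
Proof.
move=> iA; have i1 := integrable_preserving (Q1P l) iA.
have i2 := integrable_preserving (Q2P l) iA; have i12 := integrable_preserving (Q12P l) iA.
exact: (integrableD measurableT (integrableD measurableT (integrableD measurableT iA i1) i2) i12).
Qed.

Lemma Rintegral_quad l A : pi.-integrable setT (EFin \o A) ->
  \int[pi]_p quad l A p = 4 * \int[pi]_p A p.
Proof.
move=> iA; have i1 := integrable_preserving (Q1P l) iA.
have i2 := integrable_preserving (Q2P l) iA; have i12 := integrable_preserving (Q12P l) iA.
have mA := measurable_int pi iA.
rewrite /quad RintegralD//; last first.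
  exact: (integrableD measurableT (integrableD measurableT iA i1) i2).
rewrite RintegralD//; last exact: (integrableD measurableT iA i1).
rewrite RintegralD//.
have e1 : \int[pi]_p A (Q1 l p) = \int[pi]_p A p.
  by congr fine; exact: (integral_preservingP (Q1P l) mA).
have e2 : \int[pi]_p A (Q2 l p) = \int[pi]_p A p.
  by congr fine; exact: (integral_preservingP (Q2P l) mA).
have e12 : \int[pi]_p A (Q12 l p) = \int[pi]_p A p.
  by congr fine; exact: (integral_preservingP (Q12P l) mA).
rewrite [X in _ + X + _ + _]e1 [X in _ + X + _]e2 [X in _ + X]e12; ring.
Qed.

(** An inequality between symmetrized functions has only to be checked on the closed half
    space, the symmetrization being invariant under reflections of each variable. *)
Lemma ae_quad_le l (A B : T * T -> R) :
  {ae pi, forall p : T * T, l <= p.1 ord0 ord0 -> l <= p.2 ord0 ord0 -> quad l A p <= quad l B p} ->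
  {ae pi, forall p : T * T, quad l A p <= quad l B p}.
Proof.
move=> AB; have AB1 := ae_preserving (Q1P l) AB.
have AB2 := ae_preserving (Q2P l) AB; have AB12 := ae_preserving (Q12P l) AB.
have lE (x : V) : x ord0 ord0 < l -> l <= refl l x ord0 ord0.
  by move=> xl; rewrite reflE eqxx; lra.
near=> p.
have quadE (C : T * T -> R) : [/\ quad l C (Q1 l p) = quad l C p,
    quad l C (Q2 l p) = quad l C p & quad l C (Q12 l p) = quad l C p].
  by rewrite /quad/Q1/Q2/Q12/= !reflK -surjective_pairing; split; ring.
have [a1 a2 a3] := quadE A; have [b1 b2 b3] := quadE B.
have H : l <= p.1 ord0 ord0 -> l <= p.2 ord0 ord0 -> quad l A p <= quad l B p by near: p.
have H1 : l <= refl l p.1 ord0 ord0 -> l <= p.2 ord0 ord0 -> quad l A (Q1 l p) <= quad l B (Q1 l p).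
  by near: p.
have H2 : l <= p.1 ord0 ord0 -> l <= refl l p.2 ord0 ord0 -> quad l A (Q2 l p) <= quad l B (Q2 l p).
  by near: p.
have H3 : l <= refl l p.1 ord0 ord0 -> l <= refl l p.2 ord0 ord0 ->
    quad l A (Q12 l p) <= quad l B (Q12 l p) by near: p.
have [p1l|p1l] := leP l (p.1 ord0 ord0); have [p2l|p2l] := leP l (p.2 ord0 ord0).
- exact: H.
- by rewrite -a2 -b2; apply: H2 => //; exact: lE.
- by rewrite -a1 -b1; apply: H1 => //; exact: lE.
- by rewrite -a3 -b3; apply: H3; exact: lE.
Unshelve. all: by end_near. Qed.

Lemma quad_le_Rintegral l (A B : T * T -> R) : pi.-integrable setT (EFin \o A) ->
  pi.-integrable setT (EFin \o B) ->
  {ae pi, forall p : T * T, l <= p.1 ord0 ord0 -> l <= p.2 ord0 ord0 -> quad l A p <= quad l B p} ->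
  \int[pi]_p A p <= \int[pi]_p B p.
Proof.
move=> iA iB /ae_quad_le AB.
have := ae_le_Rintegral (integrable_quad l iA) (integrable_quad l iB) AB.
by rewrite !Rintegral_quad// ler_pM2l.
Qed.

Lemma quad_le_integrable l (A B : T * T -> R) : measurable_fun setT A -> (forall p, 0 <= A p) ->
  pi.-integrable setT (EFin \o B) ->
  {ae pi, forall p : T * T, l <= p.1 ord0 ord0 -> l <= p.2 ord0 ord0 -> quad l A p <= quad l B p} ->
  pi.-integrable setT (EFin \o A).
Proof.
move=> mA A0 iB /ae_quad_le AB; apply: (ae_le_integrable mA (integrable_quad l iB)).
apply: filterS AB => p; apply: le_trans; rewrite ger0_norm// /quad -!addrA lerDl.
by rewrite !addr_ge0.
Qed.

End energy.

(** * Negative parts of odd functions *)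

Section antisymmetric.
Context (R : realType) (n : nat).
Local Notation V := 'rV[R]_n.+1.
Local Notation T := (lebRN R n).
Local Notation mu := (@leb R n).
Local Notation pi := (product_measure1 mu mu).
Implicit Types (x y z : V) (u v w phi g h : V -> R) (l : R).

(** Algebra of the energy at a pair of points and its mirror images: K and C are the interactions with
    the point and with its mirror image, a and b the values of an odd function, p and q its
    negative parts. *)
Lemma quad_energy_bound (a b K C : R) (p := Num.max 0 (- a))
    (q := Num.max 0 (- b)) : 0 <= C -> C <= K ->
  (p - q) ^+ 2 * K + q ^+ 2 * C + p ^+ 2 * C <=
  2 * ((a - b) ^+ 2 * K) + 2 * ((a + b) ^+ 2 * C).
Proof.
move=> C0 CK.
have pq : (p - q) ^+ 2 <= (a - b) ^+ 2.
  rewrite /p /q; have [a0|a0] := leP 0 (- a); have [b0|b0] := leP 0 (- b).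
  - lra.
  - have : 0 <= (- a) * b by rewrite mulr_ge0//; lra.
    have := sqr_ge0 b; lra.
  - have : 0 <= a * (- b) by rewrite mulr_ge0//; lra.
    have := sqr_ge0 a; lra.
  - have := sqr_ge0 (a - b); lra.
have pa : p ^+ 2 <= a ^+ 2.
  by rewrite /p; have [?|?] := leP 0 (- a); have := sqr_ge0 a; lra.
have qb : q ^+ 2 <= b ^+ 2.
  by rewrite /q; have [?|?] := leP 0 (- b); have := sqr_ge0 b; lra.
have h1 : (p - q) ^+ 2 * K <= (a - b) ^+ 2 * K by apply: ler_wpM2r => //; lra.
have h2 : (a - b) ^+ 2 * C <= (a - b) ^+ 2 * K by apply: ler_wpM2l => //; exact: sqr_ge0.
have h3 : (p ^+ 2 + q ^+ 2) * C <= (a ^+ 2 + b ^+ 2) * C by apply: ler_wpM2r => //; lra.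
have h4 : 0 <= (a ^+ 2 + b ^+ 2) * C by rewrite mulr_ge0// addr_ge0// sqr_ge0.
have e : (a - b) ^+ 2 * C + (a + b) ^+ 2 * C = 2 * ((a ^+ 2 + b ^+ 2) * C) by ring.
have h5 : 0 <= (a + b) ^+ 2 * C by rewrite mulr_ge0// sqr_ge0.
move: e h1 h2 h3 h4 h5; rewrite [(p ^+ 2 + q ^+ 2) * C]mulrDl.
move: ((p - q) ^+ 2 * K) ((a - b) ^+ 2 * K) ((a - b) ^+ 2 * C) ((a + b) ^+ 2 * C).
move: (p ^+ 2 * C) (q ^+ 2 * C) ((a ^+ 2 + b ^+ 2) * C) => *; lra.
Qed.

Lemma quad_form_bound (a b K C : R) (p := Num.max 0 (- a))
    (q := Num.max 0 (- b)) : 0 <= C -> C <= K ->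
  (a - b) * (p - q) * K + (a + b) * q * C + (a + b) * p * C <=
  - ((p - q) ^+ 2 * K + q ^+ 2 * C + p ^+ 2 * C).
Proof.
rewrite /p /q => C0 CK; have KC : 0 <= K - C by lra.
have [a0|a0] := leP 0 (- a); have [b0|b0] := leP 0 (- b).
- have : 0 <= (- a) * (- b) * C by rewrite !mulr_ge0.
  lra.
- have : 0 <= (- a) * b * (K - C) by rewrite !mulr_ge0// ltW//; lra.
  lra.
- have : 0 <= a * (- b) * (K - C) by rewrite !mulr_ge0// ltW//; lra.
  lra.
- lra.
Qed.

Lemma quad_form_bound2 (a b K C : R) (p := Num.max 0 (- a))
    (q := Num.max 0 (- b)) : 0 <= C -> C <= K ->
  (a - b) * (p - q) * K + (a + b) * q * C + (a + b) * p * C <=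
  - (p * Num.max 0 b * (K - C)).
Proof.
rewrite /p /q => C0 CK; have KC : 0 <= K - C by lra.
have K0 : 0 <= K by lra.
have [a0|a0] := leP 0 (- a); have [b0|b0] := leP 0 (- b); have [b1|b1] := leP 0 b.
- have -> : b = 0 by lra.
  have : 0 <= a ^+ 2 * K by rewrite mulr_ge0// sqr_ge0.
  have : 0 <= a ^+ 2 * C by rewrite mulr_ge0// sqr_ge0.
  lra.
- have : 0 <= (a - b) ^+ 2 * K by rewrite mulr_ge0// sqr_ge0.
  have : 0 <= (a + b) ^+ 2 * C by rewrite mulr_ge0// sqr_ge0.
  lra.
- have : 0 <= a ^+ 2 * K by rewrite mulr_ge0// sqr_ge0.
  have : 0 <= a ^+ 2 * C by rewrite mulr_ge0// sqr_ge0.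
  lra.
- lra.
- have -> : b = 0 by lra.
  lra.
- have : 0 <= a * (- b) * (K - C) by rewrite !mulr_ge0// ltW//; lra.
  have : 0 <= b ^+ 2 * K by rewrite mulr_ge0// sqr_ge0.
  have : 0 <= b ^+ 2 * C by rewrite mulr_ge0// sqr_ge0.
  lra.
- lra.
- lra.
Qed.

Context (j : V -> R) (jG : good_kernel j).
Local Notation k := (kern j).
Local Notation E := (energy_density j).

Definition half_neg l h x : R := if l < x ord0 ord0 then Num.max 0 (- h x) else 0.

Lemma half_neg_ge0 l h x : 0 <= half_neg l h x.
Proof. by rewrite /half_neg; case: ifP => // _; rewrite le_max lexx. Qed.

Definition refl_odd l h := forall x, h (refl l x) = - h x.

Lemma half_negE l h x : refl_odd l h -> l <= x ord0 ord0 ->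
  half_neg l h x = Num.max 0 (- h x).
Proof.
move=> hA; rewrite le_eqVlt => /predU1P[lx|lx]; last by rewrite /half_neg lx.
have hx : h x = 0 by have := hA x; rewrite refl_fix//; lra.
by rewrite /half_neg -lx ltxx hx oppr0 maxxx.
Qed.

Lemma half_neg_refl l h x : l <= x ord0 ord0 -> half_neg l h (refl l x) = 0.
Proof. by move=> lx; rewrite /half_neg reflE eqxx; case: ifP => //; lra. Qed.

Lemma measurable_half_space l : measurable ([set x : V | l < x ord0 ord0] : set T).
Proof. by apply: measurable_fun_ltc; exact: leb_measurable_coord. Qed.

Lemma measurable_half_neg l h : measurable_fun [set: T] (h : T -> R) ->
  measurable_fun [set: T] (half_neg l h : T -> R).
Proof.
move=> mh.
have -> : half_neg l h = (fun x => Num.max 0 (- h x) * \1_[set x : V | l < x ord0 ord0] x).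
  apply/funext => x; rewrite /half_neg indicE; case: ifPn => lx.
    by rewrite mem_set ?mulr1.
  by rewrite memNset ?mulr0//; exact/negP.
apply: measurable_funM; last exact: (measurable_indic (measurable_half_space l)).
exact: (measurable_maxr (measurable_cst (0 : R)) (measurable_funN mh)).
Qed.

(** The negative part on one side of the hyperplane is not a contraction of h, as it
    is cut off at the hyperplane. For odd h its energy is still controlled, by symmetrization. *)
Lemma half_neg_finite_energy l h : refl_odd l h -> finite_energy j h ->
  finite_energy j (half_neg l h).
Proof.
move=> hA [mh ih]; have mp := measurable_half_neg l mh; split=> //.
apply: (quad_le_integrable (l := l) _ _ ih).
- exact: (measurable_energy_density jG).
- exact: (energy_density_ge0 jG).
apply: filterS (ae_kern_le jG l) => -[x y] /= kle lx ly; have {}kle := kle lx ly.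
rewrite /quad /energy_density/= !half_neg_refl// !half_negE// !hA.
rewrite (kern_refl2 jG) (kern_refl jG).
have := quad_energy_bound (h x) (h y) (kern_ge0 jG (x, refl l y)) kle.
move: (Num.max _ _) (Num.max _ _) => p q; lra.
Qed.

Lemma half_neg_form_le l h : refl_odd l h -> finite_energy j h ->
  energy_form j h (half_neg l h) <= - energy_form j (half_neg l h) (half_neg l h).
Proof.
move=> hA eh; have ep := half_neg_finite_energy hA eh.
have ihp := integrable_energy_density jG eh ep.
have [_ ip] := ep.
rewrite -mulN1r -RintegralZl//; apply: (quad_le_Rintegral (l := l)) => //.
  exact: (integrableZl measurableT (-1) ip).
apply: filterS (ae_kern_le jG l) => -[x y] /= kle lx ly; have {}kle := kle lx ly.
rewrite /quad /energy_density/= !half_neg_refl// !half_negE// !hA.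
rewrite (kern_refl2 jG) (kern_refl jG).
have := quad_form_bound (h x) (h y) (kern_ge0 jG (x, refl l y)) kle.
move: (Num.max _ _) (Num.max _ _) => p q; lra.
Qed.

Definition gain_density l h g (p : T * T) : R :=
  half_neg l h p.1 * g p.2 * Num.max 0 (k p - k (p.1, refl l p.2)).

Lemma measurable_gain_density l h g : measurable_fun [set: T] (h : T -> R) ->
  measurable_fun [set: T] (g : T -> R) -> measurable_fun setT (gain_density l h g).
Proof.
move=> mh mg; have mk := measurable_kern jG.
apply: measurable_funM; first apply: measurable_funM.
- by apply: measurable_fun_fst; exact: measurable_half_neg.
- exact: measurable_fun_snd.
apply: measurable_maxr => //; apply: measurable_funB => //.
apply: (measurableT_comp mk); apply: measurable_fun_pair => //.
exact: (measurableT_comp (leb_measurable_isometry (isometry_refl l)) measurable_snd).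
Qed.

(** The gain counts how much more strongly a point x with h x < 0 interacts with the points y with
    h y > 0 than with their mirror images. Only a lower bound g of the positive part of h enters, which
    can be chosen once and for all while h varies. *)
Lemma half_neg_form_gain l h g : refl_odd l h -> finite_energy j h ->
  measurable_fun [set: T] (g : T -> R) -> (forall y, 0 <= g y <= Num.max 0 (h y)) ->
  (forall y, y ord0 ord0 <= l -> g y = 0) ->
  pi.-integrable setT (EFin \o gain_density l h g) /\
  energy_form j h (half_neg l h) <= - \int[pi]_p gain_density l h g p.
Proof.
move=> hA eh mg gh g0; have ep := half_neg_finite_energy hA eh.
have ihp := integrable_energy_density jG eh ep.
have mG := measurable_gain_density l eh.1 mg.
have gQ y : l <= y ord0 ord0 -> g (refl l y) = 0.
  by move=> ly; rewrite g0// reflE eqxx; lra.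
have key : {ae pi, forall p : T * T, l <= p.1 ord0 ord0 -> l <= p.2 ord0 ord0 ->
    quad l (gain_density l h g) p <= quad l (fun p => -1 * E h (half_neg l h) p) p}.
  apply: filterS (ae_kern_le jG l) => -[x y] /= kle lx ly; have {}kle := kle lx ly.
  rewrite /quad /gain_density /energy_density/= !half_neg_refl// gQ// !half_negE// !hA.
  rewrite (kern_refl2 jG) (kern_refl jG) reflK.
  have := quad_form_bound2 (h x) (h y) (kern_ge0 jG (x, refl l y)) kle.
  have hxp : 0 <= Num.max 0 (- h x) by rewrite le_max lexx.
  have /andP[gy0 gy1] := gh y.
  have kk : 0 <= k (x, y) - k (x, refl l y) by rewrite subr_ge0.
  rewrite [Num.max 0 (k _ - _)]max_r//.
  have : Num.max 0 (- h x) * g y * (k (x, y) - k (x, refl l y)) <=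
      Num.max 0 (- h x) * Num.max 0 (h y) * (k (x, y) - k (x, refl l y)).
    by rewrite ler_wpM2r// ler_wpM2l.
  move: (Num.max 0 (- h x)) (Num.max 0 (- h y)) (Num.max 0 (h y)) => p q r; lra.
have iE : pi.-integrable setT (EFin \o (fun p => -1 * E h (half_neg l h) p)).
  exact: (integrableZl measurableT (-1) ihp).
have iG : pi.-integrable setT (EFin \o gain_density l h g).
  apply: (quad_le_integrable (l := l) _ _ iE) => //.
  move=> p; rewrite /gain_density !mulr_ge0//; first exact: half_neg_ge0.
    by case/andP: (gh p.2).
  by rewrite le_max lexx.
split=> //.
have := quad_le_Rintegral iG iE key; rewrite RintegralZl// mulN1r.
by rewrite lerNr.
Qed.

End antisymmetric.

(** * Poincare inequality on small sets *)

Section poincare.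
Context (R : realType) (n : nat).
Local Notation V := 'rV[R]_n.+1.
Local Notation T := (lebRN R n).
Local Notation mu := (@leb R n).
Local Notation pi := (product_measure1 mu mu).
Implicit Types (x y z : V) (u v w phi g h : V -> R) (l : R).

Context (j : V -> R) (jG : good_kernel j).
Local Notation E := (energy_density j).
Let mjb : measurable_fun [set: borRN R n] (j : borRN R n -> R). Proof. by case: jG => -[]. Qed.
Let mj : measurable_fun [set: T] (j : T -> R). Proof. exact: bor_leb_measurable_fun. Qed.
Let j0 z : 0 <= j z. Proof. by case: jG => -[_ + _ _ _]; apply. Qed.

Definition truncated_kernel (m : nat) z : R := Num.min (j z) m%:R * \1_(cube m) z.

Lemma truncated_kernel_ge0 m z : 0 <= truncated_kernel m z.
Proof. by rewrite mulr_ge0// le_min j0 ler0n. Qed.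

Lemma truncated_kernel_le m z : truncated_kernel m z <= j z.
Proof.
rewrite /truncated_kernel indicE; case: (_ \in _); first by rewrite mulr1 ge_min lexx.
by rewrite mulr0.
Qed.

Lemma truncated_kernel_le_nat m z : truncated_kernel m z <= m%:R.
Proof.
rewrite /truncated_kernel indicE; case: (_ \in _); last by rewrite mulr0.
by rewrite mulr1 ge_min lexx orbT.
Qed.

Lemma measurable_truncated_kernel m :
  measurable_fun [set: T] (truncated_kernel m : T -> R).
Proof.
apply: measurable_funM; first exact: measurable_minr.
exact/measurable_indic/leb_measurable_cube.
Qed.

(** Monotone convergence and the infinite mass of the kernel. *)
Lemma truncated_kernel_large (L : R) : exists m : nat,
  (L%:E <= \int[mu]_z (truncated_kernel m z)%:E)%E.
Proof.
pose gs m (z : T) := (truncated_kernel m z)%:E.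
have nd z : nondecreasing_seq (gs ^~ z).
  move=> m1 m2 m12; rewrite lee_fin /truncated_kernel !indicE.
  have [/set_mem c1|_] := boolP (z \in cube m1); last first.
    by rewrite mulr0 mulr_ge0// le_min j0 ler0n.
  rewrite mem_set ?mulr1; last exact: le_cube c1.
  by rewrite le_min !ge_min lexx/= ler_nat m12 orbT.
have lim z : limn (gs ^~ z) = (j z)%:E.
  apply: lim_near_cst => //.
  have [m _ zm] : (\bigcup_m @cube R n m) z by rewrite bigcup_cube.
  exists (maxn m (Num.trunc (j z)).+1) => // m' /=; rewrite geq_max => /andP[mm' jm'].
  rewrite /gs /truncated_kernel indicE mem_set ?mulr1; last exact: le_cube zm.
  by congr EFin; apply/min_idPl; rewrite ltW// (lt_le_trans (truncnS_gt _))// ler_nat.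
have mgs m : measurable_fun [set: T] (gs m).
  by apply/measurable_EFinP; exact: measurable_truncated_kernel.
have gs0 m z : setT z -> (0 <= gs m z)%E by rewrite lee_fin truncated_kernel_ge0.
have := cvg_monotone_convergence (mu := mu) measurableT mgs gs0 (fun z _ => nd z).
have [_ [_ jinf _]] := jG.
rewrite (_ : (\int[mu]_z limn (gs ^~ z))%E = +oo%E); last first.
  by rewrite -jinf; apply: eq_integral => z _; exact: lim.
by move=> /cvgeyPge/(_ L)[m _ mP]; exists m; exact: mP m (leqnn m).
Qed.

(** A bounded truncation of the kernel with mass L + 1 loses at most 1 on a set of small
    measure, wherever that set lies. *)
Lemma kernel_mass_outside (L : R) : exists2 d : R, 0 < d &
  forall A, measurable (A : set T) -> (mu A <= d%:E)%E -> forall x,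
    (L%:E <= \int[mu]_(y in ~` A) (j (x - y))%:E)%E.
Proof.
have [m mL] := truncated_kernel_large (L + 1).
exists (m.+1%:R^-1); first by rewrite invr_gt0.
move=> A mA Ad x.
have mt := measurable_truncated_kernel m.
have mjx : measurable_fun [set: T] (fun y : T => j (x - y)).
  exact: (measurableT_comp mj (leb_measurable_isometry (isometry_subl x))).
have mtx : measurable_fun [set: T] (fun y : T => truncated_kernel m (x - y)).
  exact: (measurableT_comp mt (leb_measurable_isometry (isometry_subl x))).
have : ((L + 1)%:E <= \int[mu]_y (truncated_kernel m (x - y))%:E)%E.
  apply: (le_trans mL).
  rewrite le_eqVlt; apply/orP; left; apply/eqP; apply/esym.
  apply: (leb_integral_isometry (f := fun z => (truncated_kernel m z)%:E) (isometry_subl x)).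
  exact/measurable_EFinP.
rewrite -(setvU A) ge0_integral_setU; [|exact: (measurableC mA)|exact: mA|
  rewrite setvU; exact/measurable_EFinP|
  by move=> y _; rewrite lee_fin truncated_kernel_ge0|by apply/disj_setPCr].
have i1 : (\int[mu]_(y in ~` A) (truncated_kernel m (x - y))%:E <=
    \int[mu]_(y in ~` A) (j (x - y))%:E)%E.
  apply: ge0_le_integral.
  - exact: (measurableC mA).
  - by move=> y _; rewrite lee_fin truncated_kernel_ge0.
  - by apply/measurable_EFinP; exact: measurable_funTS.
  - by apply/measurable_EFinP; exact: measurable_funTS.
  - by move=> y _; rewrite lee_fin truncated_kernel_le.
have i2 : (\int[mu]_(y in A) (truncated_kernel m (x - y))%:E <= 1%:E)%E.
  apply: (@le_trans _ _ (\int[mu]_(y in A) (m%:R)%:E)%E).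
    apply: ge0_le_integral.
    - exact: mA.
    - by move=> y _; rewrite lee_fin truncated_kernel_ge0.
    - by apply/measurable_EFinP; exact: measurable_funTS.
    - exact: measurable_cst.
    - by move=> y _; rewrite lee_fin truncated_kernel_le_nat.
  rewrite integral_cst//; apply: (le_trans (lee_wpmul2l _ Ad)) => //.
  by rewrite -EFinM lee_fin ler_pdivrMr// mul1r ler_nat.
move=> H; have := le_trans H (leeD i1 i2).
by rewrite EFinD leeD2rE.
Qed.

Lemma finite_energy_form_ereal phi : finite_energy j phi ->
  (energy_form j phi phi)%:E = (\int[pi]_p (E phi phi p)%:E)%E.
Proof. by move=> [_ ip]; rewrite /energy_form /Rintegral fineK//; exact: integrable_fin_num. Qed.

(** If phi vanishes off A, the energy contains the interaction of A with its complement, in which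
    phi x ^ 2 has the weight given by kernel_mass_outside. *)
Lemma poincare (L : R) : 0 <= L -> exists2 d : R, 0 < d &
  forall A phi, measurable (A : set T) -> (mu A <= d%:E)%E ->
    (forall x, ~ A x -> phi x = 0) -> finite_energy j phi ->
    (\int[mu]_x (phi x ^+ 2 * L)%:E <= (energy_form j phi phi)%:E)%E.
Proof.
move=> L0; have [d d0 dP] := kernel_mass_outside L; exists d => // A phi mA Ad phiA ep.
have [mp ip] := ep.
have mE : measurable_fun setT (EFin \o E phi phi).
  by apply/measurable_EFinP; exact: (measurable_energy_density jG).
have E0 p : (0 <= (EFin \o E phi phi) p)%E.
  by rewrite lee_fin (energy_density_ge0 jG).
rewrite finite_energy_form_ereal// fubini_tonelli1//.
apply: ge0_le_integral.
- exact: measurableT.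
- by move=> x _; rewrite lee_fin mulr_ge0// sqr_ge0.
- apply/measurable_EFinP; apply: measurable_funM; last exact: measurable_cst.
  exact: measurable_funX.
- exact: measurable_fun_fubini_tonelli_F.
move=> x _; rewrite /fubini_F.
have mAc : measurable (~` A : set T) by exact: (measurableC mA).
have mjx : measurable_fun [set: T] (fun y : T => j (x - y)).
  exact: (measurableT_comp mj (leb_measurable_isometry (isometry_subl x))).
apply: (@le_trans _ _ (\int[mu]_(y in ~` A) (phi x ^+ 2 * j (x - y))%:E)%E).
  rewrite EFinM; under eq_integral do rewrite EFinM.
  rewrite ge0_integralZl; [|exact: mAc|apply/measurable_EFinP; exact: measurable_funTS|
    by move=> y _; rewrite lee_fin|by rewrite lee_fin sqr_ge0].
  by rewrite lee_wpmul2l ?lee_fin ?sqr_ge0//; exact: dP.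
apply: (@le_trans _ _ (\int[mu]_(y in ~` A) ((EFin \o E phi phi) (x, y)))%E).
  rewrite le_eqVlt; apply/orP; left; apply/eqP; apply: eq_integral => y /set_mem Ay.
  by rewrite /= /energy_density/= (phiA y)// subr0 -expr2.
have mEx : measurable_fun [set: T] (fun y => (EFin \o E phi phi) (x, y)).
  exact: (measurable_fun_pair2 _ mE).
exact: (ge0_subset_integral mu mAc measurableT mEx (fun y _ => E0 (x, y))).
Qed.

Definition convolution_density (a m : V -> R) (p : T * T) : R := a p.1 * m (p.1 - p.2).

(** Used to show that bumps have finite energy, with a the indicator of a ball. *)
Lemma integrable_convolution (a m : V -> R) : measurable_fun [set: T] (a : T -> R) ->
  (forall x, 0 <= a x) -> mu.-integrable setT (EFin \o (a : T -> R)) ->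
  measurable_fun [set: borRN R n] (m : borRN R n -> R) -> (forall z, 0 <= m z) ->
  (\int[mu]_z (m z)%:E < +oo)%E ->
  pi.-integrable setT (EFin \o convolution_density a m).
Proof.
move=> ma a0 ia mm m0 moo.
have mT := bor_leb_measurable_fun mm.
have mD : measurable_fun setT (EFin \o convolution_density a m).
  apply/measurable_EFinP; apply: measurable_funM; first exact: measurable_fun_fst.
  exact: (measurableT_comp mm (@measurable_sub_bor R n)).
have D0 p : 0 <= convolution_density a m p by rewrite mulr_ge0.
apply/integrableP; split => //.
rewrite (eq_integral (EFin \o convolution_density a m)); last first.
  by move=> p _; rewrite gee0_abs// lee_fin.
rewrite fubini_tonelli1// /fubini_F.
have FE x : (\int[mu]_y (EFin \o convolution_density a m) (x, y) =
    (a x)%:E * \int[mu]_z (m z)%:E)%E.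
  under eq_integral do rewrite /= /convolution_density/= EFinM.
  have mx : measurable_fun [set: T] (fun y : T => (m (x - y))%:E).
    apply/measurable_EFinP.
    exact: (measurableT_comp mT (leb_measurable_isometry (isometry_subl x))).
  rewrite ge0_integralZl; [|exact: measurableT|exact: mx|
    by move=> y _; rewrite lee_fin|by rewrite lee_fin].
  congr (_ * _)%E.
  apply: (leb_integral_isometry (f := fun z => (m z)%:E) (isometry_subl x)).
  exact/measurable_EFinP.
under eq_integral do rewrite FE.
rewrite ge0_integralZr; [|exact: measurableT|exact/measurable_EFinP|
  by move=> y _; rewrite lee_fin|by apply: integral_ge0 => z _; rewrite lee_fin].
rewrite lte_mul_pinfty//.
- by apply: integral_ge0 => z _; rewrite lee_fin.
- rewrite ge0_fin_numE; last by apply: integral_ge0 => z _; rewrite lee_fin.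
  by have := integrable_lty measurableT ia.
Qed.

End poincare.

(** * Bumps and barriers *)

Section bumps.
Context (R : realType) (n : nat).
Local Notation V := 'rV[R]_n.+1.
Local Notation T := (lebRN R n).
Local Notation mu := (@leb R n).
Local Notation borRN := (borRN R n).
Implicit Types (x y z : V) (u v w phi g h : V -> R) (l r : R).

Lemma coord_sqr_le x i : x ord0 i ^+ 2 <= sqn x.
Proof. by rewrite /sqn (bigD1 i)//= lerDl sumr_ge0// => k _; exact: sqr_ge0. Qed.

Lemma coord_le_enorm x i : `|x ord0 i| <= enorm x.
Proof. by rewrite /enorm -sqrtr_sqr ler_wsqrtr// coord_sqr_le. Qed.

Lemma sqnN x : sqn (- x) = sqn x.
Proof. by apply: eq_bigr => i _; rewrite mxE sqrrN. Qed.

Lemma sqn_parallelogram x y : sqn (x + y) + sqn (x - y) = 2 * sqn x + 2 * sqn y.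
Proof.
rewrite /sqn -big_split/= !mulr_sumr -big_split/=; apply: eq_bigr => i _.
by rewrite !mxE; ring.
Qed.

Lemma bor_measurable_sqn : measurable_fun [set: borRN] (@sqn R n : borRN -> R).
Proof.
by apply: measurable_sum => i; apply: measurable_funX; exact: bor_measurable_coord.
Qed.

Definition bump_fun x0 r y : R := Num.max 0 (r ^+ 2 - sqn (y - x0)).

Lemma bump_ge0 x0 r y : 0 <= bump_fun x0 r y.
Proof. by rewrite le_max lexx. Qed.

Lemma bump_le x0 r y : bump_fun x0 r y <= r ^+ 2.
Proof. by rewrite ge_max sqr_ge0 gerBl sqn_ge0. Qed.

Lemma bump_out x0 r y : r ^+ 2 <= sqn (y - x0) -> bump_fun x0 r y = 0.
Proof. by move=> ry; apply/max_idPl; rewrite subr_le0. Qed.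

Lemma maxr0_lipschitz (a b : R) : `|Num.max 0 a - Num.max 0 b| <= `|a - b|.
Proof.
have := ler_norm (a - b); have := ler_norm (b - a); rewrite [`|b - a|]distrC => h1 h2.
have h3 := normr_ge0 (a - b).
by rewrite ler_norml; have [?|?] := leP 0 a; have [?|?] := leP 0 b;
  apply/andP; split; lra.
Qed.

Lemma bor_measurable_bump x0 r : measurable_fun [set: borRN] (bump_fun x0 r : borRN -> R).
Proof.
apply: measurable_maxr => //; apply: measurable_funB => //.
apply: (measurableT_comp bor_measurable_sqn); apply: measurable_fun_bor => i.
under eq_fun do rewrite mxE; apply: measurable_funD => //.
exact: bor_measurable_coord.
Qed.

Definition bump_const r : R := (r ^+ 2) ^+ 2 + (n.+1%:R * (1 + 2 * r)) ^+ 2.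

Lemma bump_diff_in x0 r x y : 0 <= r -> sqn (x - x0) < r ^+ 2 ->
  (bump_fun x0 r x - bump_fun x0 r y) ^+ 2 <= bump_const r * Num.min 1 (sqn (x - y)).
Proof.
move=> r0 xr.
have r20 := sqr_ge0 r.
have [xy1|xy1] := leP 1 (sqn (x - y)).
  rewrite mulr1 /bump_const (@le_trans _ _ ((r ^+ 2) ^+ 2))//; last first.
    by rewrite lerDl sqr_ge0.
  rewrite -ler_sqrt ?sqr_ge0// !sqrtr_sqr (ger0_norm r20) ler_norml.
  have := bump_ge0 x0 r x; have := bump_ge0 x0 r y.
  have := bump_le x0 r x; have := bump_le x0 r y.
  by move=> *; apply/andP; split; lra.
pose t := enorm (x - y).
have t0 : 0 <= t by exact: sqrtr_ge0.
have tE : t ^+ 2 = sqn (x - y) by exact: enorm_sqr.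
have t1 : t <= 1 by rewrite -(@expr_le1 _ 2)// tE ltW.
have cr i : `|x ord0 i - x0 ord0 i| <= r.
  rewrite -(ger0_norm r0) -ler_sqr ?nnegrE// !real_normK ?num_real//.
  have := coord_sqr_le (x - x0) i; rewrite !mxE => /le_trans; apply; exact: ltW.
have diff : `|sqn (y - x0) - sqn (x - x0)| <= n.+1%:R * (1 + 2 * r) * t.
  rewrite /sqn -sumrB (le_trans (ler_norm_sum _ _ _))//.
  rewrite -mulrA -[n.+1 in leRHS]card_ord mulr_natl -sumr_const; apply: ler_sum => i _.
  rewrite !mxE.
  have -> : (y ord0 i - x0 ord0 i) ^+ 2 - (x ord0 i - x0 ord0 i) ^+ 2 =
      (y ord0 i - x ord0 i) * ((y ord0 i - x ord0 i) + 2 * (x ord0 i - x0 ord0 i)) by ring.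
  have yt : `|y ord0 i - x ord0 i| <= t.
    by have := coord_le_enorm (x - y) i; rewrite !mxE distrC.
  rewrite normrM mulrC ler_pM// (le_trans (ler_normD _ _))// lerD//.
    exact: le_trans t1.
  by rewrite normrM ger0_norm// ler_wpM2l.
apply: (@le_trans _ _ ((n.+1%:R * (1 + 2 * r) * t) ^+ 2)).
  rewrite -real_normK ?num_real// ler_sqr ?nnegrE//; last first.
    by rewrite !mulr_ge0// addr_ge0// mulr_ge0.
  rewrite (le_trans (maxr0_lipschitz _ _))//.
  by rewrite opprB addrC addrA subrK.
rewrite exprMn tE ler_wpM2r ?sqn_ge0// /bump_const lerDr sqr_ge0//.
Qed.

(** A bump is bounded and Lipschitz, so its squared increments are O(min(1, |x - y|^2)), which (J1)
    integrates; they vanish when both points lie off the ball. *)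
Lemma bump_diff x0 r x y (S := [set y | sqn (y - x0) < r ^+ 2]) : 0 <= r ->
  (bump_fun x0 r x - bump_fun x0 r y) ^+ 2 <=
    bump_const r * (\1_S x + \1_S y) * Num.min 1 (sqn (x - y)).
Proof.
move=> r0.
have C0 : 0 <= bump_const r by rewrite addr_ge0 ?sqr_ge0.
have m0 : 0 <= Num.min 1 (sqn (x - y)) by rewrite le_min ler01 sqn_ge0.
have [xr|xr] := ltP (sqn (x - x0)) (r ^+ 2).
  rewrite (le_trans (bump_diff_in y r0 xr))// ler_wpM2r// ler_peMr//.
  by rewrite indicE mem_set// lerDl.
have [yr|yr] := ltP (sqn (y - x0)) (r ^+ 2); last first.
  rewrite (bump_out xr) (bump_out yr) subr0 expr0n/=.
  by rewrite !mulr_ge0// addr_ge0.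
rewrite -sqrrN opprB (le_trans (bump_diff_in x r0 yr))// -sqnN opprB ler_wpM2r// ler_peMr//.
by rewrite [\1_S y]indicE mem_set// lerDr.
Qed.

Context (j : V -> R) (jG : good_kernel j).
Local Notation k := (kern j).
Local Notation E := (energy_density j).
Let mjb : measurable_fun [set: borRN] (j : borRN -> R). Proof. by case: jG => -[]. Qed.
Let j0 z : 0 <= j z. Proof. by case: jG => -[_ + _ _ _]; apply. Qed.
Let jN z : j (- z) = j z. Proof. by case: jG => -[_ _ + _ _]; apply. Qed.

(** (J1) says that the measure with this density is finite. *)
Definition levy_density z : R := Num.min 1 (sqn z) * j z.

Lemma levy_density_ge0 z : 0 <= levy_density z.
Proof. by rewrite mulr_ge0// le_min ler01 sqn_ge0. Qed.

Lemma bor_measurable_levy_density : measurable_fun [set: borRN] (levy_density : borRN -> R).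
Proof.
apply: measurable_funM => //; apply: measurable_minr => //; exact: bor_measurable_sqn.
Qed.

Lemma levy_density_lty : (\int[mu]_z (levy_density z)%:E < +oo)%E.
Proof. by have [_ []] := jG. Qed.

Lemma levy_densityN z : levy_density (- z) = levy_density z.
Proof. by rewrite /levy_density sqnN jN. Qed.

Lemma integrable_levy_density : mu.-integrable setT (EFin \o (levy_density : T -> R)).
Proof.
apply/integrableP; split.
  by apply/measurable_EFinP; exact: (bor_leb_measurable_fun bor_measurable_levy_density).
rewrite (eq_integral (fun z : T => (levy_density z)%:E)); first exact: levy_density_lty.
by move=> z _; rewrite gee0_abs// lee_fin levy_density_ge0.
Qed.

Lemma finite_energy_bump x0 r : 0 <= r -> finite_energy j (bump_fun x0 r).
Proof.
move=> r0; pose S : set V := [set y | sqn (y - x0) < r ^+ 2].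
have mb := bor_leb_measurable_fun (@bor_measurable_bump x0 r).
have mS : measurable (S : set T).
  rewrite (_ : S = [set y | - r ^+ 2 < - sqn (y - x0)]); last first.
    by apply/seteqP; split=> y; rewrite /S/= ltrN2.
  apply: measurable_fun_ltc; apply: measurable_funN.
  exact: (measurableT_comp (@measurable_sqn R n) (leb_measurable_isometry (isometry_sub x0))).
have Soo : (mu S < +oo)%E.
  apply: (@le_lt_trans _ _ (mu (box (x0 - const_mx r) (x0 + const_mx r)))).
    apply: le_leb => y Sy i; rewrite !mxE.
    have : `|y ord0 i - x0 ord0 i| <= r.
      rewrite -(ger0_norm r0) -ler_sqr ?nnegrE// !real_normK ?num_real//.
      by have := coord_sqr_le (y - x0) i; rewrite !mxE => /le_trans; apply; exact: ltW.
    by rewrite ler_norml => /andP[? ?]; apply/andP; split; lra.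
  apply: le_lt_trans (ltry (box_vol _ _)); apply: lebesgue_outer_box_le => i.
  by rewrite !mxE; lra.
have iS : mu.-integrable setT (EFin \o (\1_S : T -> R)).
  apply/integrableP; split; first exact/measurable_EFinP/measurable_indic.
  rewrite (eq_integral (fun y : T => (\1_S y)%:E)); last by move=> y _; rewrite gee0_abs// lee_fin.
  by rewrite integral_indic// setIT.
have S0 x : 0 <= \1_S x :> R by rewrite indicE.
have i1 := integrable_convolution (measurable_indic mS) S0 iS
  bor_measurable_levy_density levy_density_ge0 levy_density_lty.
have i2 := integrable_preserving (@pi_preserving_swap R n) i1.
have i12 := integrableZl measurableT (bump_const r) (integrableD measurableT i1 i2).
split=> //; apply: (le_integrable measurableT _ _ i12).
  by apply/measurable_EFinP; exact: (measurable_energy_density jG).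
move=> [x y] _ /=; rewrite lee_fin ger0_norm ?(energy_density_ge0 jG)//.
rewrite (le_trans _ (ler_norm _))// /convolution_density/= /energy_density/kern/= -expr2.
have -> : levy_density (y - x) = levy_density (x - y) by rewrite -levy_densityN opprB.
rewrite -mulrDl mulrA /levy_density mulrA ler_wpM2r//; exact: bump_diff.
Qed.

End bumps.

Section shear.
Context (R : realType) (n : nat).
Local Notation V := 'rV[R]_n.+1.
Local Notation T := (lebRN R n).
Local Notation mu := (@leb R n).
Local Notation pi := (product_measure1 mu mu).
Local Notation borRN := (borRN R n).
Implicit Types (x y z : V) (u v w phi g h : V -> R) (l r : R).

(** The substitution x = z + y, under which the kernel j (x - y) depends on z only. *)
Definition shear (p : T * T) : T * T := ((p.1 : V) + p.2 : T, p.2).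

Lemma ge0_integral_shear (f : T * T -> \bar R) : measurable_fun setT f ->
  measurable_fun setT (f \o shear) -> (forall p, 0 <= f p)%E ->
  (\int[pi]_p (f \o shear) p = \int[pi]_p f p)%E.
Proof.
move=> mf mfs f0.
transitivity (\int[mu]_y fubini_G mu (f \o shear) y)%E.
  by apply: fubini_tonelli2 => // p; exact: f0.
transitivity (\int[mu]_y fubini_G mu f y)%E; last by symmetry; exact: fubini_tonelli2.
apply: eq_integral => y _.
apply: (leb_integral_isometry (f := fun x => f (x, y)) (isometry_translate y)).
exact: (measurable_fun_pair1 _ mf).
Qed.

Lemma integral_shear (f : T * T -> \bar R) : measurable_fun setT f ->
  measurable_fun setT (f \o shear) ->
  (\int[pi]_p (f \o shear) p = \int[pi]_p f p)%E.
Proof.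
move=> mf mfs; rewrite integralE [RHS]integralE funepos_comp funeneg_comp.
congr (_ - _)%E; apply: ge0_integral_shear => //.
- exact: measurable_funepos.
- by rewrite -funepos_comp; exact: measurable_funepos.
- exact: measurable_funeneg.
- by rewrite -funeneg_comp; exact: measurable_funeneg.
Qed.

Lemma integrable_shear (f : T * T -> \bar R) :
  measurable_fun setT (f \o shear) -> pi.-integrable setT f ->
  pi.-integrable setT (f \o shear).
Proof.
move=> mfs /integrableP[mf foo]; apply/integrableP; split=> //.
have mabs : measurable_fun setT (fun p => `|f p|)%E by exact: measurableT_comp.
have mabss : measurable_fun setT ((fun p => `|f p|)%E \o shear) by exact: measurableT_comp mfs.
by apply: le_lt_trans foo; rewrite le_eqVlt; apply/orP; left; apply/eqP; exact: integral_shear mabs mabss.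
Qed.

Lemma measurable_add_bor :
  measurable_fun [set: T * T] (fun p : T * T => (p.1 : V) + p.2 : borRN).
Proof.
apply: measurable_fun_bor => i; under eq_fun do rewrite mxE.
apply: measurable_funD.
  exact: (measurable_fun_fst (@leb_measurable_coord R n i)).
exact: (measurable_fun_snd (@leb_measurable_coord R n i)).
Qed.

End shear.

Section barriers.
Context (R : realType) (n : nat).
Local Notation V := 'rV[R]_n.+1.
Local Notation T := (lebRN R n).
Local Notation mu := (@leb R n).
Local Notation pi := (product_measure1 mu mu).
Local Notation borRN := (borRN R n).
Implicit Types (x y z : V) (u v w phi g h : V -> R) (l r : R).

(** An odd function which, when r is at most the distance of x0 to the hyperplane, is positive exactly on
    the ball of radius r around x0. *)
Definition barrier l x0 r y : R := bump_fun x0 r y - bump_fun x0 r (refl l y).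

Lemma barrier_odd l x0 r : refl_odd l (barrier l x0 r).
Proof. by move=> y; rewrite /barrier reflK opprB. Qed.

Lemma bor_measurable_barrier l x0 r :
  measurable_fun [set: borRN] (barrier l x0 r : borRN -> R).
Proof.
apply: measurable_funB; first exact: bor_measurable_bump.
exact: (measurableT_comp (@bor_measurable_bump R n x0 r) (@bor_measurable_refl R n l)).
Qed.

Lemma normr_barrier_le l x0 r y : `|barrier l x0 r y| <= r ^+ 2.
Proof.
have := bump_ge0 x0 r y; have := bump_ge0 x0 r (refl l y).
have := bump_le x0 r y; have := bump_le x0 r (refl l y).
by rewrite /barrier ler_norml => *; apply/andP; split; lra.
Qed.

Lemma sqn_refl_ge l x0 y : 2 * (x0 ord0 ord0 - l) ^+ 2 <=
  sqn (y - x0) + sqn (refl l y - x0).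
Proof.
have := coord_sqr_le (y - x0) ord0; have := coord_sqr_le (refl l y - x0) ord0.
rewrite !(reflE, mxE) eqxx => h1 h2; apply: le_trans (lerD h2 h1).
have := sqr_ge0 (y ord0 ord0 - l); lra.
Qed.

Section barrier_profile.
Variables (l r : R) (x0 : V).
Hypotheses (r0 : 0 < r) (rl : r <= x0 ord0 ord0 - l).

Let sum_le y : (r ^+ 2 - sqn (y - x0)) + (r ^+ 2 - sqn (refl l y - x0)) <= 0.
Proof.
have := sqn_refl_ge l x0 y.
have : 0 <= (x0 ord0 ord0 - l - r) * (x0 ord0 ord0 - l + r) by rewrite mulr_ge0; move: r0 rl; lra.
lra.
Qed.

Lemma barrier_ge y : r ^+ 2 - sqn (y - x0) <= barrier l x0 r y.
Proof.
have := sum_le y; rewrite /barrier /bump_fun.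
move: (_ - sqn (y - x0)) (_ - sqn (refl l y - x0)) => a b ab.
by have [?|?] := leP 0 a; have [?|?] := leP 0 b; lra.
Qed.

Lemma barrier_gt0 y : 0 < barrier l x0 r y -> barrier l x0 r y = r ^+ 2 - sqn (y - x0).
Proof.
have := sum_le y; rewrite /barrier /bump_fun.
move: (_ - sqn (y - x0)) (_ - sqn (refl l y - x0)) => a b ab.
by have [?|?] := leP 0 a; have [?|?] := leP 0 b; lra.
Qed.

(** Where b is positive it coincides with r^2 - |y - x0|^2, which lies below b everywhere. So b is
    semiconvex at the points where it is positive, with the constant of a paraboloid. *)
Lemma barrier_second_difference y z : 0 < barrier l x0 r y ->
  2 * barrier l x0 r y - barrier l x0 r (y - z) - barrier l x0 r (y + z) <=
  (2 + 4 * r ^+ 2) * Num.min 1 (sqn z).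
Proof.
move=> by0; have r20 := sqr_ge0 r; have sz := sqn_ge0 z.
have [z1|z1] := leP 1 (sqn z).
  rewrite mulr1; have := normr_barrier_le l x0 r y.
  have := normr_barrier_le l x0 r (y - z); have := normr_barrier_le l x0 r (y + z).
  by rewrite !ler_norml => /andP[? ?] /andP[? ?] /andP[? ?]; lra.
have := barrier_gt0 by0; have := barrier_ge (y - z); have := barrier_ge (y + z).
have := sqn_parallelogram (y - x0) z.
rewrite [y - z - x0]addrAC [y + z - x0]addrAC => *.
have : 0 <= r ^+ 2 * sqn z by rewrite mulr_ge0.
lra.
Qed.

End barrier_profile.

Context (j : V -> R) (jG : good_kernel j).
Local Notation E := (energy_density j).
Let mjb : measurable_fun [set: borRN] (j : borRN -> R). Proof. by case: jG => -[]. Qed.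
Let j0 z : 0 <= j z. Proof. by case: jG => -[_ + _ _ _]; apply. Qed.

Lemma finite_energy_barrier l x0 r : 0 <= r -> finite_energy j (barrier l x0 r).
Proof.
move=> r0; have e1 := finite_energy_bump jG x0 r0.
have := finite_energy_lincomb jG 1 (-1) e1 (finite_energy_refl jG l e1).
rewrite (_ : (fun x => _) = barrier l x0 r)//.
by apply/funext => x; rewrite /= mul1r mulN1r.
Qed.

Section barrier_form.
Variables (l r : R) (x0 : V).
Hypotheses (r0 : 0 < r) (rl : r <= x0 ord0 ord0 - l).
Let b := barrier l x0 r.
Let C : R := (2 + 4 * r ^+ 2) * fine (\int[mu]_z (levy_density j z)%:E).

Let mb : measurable_fun [set: T] (b : T -> R).
Proof. exact: (bor_leb_measurable_fun (@bor_measurable_barrier l x0 r)). Qed.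

Lemma barrier_const_ge0 : 0 <= C.
Proof.
rewrite mulr_ge0//; first by have := sqr_ge0 r; lra.
by rewrite fine_ge0// integral_ge0// => z _; rewrite lee_fin (levy_density_ge0 jG).
Qed.

Lemma Rintegral_isometry tau (f : V -> R) : box_isometry tau ->
  measurable_fun [set: T] (f : T -> R) -> \int[mu]_x f (tau x) = \int[mu]_x f x.
Proof.
move=> tauP mf; congr fine.
by apply: (leb_integral_isometry (f := fun x => (f x)%:E) tauP); exact/measurable_EFinP.
Qed.

Lemma integrable_bounded_mul (f g : V -> R) (M : R) :
  measurable_fun [set: T] (f : T -> R) -> (forall x, `|f x| <= M) ->
  mu.-integrable setT (EFin \o (g : T -> R)) ->
  mu.-integrable setT (EFin \o (fun x : T => f x * g x)).
Proof.
move=> mf fM ig; have mg : measurable_fun setT (g : T -> R).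
  exact/measurable_EFinP/(measurable_int mu ig).
apply: (le_integrable measurableT _ _ (integrableZl measurableT M (integrable_norm ig))).
  by apply/measurable_EFinP; exact: measurable_funM.
move=> x _ /=; rewrite lee_fin normrM normrM normr_id ler_wpM2r//.
by rewrite (le_trans (fM x))// ler_norm.
Qed.

(** For fixed z, discrete integration by parts replaces the increments of phi by the second
    differences of b, which are controlled on the support of phi. *)
Lemma barrier_slice_le phi z : measurable_fun [set: T] (phi : T -> R) ->
  mu.-integrable setT (EFin \o (phi : T -> R)) -> (forall y, 0 <= phi y) ->
  {ae mu, forall y, b y <= 0 -> phi y = 0} ->
  let D y := (b (z + y) - b y) * (phi (z + y) - phi y) in
  mu.-integrable setT (EFin \o (D : T -> R)) /\
  \int[mu]_y D y <= (2 + 4 * r ^+ 2) * Num.min 1 (sqn z) * \int[mu]_y phi y.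
Proof.
move=> mp ip p0 pb.
have bM y : `|b y| <= r ^+ 2 by exact: normr_barrier_le.
have mbz (w : V) : measurable_fun [set: T] (fun y : T => b (y + w)).
  exact: (measurableT_comp mb (leb_measurable_isometry (isometry_translate w))).
have ibp (w : V) : mu.-integrable setT (EFin \o (fun y : T => (b y - b (y + w)) * phi y)).
  apply: (integrable_bounded_mul (M := 2 * r ^+ 2) _ _ ip).
    by apply: measurable_funB.
  by move=> y; rewrite (le_trans (ler_normB _ _))// mulr_natl mulr2n lerD.
(* translating the first product by z turns the sum into second differences *)
pose A y := (b y - b (y - z)) * phi y.
pose B y := (b y - b (y + z)) * phi y.
have iA : mu.-integrable setT (EFin \o (A : T -> R)) by exact: (ibp (- z)).
have iB : mu.-integrable setT (EFin \o (B : T -> R)) by exact: (ibp z).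
have iAz : mu.-integrable setT (EFin \o (fun y : T => A (y + z))).
  exact: (leb_integrable_isometry (isometry_translate z) iA).
have mA : measurable_fun [set: T] (A : T -> R).
  exact/measurable_EFinP/(measurable_int mu iA).
move=> D; have DE y : D y = A (y + z) + B y.
  by rewrite /D/A/B addrK [y + z]addrC; ring.
split.
  have := integrableD measurableT iAz iB; congr (_ = true); congr (integrable _ _ _).
  by apply/funext => y /=; rewrite DE.
have -> : \int[mu]_y D y = \int[mu]_y (A y + B y).
  rewrite RintegralD// -(Rintegral_isometry (isometry_translate z) mA) -RintegralD//.
  by apply: eq_Rintegral => y _; rewrite DE.
rewrite -RintegralZl//; apply: ae_le_Rintegral.
- exact: (integrableD measurableT iA iB).
- exact: (integrableZl measurableT _ ip).
near=> y.
have pby : b y <= 0 -> phi y = 0 by near: y.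
rewrite /A /B -mulrDl; have [/pby->|by0] := leP (b y) 0; first by rewrite !mulr0.
rewrite ler_wpM2r//; have := barrier_second_difference r0 rl z by0; rewrite -/b; lra.
Unshelve. all: by end_near. Qed.

(** The operator applied to b is bounded above where b is positive. A Borel version q of phi is
    needed for the composition with the shear to be measurable. *)
Lemma barrier_form_le phi : finite_energy j phi ->
  mu.-integrable setT (EFin \o (phi : T -> R)) -> (forall y, 0 <= phi y) ->
  (forall y, b y <= 0 -> phi y = 0) ->
  energy_form j b phi <= C * \int[mu]_y phi y.
Proof.
move=> ep ip p0 pb.
have [mp _] := ep.
have [q [mq q0 qp]] := borel_version mp p0.
have {}qp : {ae mu, forall x, phi x = q x}.
  by apply/aeP; rewrite -[RHS]qp; congr (lebesgue_outer _); apply/seteqP; split=> x /= + /esym.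
have mqT := bor_leb_measurable_fun mq.
have eq_ := ae_eq_finite_energy jG mqT qp ep.
have eb : finite_energy j b by apply: finite_energy_barrier; exact: ltW.
rewrite (_ : energy_form j b phi = energy_form j b q); last first.
  by rewrite energy_formC [RHS]energy_formC; exact: ae_eq_energy_form.
rewrite (ae_eq_Rintegral mp mqT qp).
have iq : mu.-integrable setT (EFin \o (q : T -> R)) by exact: (ae_eq_integrable mqT qp ip).
have qb : {ae mu, forall y, b y <= 0 -> q y = 0}.
  by apply: filterS qp => y <-; exact: pb.
have ibq := integrable_energy_density jG eb eq_.
pose s (p : T * T) := (b ((p.1 : V) + p.2) - b p.2) * (q ((p.1 : V) + p.2) - q p.2) * j p.1.
have sE p : E b q (shear p) = s p.
  by rewrite /energy_density/kern/s/= addrK.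
have ms : measurable_fun setT s.
  have madd := @measurable_add_bor R n.
  apply: measurable_funM.
    apply: measurable_funM; apply: measurable_funB.
    - exact: (measurableT_comp (@bor_measurable_barrier l x0 r) madd).
    - exact: measurable_fun_snd.
    - exact: (measurableT_comp mq madd).
    - exact: measurable_fun_snd.
  by apply: measurable_fun_fst; exact: bor_leb_measurable_fun.
have msE : measurable_fun setT ((EFin \o E b q) \o @shear R n).
  rewrite (_ : _ \o _ = EFin \o s); first exact/measurable_EFinP.
  by apply/funext => p /=; rewrite sE.
have is_ : pi.-integrable setT (EFin \o s).
  have := integrable_shear msE ibq; congr (_ = true); congr (integrable _ _ _).
  by apply/funext => p /=; rewrite sE.
rewrite /energy_form /Rintegral -integral_shear//; last exact: (measurable_int pi ibq).
rewrite (_ : (_ \o _) = EFin \o s); last by apply/funext => p /=; rewrite sE.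
rewrite -integral12_prod_meas1//.
have iF := integrable_fubini_F is_.
pose I := \int[mu]_y q y.
have iL : mu.-integrable setT (fun z : T => ((2 + 4 * r ^+ 2) * I)%:E * (levy_density j z)%:E)%E.
  exact: (integrableZl measurableT _ (integrable_levy_density jG)).
have -> : C * fine (\int[mu]_x (q x)%:E) =
    fine (\int[mu]_z (((2 + 4 * r ^+ 2) * I)%:E * (levy_density j z)%:E)).
  rewrite integralZl//; last exact: (integrable_levy_density jG).
  rewrite fineM//; last by apply: integrable_fin_num => //; exact: (integrable_levy_density jG).
  by rewrite /C /I /Rintegral/=; ring.
apply: fine_le; [exact: integrable_fin_num|exact: integrable_fin_num|].
apply: le_integral => // z _; rewrite /fubini_F.
have [iD Dle] := barrier_slice_le z mqT iq q0 qb.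
rewrite (_ : (\int[mu]_y (EFin \o s) (z, y))%E =
    (\int[mu]_y (((b (z + y) - b y) * (q (z + y) - q y))%:E * (j z)%:E))%E); last first.
  by apply: eq_integral => y _; rewrite /s/= EFinM.
rewrite integralZr; [|exact: measurableT|exact: iD].
have fD := integrable_fin_num measurableT iD.
rewrite -[X in (X * _)%E](fineK fD) -!EFinM lee_fin /levy_density.
rewrite -/(\int[mu]_y _) mulrA ler_wpM2r// (le_trans Dle)// mulrAC//.
Qed.

End barrier_form.
End barriers.

(** * The maximum principle in small volume *)

Section admissible.
Context (R : realType) (n : nat).
Local Notation V := 'rV[R]_n.+1.
Local Notation T := (lebRN R n).
Local Notation mu := (@leb R n).
Implicit Types (x y z : V) (u v w phi g h b : V -> R) (l r : R).

Definition symmetric_domain (Omega : set V) :=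
  [/\ open Omega, exists m, Omega `<=` cube m &
      forall x t, Omega x -> `|t| <= `|x ord0 ord0| -> Omega (set_coord x ord0 t)].

(** The right-hand side b is kept as a function of x, to detach the argument from f. *)
Definition weak_equation (j : V -> R) (Omega : set V) (u b : V -> R) :=
  forall phi, finite_energy j phi -> (forall x, ~ Omega x -> phi x = 0) ->
    mu.-integrable (Omega : set T) (fun x : T => (b x * phi x)%:E) /\
    2^-1 * energy_form j u phi = \int[mu]_(x in (Omega : set T)) (b x * phi x).

Definition reflection_gap l u x : R := u (refl l x) - u x.

(** What the moving planes use of a solution. The inequality for b combines (F1) and (F2); it is
    required for l of both signs so that the class is stable under u -> u o refl 0. *)
Definition admissible (j : V -> R) (Omega : set V) (L : R) u :=
  [/\ finite_energy j u, forall x, 0 <= u x, exists M, forall x, u x <= M &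
      forall x, ~ Omega x -> u x = 0] /\
  exists2 b, weak_equation j Omega u b &
    forall l, l != 0 -> {ae mu, forall x, Omega x -> 1 < x ord0 ord0 / l ->
      - L * `|reflection_gap l u x| <= b (refl l x) - b x}.

Lemma integrable_bounded_support (Omega : set V) (f : V -> R) (M : R) :
  symmetric_domain Omega -> measurable_fun [set: T] (f : T -> R) ->
  (forall x, `|f x| <= M) -> (forall x, ~ Omega x -> f x = 0) ->
  mu.-integrable setT (EFin \o (f : T -> R)).
Proof.
move=> [oO [m Om] _] mf fM f0.
have mO := open_leb_measurable oO.
have Ooo : (mu Omega < +oo)%E.
  by apply: le_lt_trans (leb_cube_lty R n m); exact: le_leb.
have mabs : measurable_fun [set: T] (fun x : T => `|(f x)%:E|)%E.
  by apply: measurableT_comp; [exact: abse_measurable|exact/measurable_EFinP].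
apply/integrableP; split; first exact/measurable_EFinP.
apply: (@le_lt_trans _ _ (\int[mu]_(x in (Omega : set T)) M%:E)%E).
  rewrite integral_mkcond [leRHS]integral_mkcond; apply: ge0_le_integral.
  - exact: measurableT.
  - by move=> x _; rewrite patchE; case: ifP => // _; exact: abse_ge0.
  - exact: ((measurable_restrictT _ measurableT).1 mabs).
  - exact: ((measurable_restrictT _ mO).1 (measurable_cst _)).
  - move=> x _; rewrite !patchE in_setT /=; case: ifPn => [_|/negP xO].
      by rewrite lee_fin.
    by rewrite f0 ?normr0// => Ox; apply: xO; rewrite inE.
rewrite integral_cst//.
have M0 : 0 <= M by rewrite (le_trans _ (fM 0)).
by rewrite lte_mul_pinfty.
Qed.

Context (j : V -> R) (jG : good_kernel j) (Omega : set V) (OD : symmetric_domain Omega).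
Context (L : R) (L0 : 0 <= L).

Lemma Omega_refl l x : 0 < l -> l < x ord0 ord0 -> Omega x -> Omega (refl l x).
Proof.
move=> l0 lx Ox; have [_ _ OS] := OD; apply: OS => //.
by rewrite [leRHS]gtr0_norm ?(lt_trans l0)// ler_norml; apply/andP; split; lra.
Qed.

Lemma finite_energy_gap l u : finite_energy j u -> finite_energy j (reflection_gap l u).
Proof.
move=> eu; have := finite_energy_lincomb jG 1 (-1) (finite_energy_refl jG l eu) eu.
by rewrite (_ : (fun x => _) = reflection_gap l u)//; apply/funext => x /=; rewrite mul1r mulN1r.
Qed.

Lemma refl_odd_gap l u : refl_odd l (reflection_gap l u).
Proof. by move=> x; rewrite /reflection_gap reflK opprB. Qed.

Lemma integral_support (f : V -> R) : (forall x, ~ Omega x -> f x = 0) ->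
  \int[mu]_(x in (Omega : set T)) f x = \int[mu]_x f x.
Proof.
move=> f0; rewrite Rintegral_mkcond; apply: eq_Rintegral => x _; rewrite patchE.
by case: ifPn => // /negP xO; rewrite f0// => Ox; apply: xO; rewrite inE.
Qed.

Lemma integrable_support (f : V -> R) : (forall x, ~ Omega x -> f x = 0) ->
  mu.-integrable (Omega : set T) (fun x : T => (f x)%:E) ->
  mu.-integrable setT (EFin \o (f : T -> R)).
Proof.
move=> f0; have [oO _ _] := OD; have mO := open_leb_measurable oO.
move=> /(integrable_mkcond _ mO); congr (_ = true); congr (integrable _ _ _).
apply/funext => x; rewrite patchE /=.
by case: ifPn => // /negP xO; rewrite f0// => Ox; apply: xO; rewrite inE.
Qed.

(** Test the equation of u with phi o refl l and with phi, and subtract. *)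
Lemma gap_form_ge l u phi : admissible j Omega L u -> 0 < l -> finite_energy j phi ->
  (forall x, 0 <= phi x) -> (forall x, ~ (Omega x /\ l < x ord0 ord0) -> phi x = 0) ->
  mu.-integrable setT (EFin \o (fun x : T => `|reflection_gap l u x| * phi x)) ->
  - (2 * L) * \int[mu]_x (`|reflection_gap l u x| * phi x) <=
    energy_form j (reflection_gap l u) phi.
Proof.
move=> [[eu u0 _ uO] [b ub bL]] l0 ep p0 pO iwp.
have epQ := finite_energy_refl jG l ep.
have pO1 x : ~ Omega x -> phi x = 0 by move=> nO; apply: pO => -[].
have pQO x : ~ Omega x -> phi (refl l x) = 0.
  move=> nO; apply: pO => -[Ox lx]; apply: nO.
  by rewrite -(reflK l x); exact: Omega_refl.
have [ib eb] := ub _ ep pO1; have [ibQ ebQ] := ub _ epQ pQO.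
have bO x : ~ Omega x -> b x * phi x = 0 by move=> nO; rewrite pO1// mulr0.
have bQO x : ~ Omega x -> b x * (phi \o refl l) x = 0.
  by move=> nO; rewrite /= pQO// mulr0.
rewrite integral_support// in eb; rewrite integral_support// in ebQ.
have {}ib := integrable_support bO ib; have {}ibQ := integrable_support bQO ibQ.
have ibQ2 := leb_integrable_isometry (isometry_refl l) ibQ.
have -> : energy_form j (reflection_gap l u) phi =
    energy_form j u (phi \o refl l) - energy_form j u phi.
  have := energy_form_lincomb jG 1 (-1) (finite_energy_refl jG l eu) eu ep.
  rewrite (_ : (fun x => _) = reflection_gap l u); last first.
    by apply/funext => x /=; rewrite mul1r mulN1r.
  move=> ->; rewrite mul1r mulN1r; congr (_ - _).
  have := energy_form_refl jG l eu epQ.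
  by rewrite (_ : (phi \o refl l) \o refl l = phi)//; apply/funext => x /=; rewrite reflK.
have -> : energy_form j u (phi \o refl l) = 2 * \int[mu]_x (b (refl l x) * phi x).
  have mbQ : measurable_fun [set: T] ((fun x => b x * (phi \o refl l) x) : T -> R).
    exact/measurable_EFinP/(measurable_int mu ibQ).
  have := Rintegral_isometry (isometry_refl l) mbQ.
  rewrite (_ : \int[mu]_x (_ * _) = \int[mu]_x (b (refl l x) * phi x)); last first.
    by apply: eq_Rintegral => x _; rewrite /= reflK.
  by move=> ->; rewrite -ebQ; lra.
have -> : energy_form j u phi = 2 * \int[mu]_x (b x * phi x) by rewrite -eb; lra.
have i1 : mu.-integrable setT (EFin \o (fun x : T => b (refl l x) * phi x)).
  have := ibQ2; congr (_ = true); congr (integrable _ _ _).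
  by apply/funext => x /=; rewrite reflK.
rewrite -mulrBr -RintegralB// mulNr -mulrN -mulrA ler_pM2l// mulrN -mulNr.
rewrite -RintegralZl//; apply: ae_le_Rintegral.
- exact: (integrableZl measurableT (- L) iwp).
- exact: (integrableB measurableT i1 ib).
have lN0 : l != 0 by rewrite gt_eqF.
apply: filterS (bL l lN0) => x H.
have [[Ox lx]|nO] := pselect (Omega x /\ l < x ord0 ord0); last by rewrite pO// !mulr0 subrr.
rewrite mulrA -mulrBl ler_wpM2r//; apply: H => //.
by rewrite ltr_pdivlMr// mul1r.
Qed.

(** Testing gap_form_ge with the negative part phi of the gap on the half space, half_neg_form_le gives
    energy phi phi <= 2 L int phi^2, against the Poincare inequality with constant
    2 L + 1. *)
Lemma small_volume_maximum_principle : exists2 d : R, 0 < d &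
  forall u l, admissible j Omega L u -> 0 < l ->
    (mu [set x : V | l < x ord0 ord0 /\ reflection_gap l u x < 0]%R <= d%:E)%E ->
    {ae mu, forall x, l < x ord0 ord0 -> 0 <= reflection_gap l u x}.
Proof.
have L1 : 0 <= 2 * L + 1 by move: L0; lra.
have [d d0 dP] := poincare jG L1.
exists d => // u l au l0 small.
have [[eu u0 [M uM] uO] _] := au.
set w := reflection_gap l u.
have ew : finite_energy j w by exact: finite_energy_gap.
have ow : refl_odd l w by exact: refl_odd_gap.
have ep := half_neg_finite_energy jG ow ew.
set phi := half_neg l w.
have p0 x : 0 <= phi x by exact: half_neg_ge0.
have mw := ew.1; have mp : measurable_fun [set: T] (phi : T -> R) := ep.1.
set A := [set x : V | _ /\ _] in small.
have mA : measurable (A : set T).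
  rewrite (_ : A = [set x : V | l < x ord0 ord0] `&` [set x : V | 0 < - w x]).
    apply: measurableI; first exact: measurable_half_space.
    by apply: measurable_fun_ltc; exact: measurable_funN.
  by apply/seteqP; split=> x; rewrite /A/= oppr_gt0.
have pA x : ~ A x -> phi x = 0.
  rewrite /A/= /phi/half_neg => nA; case: ifP => // lx; apply/max_idPl.
  by rewrite oppr_le0 leNgt; apply/negP => wx; exact: nA.
have AO x : A x -> Omega x.
  move=> [lx wx]; apply: contrapT => /uO ux; move: wx.
  by rewrite /w/reflection_gap ux subr0 ltNge u0.
have pO x : ~ (Omega x /\ l < x ord0 ord0) -> phi x = 0.
  by move=> nO; apply: pA => Ax; apply: nO; split; [exact: AO|exact: Ax.1].
have M0 : 0 <= M by rewrite (le_trans (u0 0)).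
have wM x : `|w x| <= M.
  have := u0 x; have := u0 (refl l x); have := uM x; have := uM (refl l x).
  by rewrite /w/reflection_gap ler_norml => *; apply/andP; split; lra.
have wp x : `|w x| * phi x = phi x ^+ 2.
  have [Ax|/pA->] := pselect (A x); last by rewrite mulr0 expr0n.
  have -> : phi x = `|w x|.
    rewrite /phi/half_neg Ax.1 ltr0_norm; last exact: Ax.2.
    by apply/max_idPr; rewrite oppr_ge0 ltW//; exact: Ax.2.
  by rewrite expr2.
have pM x : `|phi x| <= M.
  rewrite ger0_norm// /phi/half_neg; case: ifP => // _; rewrite ge_max M0/=.
  by rewrite (le_trans (ler_norm _))// normrN.
have ip2 : mu.-integrable setT (EFin \o (fun x : T => phi x ^+ 2)).
  apply: (@integrable_bounded_support Omega _ (M ^+ 2)).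
  - exact: OD.
  - exact: measurable_funX.
  - by move=> x; rewrite normrX lerXn2r// nnegrE.
  - by move=> x nO; rewrite pO ?expr0n// => -[].
have iwp : mu.-integrable setT (EFin \o (fun x : T => `|w x| * phi x)).
  by have := ip2; congr (_ = true); congr (integrable _ _ _); apply/funext => x /=; rewrite wp.
have h1 := gap_form_ge au l0 ep p0 pO iwp.
have h2 := half_neg_form_le jG ow ew.
have h3 := dP A phi mA small pA ep.
have I0 : 0 <= \int[mu]_x (phi x ^+ 2) by apply: Rintegral_ge0 => x _; exact: sqr_ge0.
have ie : (\int[mu]_x (phi x ^+ 2 * (2 * L + 1))%:E)%E =
    ((2 * L + 1) * \int[mu]_x (phi x ^+ 2))%:E.
  under eq_integral do rewrite mulrC EFinM.
  rewrite integralZl//.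
  by rewrite EFinM /Rintegral fineK//; exact: integrable_fin_num.
rewrite ie lee_fin in h3.
have wpE : \int[mu]_x (`|w x| * phi x) = \int[mu]_x (phi x ^+ 2).
  by apply: eq_Rintegral => x _; exact: wp.
rewrite wpE in h1.
have I00 : \int[mu]_x (phi x ^+ 2) = 0.
  apply/eqP; rewrite eq_le I0 andbT.
  by move: h1 h2 h3; rewrite -/w -/phi; move: (\int[mu]_x (phi x ^+ 2)) => I h1 h2 h3; lra.
have ip2' : (\int[mu]_x `|(phi x ^+ 2)%:E|)%E = 0%E.
  rewrite (eq_integral (fun x : T => (phi x ^+ 2)%:E)); last first.
    by move=> x _; rewrite gee0_abs// lee_fin sqr_ge0.
  by rewrite -[LHS]fineK ?integrable_fin_num// -[fine _]/(\int[mu]_x (phi x ^+ 2)) I00.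
have /(ae_eq_integral_abs mu measurableT (measurable_int mu ip2)) := ip2'.
apply: filterS => x /(_ Logic.I) [] /eqP; rewrite expf_eq0/= => /eqP px lx.
rewrite leNgt; apply/negP => wx; move: px; rewrite /phi/half_neg lx.
by apply/eqP; rewrite gt_eqF// lt_max oppr_gt0 wx orbT.
Qed.

End admissible.

(** * The strong maximum principle *)

Section gain_estimate.
Context (R : realType) (n : nat).
Local Notation V := 'rV[R]_n.+1.
Local Notation T := (lebRN R n).
Local Notation mu := (@leb R n).
Implicit Types (x y z : V) (u v w phi g h b : V -> R) (l r : R).

Context (j : V -> R) (jG : good_kernel j).
Let mjb : measurable_fun [set: borRN R n] (j : borRN R n -> R). Proof. by case: jG => -[]. Qed.
Let mj : measurable_fun [set: T] (j : T -> R). Proof. exact: bor_leb_measurable_fun. Qed.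

Lemma inv_nat_lt (t : R) : 0 < t ->
  exists N0 : nat, forall N, (N0 <= N)%N -> N.+1%:R^-1 < t.
Proof.
move=> t0; exists (Num.trunc t^-1) => N N0.
rewrite invf_plt ?posrE// (lt_le_trans (truncnS_gt _))//.
by rewrite ler_nat ltnS.
Qed.

Definition far x (rho : R) : set V := ~` box (x - const_mx rho) (x + const_mx rho).

Lemma farP x rho y : ~ far x rho y <-> forall i, `|y ord0 i - x ord0 i| <= rho.
Proof.
split.
  move=> /contrapT yb i; have := yb i; rewrite !mxE => /andP[? ?].
  by rewrite ler_norml; apply/andP; split; lra.
move=> H nb; apply: nb => i; have /andP[? ?] : - rho <= y ord0 i - x ord0 i <= rho.
  by rewrite -ler_norml; exact: H.
rewrite !mxE.
by apply/andP; split; lra.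
Qed.

(** Points y where w is positive and where reflecting y weakens its interaction with x0. The
    set stays away from x0, hence from the support of the barrier; a single parameter N
    quantifies everything. *)
Definition gain_set l w x0 (N : nat) : set V :=
  [set y : V | l < y ord0 ord0] `&` [set y : V | N.+1%:R^-1 < w y] `&` cube N `&`
  far x0 N.+1%:R^-1 `&` [set y : V | 3 * N.+1%:R^-1 < j (x0 - y) - j (x0 - refl l y)].

Lemma measurable_kernel_translate x : measurable_fun [set: T] (fun y : T => j (x - y)).
Proof. exact: (measurableT_comp mj (leb_measurable_isometry (isometry_subl x))). Qed.

Lemma measurable_kernel_reflected l x :
  measurable_fun [set: T] (fun y : T => j (x - refl l y)).
Proof.
exact: (measurableT_comp (measurable_kernel_translate x) (leb_measurable_isometry (isometry_refl l))).
Qed.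

Lemma measurable_gain_set l w x0 N : measurable_fun [set: T] (w : T -> R) ->
  measurable (gain_set l w x0 N : set T).
Proof.
move=> mw; apply: measurableI; last first.
  apply: measurable_fun_ltc; apply: measurable_funB.
    exact: measurable_kernel_translate.
  exact: measurable_kernel_reflected.
apply: measurableI; last by apply: measurableC; exact: leb_measurable_box.
apply: measurableI; last exact: leb_measurable_cube.
apply: measurableI; first exact: measurable_half_space.
exact: measurable_fun_ltc.
Qed.

(** These sets exhaust the points of the half space where w > 0, up to a null set. *)
Lemma gain_set_nonnull l w x0 : measurable_fun [set: T] (w : T -> R) ->
  {ae mu, forall y, l < y ord0 ord0 -> 0 <= w y} ->
  ~ {ae mu, forall y, l < y ord0 ord0 -> w y = 0} -> l < x0 ord0 ord0 ->
  exists N, mu (gain_set l w x0 N) != 0%E.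
Proof.
move=> mw w0 wN lx; apply: contrapT => nN; apply: wN.
have G0 N : mu (gain_set l w x0 N) = 0%E.
  by apply/eqP; rewrite -[_ == _]negbK; apply/negP => H; apply: nN; exists N.
have aeG : {ae mu, forall y, ~ (\bigcup_N gain_set l w x0 N) y}.
  apply/aeP; rewrite -[RHS](leb_bigcup0 G0); congr (lebesgue_outer _).
  by apply/seteqP; split=> y /=; [move/contrapT|move=> + /(_ _)].
have [_ [_ _ /(_ l x0 lx) jm]] := jG.
have ae0 : {ae mu, forall y, y <> x0}.
  apply/aeP; rewrite -[RHS](leb_set1 x0); congr (lebesgue_outer _).
  by apply/seteqP; split=> y /=; [move/contrapT|move=> -> /(_ erefl)].
near=> y => ly.
have wy : 0 <= w y by move: ly; near: y.
apply/eqP; rewrite eq_le wy andbT leNgt; apply/negP => wy0.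
have jy : j (x0 - refl l y) < j (x0 - y) by move: ly; near: y.
have nG : ~ (\bigcup_N gain_set l w x0 N) y by near: y.
have yx : y <> x0 by near: y.
apply: nG.
have [i yi] : exists i, y ord0 i != x0 ord0 i.
  apply: contrapT => H; apply: yx; apply/rowP => i; apply/eqP; rewrite -[_ == _]negbK.
  by apply/negP => Hi; apply: H; exists i.
have [N1 N1P] := inv_nat_lt wy0.
have yi0 : 0 < `|y ord0 i - x0 ord0 i| by rewrite normr_gt0 subr_eq0.
have [N2 N2P] := inv_nat_lt yi0.
have jy0 : 0 < (j (x0 - y) - j (x0 - refl l y)) / 3 by rewrite divr_gt0// subr_gt0.
have [N3 N3P] := inv_nat_lt jy0.
have [m _ ym] : (\bigcup_m @cube R n m) y by rewrite bigcup_cube.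
exists (maxn (maxn N1 N2) (maxn N3 m)) => //; set N := maxn _ _.
have [h1 h2 h3 h4] : [/\ (N1 <= N)%N, (N2 <= N)%N, (N3 <= N)%N & (m <= N)%N].
  by rewrite /N !leq_max !leqnn !orbT.
do 4?split => //.
- exact: N1P.
- exact: le_cube ym.
- move=> yb; have := (farP x0 N.+1%:R^-1 y).1 _ i.
  by move=> /(_ (fun H => H yb)); rewrite leNgt N2P.
- by have := N3P N h3; rewrite /= ltr_pdivlMr// mulrC.
Unshelve. all: by end_near. Qed.

Lemma refl_add l y a : refl l (y + refl 0 a) = refl l y + a.
Proof. by apply/rowP => i; rewrite !(reflE, mxE) eqxx; case: eqP => [->|_]; ring. Qed.

(** At x0 itself the difference of the kernels exceeds 3 eta on the set; for x close to x0
    both kernels change by at most eta except on a set of y of small measure. This is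
    where translations have to be continuous in measure, as the kernel is not continuous. *)
Lemma gain_lower_bound l w x0 N : measurable_fun [set: T] (w : T -> R) ->
  mu (gain_set l w x0 N) != 0%E ->
  exists2 kappa : R, 0 < kappa & exists2 d : R, 0 < d &
    forall x, (forall i, `|x ord0 i - x0 ord0 i| < d) ->
    (kappa%:E <= \int[mu]_y ((N.+1%:R^-1 * \1_(gain_set l w x0 N) y) *
        Num.max 0 (j (x - y) - j (x - refl l y)))%:E)%E.
Proof.
move=> mw muG; set G := gain_set l w x0 N.
have mG : measurable (G : set T) by exact: measurable_gain_set.
have Goo : (mu G < +oo)%E.
  apply: le_lt_trans (leb_cube_lty R n N); apply: le_leb => y [[[_ yN] _] _]; exact: yN.
have fG : (mu G \is a fin_num)%E by rewrite ge0_fin_numE ?leb_ge0.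
pose c := fine (mu G).
have c0 : 0 < c by rewrite fine_gt0// Goo andbT lt0e muG leb_ge0.
have c40 : 0 < c / 4 by rewrite divr_gt0.
pose eta : R := N.+1%:R^-1.
have eta0 : 0 < eta by rewrite invr_gt0.
have [d1 d10 d1P] := leb_translation_continuous N (measurable_kernel_translate x0) eta0 c40.
have [d2 d20 d2P] := leb_translation_continuous N (measurable_kernel_reflected l x0) eta0 c40.
exists (eta ^+ 2 * (c / 2)); first by rewrite mulr_gt0// ?exprn_gt0// divr_gt0.
exists (Num.min d1 d2); first by rewrite lt_min d10.
move=> x xd.
have xd1 i : `|(x0 - x) ord0 i| < d1.
  by rewrite !mxE distrC (lt_le_trans (xd i))// ge_min lexx.
have xd2 i : `|(refl 0 (x0 - x)) ord0 i| < d2.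
  have H k : `|(x0 - x) ord0 k| < d2.
    by rewrite !mxE distrC (lt_le_trans (xd k))// ge_min lexx orbT.
  by rewrite reflE; case: ifP => _; rewrite ?mulr0 ?sub0r ?normrN; exact: H.
set B1 := cube N `&` [set y : V | eta < `|j (x - y) - j (x0 - y)|].
set B2 := cube N `&` [set y : V | eta < `|j (x - refl l y) - j (x0 - refl l y)|].
have B1c : (mu B1 <= (c / 4)%:E)%E.
  have := d1P _ xd1; apply: le_trans; apply: le_leb => y [yN yB]; split=> //=.
  by move: yB => /=; congr (_ < `|j _ - _|); apply/rowP => i; rewrite !mxE; ring.
have B2c : (mu B2 <= (c / 4)%:E)%E.
  have := d2P _ xd2; apply: le_trans; apply: le_leb => y [yN yB]; split=> //=.
  move: yB => /=; congr (_ < `|j _ - _|); rewrite refl_add.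
  by apply/rowP => i; rewrite !(reflE, mxE); ring.
have mB1 : measurable (B1 : set T).
  apply: measurableI; first exact: leb_measurable_cube.
  apply: measurable_fun_ltc; apply: (measurableT_comp (@normr_measurable R setT)).
  by apply: measurable_funB; exact: measurable_kernel_translate.
have mB2 : measurable (B2 : set T).
  apply: measurableI; first exact: leb_measurable_cube.
  apply: measurable_fun_ltc; apply: (measurableT_comp (@normr_measurable R setT)).
  by apply: measurable_funB; exact: measurable_kernel_reflected.
pose D := G `\` (B1 `|` B2).
have mD : measurable (D : set T) by apply: measurableD => //; exact: measurableU.
have Dc : ((c / 2)%:E <= mu D)%E.
  have : (mu G <= mu D + (mu B1 + mu B2))%E.
    apply: (@le_trans _ _ (mu (D `|` (B1 `|` B2)))).
      apply: le_leb => y Gy; have [By|nBy] := pselect ((B1 `|` B2) y); first by right.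
      by left.
    by apply: (le_trans (leb_subadd _ _)); apply: leeD => //; exact: leb_subadd.
  have Dfin : (mu D \is a fin_num)%E.
    rewrite ge0_fin_numE ?leb_ge0//; apply: le_lt_trans Goo; apply: le_leb.
    exact: subDsetl.
  move=> H; have := le_trans H (leeD2l _ (leeD B1c B2c)).
  rewrite -(fineK fG) -(fineK Dfin) -/c -!EFinD !lee_fin; lra.
have mF : measurable_fun [set: T] (fun y : T => ((eta * \1_G y) *
        Num.max 0 (j (x - y) - j (x - refl l y)))%:E).
  apply/measurable_EFinP; apply: measurable_funM.
    by apply: measurable_funM; [exact: measurable_cst|exact: measurable_indic].
  apply: measurable_maxr; first exact: measurable_cst.
  apply: measurable_funB; first exact: measurable_kernel_translate.
  exact: measurable_kernel_reflected.
apply: (@le_trans _ _ (\int[mu]_y ((eta ^+ 2)%:E * (\1_D y)%:E))%E).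
  rewrite ge0_integralZl; [|exact: measurableT|exact/measurable_EFinP/measurable_indic|
    by move=> y _; rewrite lee_fin|by rewrite lee_fin sqr_ge0].
  by rewrite integral_indic// setIT EFinM lee_wpmul2l// lee_fin sqr_ge0.
apply: ge0_le_integral.
- exact: measurableT.
- by move=> y _; rewrite -EFinM lee_fin mulr_ge0// sqr_ge0.
- apply/measurable_EFinP; apply: measurable_funM; first exact: measurable_cst.
  exact: measurable_indic.
- exact: mF.
move=> y _; rewrite -EFinM lee_fin.
have max0 : 0 <= Num.max 0 (j (x - y) - j (x - refl l y)) by rewrite le_max lexx.
rewrite [\1_D y]indicE; have [/set_mem [Gy nBy]|_] := boolP (y \in D); last first.
  by rewrite mulr0 !mulr_ge0// ltW.
rewrite mulr1 indicE mem_set// mulr1 expr2 ler_wpM2l ?(ltW eta0)// le_max; apply/orP; right.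
have [[[[ly wy] yN] yf] /= yj] := Gy.
have n1 : `|j (x - y) - j (x0 - y)| <= eta.
  by rewrite leNgt; apply/negP => H; apply: nBy; left.
have n2 : `|j (x - refl l y) - j (x0 - refl l y)| <= eta.
  by rewrite leNgt; apply/negP => H; apply: nBy; right.
move: n1 n2 yj; rewrite -/eta !ler_norml => /andP[? ?] /andP[? ?] ?; lra.
Qed.

End gain_estimate.

Section strong_maximum.
Context (R : realType) (n : nat).
Local Notation V := 'rV[R]_n.+1.
Local Notation T := (lebRN R n).
Local Notation mu := (@leb R n).
Local Notation pi := (product_measure1 mu mu).
Implicit Types (x y z : V) (u v w phi g h b : V -> R) (l r : R).

Context (j : V -> R) (jG : good_kernel j).
Context (Omega : set V) (OD : symmetric_domain Omega).
Context (L : R) (L0 : 0 <= L).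

Lemma sqn_small (d : R) : 0 < d -> exists2 r, 0 < r & r <= d /\
  forall x, sqn x < r ^+ 2 -> forall i, `|x ord0 i| < d.
Proof.
move=> d0; exists d => //; split => // x xd i.
rewrite -(gtr0_norm d0) -ltr_sqr ?nnegrE// !real_normK ?num_real//.
exact: le_lt_trans (coord_sqr_le x i) xd.
Qed.

Lemma sqn_lt_of_coord (s : R) : 0 < s -> exists2 d : R, 0 < d &
  forall x, (forall i, `|x ord0 i| < d) -> sqn x <= s.
Proof.
move=> s0; exists (Num.min 1 (s / n.+1%:R)); first by rewrite lt_min ltr01 divr_gt0.
move=> x xd; rewrite /sqn (@le_trans _ _ (\sum_(i < n.+1) (s / n.+1%:R)))//.
  apply: ler_sum => i _; have := xd i; rewrite lt_min => /andP[x1 xs].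
  rewrite -real_normK ?num_real// expr2 (le_trans _ (ltW xs))// ler_piMr// ltW//.
by rewrite sumr_const card_ord -(mulr_natr (s / _)) divfK// pnatr_eq0.
Qed.

(** For small eps the gain kappa outweighs all the terms of order eps. *)
Lemma gain_absorption (eps kappa r2 C K I W Fw Fb P : R) :
  0 < eps -> 0 <= I -> 0 < K -> K = 2 * L * r2 + C + 1 -> 2 * (eps * K) = kappa ->
  - (2 * L) * W <= Fw -> Fb <= C * I -> W <= eps * r2 * I ->
  Fw - eps * Fb <= - P -> kappa * I <= P -> I <= 0.
Proof.
move=> eps0 I0 K0 KE epsK h1 h2 h3 h5 h6.
have L20 : 0 <= 2 * L by rewrite mulr_ge0.
have h7 : eps * Fb <= eps * (C * I) by rewrite ler_wpM2l// ltW.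
have h8 : 2 * L * W <= 2 * L * (eps * r2 * I) by rewrite ler_wpM2l.
have h9 : kappa * I <= eps * (K - 1) * I.
  have -> : eps * (K - 1) * I = 2 * L * (eps * r2 * I) + eps * (C * I).
    by rewrite KE; ring.
  move: h1 h5 h6 h7 h8; rewrite mulNr.
  move: (2 * L * W) (2 * L * _) (eps * Fb) (eps * (C * I)) (kappa * I) => *; lra.
have h10 : eps * K * I <= 0.
  have : 0 <= eps * I by rewrite mulr_ge0// ltW.
  have : eps * (K - 1) * I = eps * K * I - eps * I by ring.
  have : kappa * I = 2 * (eps * K * I) by rewrite -epsK; ring.
  move: h9; move: (kappa * I) (eps * (K - 1) * I) (eps * K * I) (eps * I) => *; lra.
by move: h10; rewrite pmulr_rle0// mulr_gt0.
Qed.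

(** The function h = w - eps b is negative only within the support of b, so its negative part phi
    interacts with the whole gain set, from which it gains kappa int phi; all other
    terms are of order eps int phi. Hence phi = 0, that is, w >= eps b on the half space. *)
Theorem strong_maximum_principle u l x0 : admissible j Omega L u -> 0 < l ->
  {ae mu, forall x, l < x ord0 ord0 -> 0 <= reflection_gap l u x} ->
  ~ {ae mu, forall x, l < x ord0 ord0 -> reflection_gap l u x = 0} ->
  Omega x0 -> l < x0 ord0 ord0 ->
  exists2 c : R, 0 < c & exists2 d : R, 0 < d &
    {ae mu, forall y, (forall i, `|y ord0 i - x0 ord0 i| < d) -> c <= reflection_gap l u y}.
Proof.
move=> au l0 w0 wN Ox lx; have [[eu u0 [M uM] uO] _] := au.
set w := reflection_gap l u.
have ew : finite_energy j w by exact: finite_energy_gap.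
have ow : refl_odd l w by exact: refl_odd_gap.
have mw := ew.1.
have [N muG] := gain_set_nonnull jG mw w0 wN lx.
have [kappa k0 [d d0 kd]] := gain_lower_bound jG mw muG.
set G := gain_set j l w x0 N in kd muG.
have mG : measurable (G : set T) by exact: measurable_gain_set.
pose eta : R := N.+1%:R^-1.
have eta0 : 0 < eta by rewrite invr_gt0.
have [oO _ _] := OD.
have /nbhs_rVP[d1 d10 d1P] : nbhs x0 Omega by exact: open_nbhs_nbhs.
(* the ball has to lie in Omega, in the half space, off the gain set, and where kappa is valid *)
pose d2 := Num.min (Num.min d d1) (Num.min eta (x0 ord0 ord0 - l)).
have d20 : 0 < d2 by rewrite /d2 !lt_min d0 d10 eta0 subr_gt0.
have [d2d d2d1 d2e d2l] : [/\ d2 <= d, d2 <= d1, d2 <= eta & d2 <= x0 ord0 ord0 - l].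
  by rewrite /d2 !ge_min !lexx !orbT.
have [r r0 [rd rP]] := sqn_small d20.
have rl : r <= x0 ord0 ord0 - l by exact: le_trans d2l.
pose b := barrier l x0 r.
have b_in y : 0 < b y -> forall i, `|y ord0 i - x0 ord0 i| < d2.
  move=> by0 i; have byE := barrier_gt0 r0 rl by0.
  have : sqn (y - x0) < r ^+ 2 by rewrite -subr_gt0 -byE.
  by move=> /rP/(_ i); rewrite !mxE.
have r00 := ltW r0.
have eb : finite_energy j b by exact: finite_energy_barrier.
have mb := eb.1.
have [C C0 CP] : exists2 C : R, 0 <= C & forall phi, finite_energy j phi ->
    mu.-integrable setT (EFin \o (phi : T -> R)) -> (forall y, 0 <= phi y) ->
    (forall y, b y <= 0 -> phi y = 0) -> energy_form j b phi <= C * \int[mu]_y phi y.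
  exists ((2 + 4 * r ^+ 2) * fine (\int[mu]_z (levy_density j z)%:E)).
    exact: barrier_const_ge0.
  by move=> phi; exact: barrier_form_le.
pose K := 2 * L * r ^+ 2 + C + 1.
have K0 : 0 < K.
  have : 0 <= 2 * L * r ^+ 2 by rewrite !mulr_ge0// sqr_ge0.
  by rewrite /K; move: C0; lra.
(* eps (2 L r^2 + C + 1) is half of kappa *)
pose eps := kappa / (2 * K).
have eps0 : 0 < eps by rewrite divr_gt0// mulr_gt0.
have epsK : 2 * (eps * K) = kappa.
  by rewrite /eps; field; rewrite gt_eqF.
pose h x := w x - eps * b x.
have eh : finite_energy j h.
  have := finite_energy_lincomb jG 1 (- eps) ew eb.
  by rewrite (_ : (fun x => _) = h)//; apply/funext => x; rewrite /h mul1r mulNr.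
have oh : refl_odd l h.
  by move=> x; rewrite /h ow [b (refl l x)]barrier_odd -/b; ring.
set phi := half_neg l h.
have ephi : finite_energy j phi by exact: half_neg_finite_energy.
have mA : measurable ([set y : V | 0 < b y] : set T) by exact: measurable_fun_ltc.
(* almost everywhere equal to phi, but with support in the ball where b > 0 *)
pose phi' y := phi y * \1_[set y : V | 0 < b y] y.
have mphi' : measurable_fun [set: T] (phi' : T -> R).
  by apply: measurable_funM; [exact: ephi.1|exact: measurable_indic].
have p'in y : 0 < b y -> phi' y = phi y.
  by move=> by0; rewrite /phi' indicE mem_set ?mulr1.
have p'out y : b y <= 0 -> phi' y = 0.
  by move=> by0; rewrite /phi' indicE memNset ?mulr0//= => /lt_geF; rewrite by0.
have phi0 y : 0 <= phi y by exact: half_neg_ge0.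
have phi'0 y : 0 <= phi' y.
  by have [/p'out->//|/p'in->] := leP (b y) 0.
have phi'w y : 0 < b y -> phi y != 0 -> l < y ord0 ord0 /\ w y < eps * b y.
  move=> by0; rewrite /phi/half_neg; case: ifP => [ly|]; last by rewrite eqxx.
  move=> H; split=> //; rewrite ltNge; apply/negP => wb; move: H.
  by rewrite (_ : Num.max _ _ = 0) ?eqxx//; apply/max_idPl; rewrite /h; move: wb; clear; lra.
have ae_phi : {ae mu, forall y, phi y = phi' y}.
  apply: filterS w0 => y wy; have [by0|/p'in->//] := leP (b y) 0.
  rewrite p'out// /phi/half_neg; case: ifP => // ly; apply/max_idPl.
  have := wy ly; rewrite -/w /h.
  have : eps * b y <= 0 by rewrite mulr_ge0_le0// ltW.
  clear; lra.
have ephi' : finite_energy j phi' by exact: ae_eq_finite_energy ae_phi ephi.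
have phi'O y : ~ (Omega y /\ l < y ord0 ord0) -> phi' y = 0.
  move=> nO; have [/p'out//|by0] := leP (b y) 0.
  have yin := b_in _ by0; exfalso; apply: nO; split.
    by apply: d1P => i; exact: lt_le_trans (yin i) d2d1.
  have := yin ord0; rewrite ltr_norml => /andP[]; move: d2l; clear; lra.
have b_le y : b y <= r ^+ 2.
  by rewrite (le_trans (ler_norm _))//; exact: normr_barrier_le.
have wphi y : l < y ord0 ord0 -> 0 <= w y -> `|w y| * phi' y <= eps * r ^+ 2 * phi' y.
  move=> ly wy; have [/p'out->|by0] := leP (b y) 0; first by rewrite !mulr0.
  have [p0|pN] := eqVneq (phi y) 0; first by rewrite p'in// p0 !mulr0.
  rewrite ler_wpM2r// ger0_norm//; have [_ wb] := phi'w y by0 pN.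
  by rewrite (le_trans (ltW wb))// ler_wpM2l// ltW.
have M0 : 0 <= M by rewrite (le_trans (u0 0)).
have wM x : `|w x| <= M.
  have := u0 x; have := u0 (refl l x); have := uM x; have := uM (refl l x).
  rewrite /w/reflection_gap; move: (u x) (u _) => a c; clear => *.
  by rewrite ler_norml; apply/andP; split; lra.
have phi'M y : `|phi' y| <= M + eps * r ^+ 2.
  have P0 : 0 <= M + eps * r ^+ 2.
    by rewrite addr_ge0// mulr_ge0 ?sqr_ge0// ltW.
  have [/p'out->|by0] := leP (b y) 0; first by rewrite normr0.
  rewrite p'in// ger0_norm// /phi/half_neg; case: ifP => // _; rewrite ge_max P0/= /h opprB.
  have := wM y; rewrite ler_norml => /andP[w1 _].
  have : eps * b y <= eps * r ^+ 2 by rewrite ler_wpM2l// ltW.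
  move: w1; clear; lra.
have ip' : mu.-integrable setT (EFin \o (phi' : T -> R)).
  apply: (integrable_bounded_support OD mphi' phi'M) => x nO.
  by apply: phi'O => -[].
have iwp : mu.-integrable setT (EFin \o (fun x : T => `|w x| * phi' x)).
  apply: (integrable_bounded_mul (M := M) _ _ ip').
    exact: (measurableT_comp (@normr_measurable R setT) mw).
  by move=> x; rewrite normr_id.
have I0 : 0 <= \int[mu]_x phi' x by apply: Rintegral_ge0 => x _; exact: phi'0.
have h1 := gap_form_ge jG OD au l0 ephi' phi'0 phi'O iwp.
have h2 := CP _ ephi' ip' phi'0 p'out.
have h3 : \int[mu]_x (`|w x| * phi' x) <= eps * r ^+ 2 * \int[mu]_x phi' x.
  rewrite -RintegralZl//; apply: ae_le_Rintegral => //.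
    exact: (integrableZl measurableT _ ip').
  apply: filterS w0 => x wx.
  have [lx'|nl] := ltP l (x ord0 ord0); first by apply: wphi => //; exact: wx.
  by rewrite phi'O ?mulr0// => -[_]; rewrite ltNge nl.
have h4 : energy_form j h phi = energy_form j w phi' - eps * energy_form j b phi'.
  rewrite [LHS]energy_formC (ae_eq_energy_form jG ephi.1 mphi' eh.1 ae_phi).
  rewrite -[LHS]energy_formC -mulNr -[X in X + _]mul1r.
  rewrite -(energy_form_lincomb jG 1 (- eps) ew eb ephi').
  by congr (energy_form j _ _); apply/funext => x; rewrite /h mul1r mulNr.
(* on the gain set w > eta and b <= 0, hence h > eta there for every eps *)
pose g y := eta * \1_G y.
have mg : measurable_fun [set: T] (g : T -> R).
  by apply: measurable_funM; [exact: measurable_cst|exact: measurable_indic].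
have Gb y : G y -> b y <= 0.
  move=> [[[_ _] fy] _]; rewrite leNgt; apply/negP => /b_in yb.
  have := fy; apply: (farP _ _ _).2 => i; rewrite ltW// (lt_le_trans (yb i))//.
have gh y : 0 <= g y <= Num.max 0 (h y).
  rewrite /g indicE; have [/set_mem Gy|_] := boolP (y \in G); last first.
    by rewrite mulr0 lexx le_max lexx.
  rewrite mulr1 ltW//= le_max; apply/orP; right.
  have [[[[_ wy] _] _] _] := Gy; rewrite /= in wy.
  have : eps * b y <= 0 by rewrite mulr_ge0_le0 ?Gb// ltW.
  rewrite /h; move: wy; rewrite -/eta; move: (w y) (eps * b y); clear => *; lra.
have gl y : y ord0 ord0 <= l -> g y = 0.
  move=> yl; rewrite /g indicE memNset ?mulr0// => -[[[[/= ly _] _] _] _].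
  by move: yl; rewrite leNgt ly.
have [iG h5] := half_neg_form_gain jG oh eh mg gh gl.
have h6 : kappa * \int[mu]_x phi' x <= \int[pi]_p gain_density j l h g p.
  have G0 p : 0 <= gain_density j l h g p.
    rewrite /gain_density mulr_ge0 ?le_max ?lexx// mulr_ge0 ?half_neg_ge0//.
    by case/andP: (gh p.2).
  have mGd : measurable_fun setT (EFin \o gain_density j l h g) := measurable_int pi iG.
  have G0' (p : T * T) : (0 <= (EFin \o gain_density j l h g) p)%E by rewrite lee_fin.
  have -> : kappa * \int[mu]_x phi' x = \int[mu]_x (kappa * phi' x) by rewrite RintegralZl.
  have ikp := integrableZl measurableT kappa ip'.
  rewrite -lee_fin; rewrite fineK; last exact: (integrable_fin_num measurableT ikp).
  rewrite fineK; last exact: (integrable_fin_num measurableT iG).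
  rewrite [leRHS](fubini_tonelli1 _ mGd G0').
  have mF := measurable_fun_fubini_tonelli_F (m2 := mu) _ mGd G0'.
  apply: ae_ge0_le_integral.
  - exact: measurableT.
  - by move=> x _; rewrite lee_fin mulr_ge0// ltW.
  - exact: (measurable_int mu ikp).
  - by move=> x _; apply: integral_ge0 => y _; exact: G0'.
  - exact: mF.
  apply: filterS ae_phi => x px _; rewrite /fubini_F /=.
  have [/p'out->|bx0] := leP (b x) 0.
    by rewrite mulr0; apply: integral_ge0 => y _; exact: G0'.
  have xd i : `|x ord0 i - x0 ord0 i| < d by exact: lt_le_trans (b_in _ bx0 i) d2d.
  rewrite (eq_integral (fun y : T => (phi' x)%:E * ((N.+1%:R^-1 * \1_G y) *
      Num.max 0 (j (x - y) - j (x - refl l y)))%:E)%E); last first.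
    by move=> y _; rewrite -px -EFinM; congr (_%:E); exact: esym (mulrA _ _ _).
  rewrite ge0_integralZl; last 4 first.
  - exact: measurableT.
  - apply/measurable_EFinP; apply: measurable_funM; first exact: mg.
    apply: measurable_maxr; first exact: measurable_cst.
    apply: measurable_funB; first exact: measurable_kernel_translate.
    exact: measurable_kernel_reflected.
  - move=> y _; rewrite lee_fin; apply: mulr_ge0; last by rewrite le_max lexx.
    by have /andP[gy _] := gh y; exact: gy.
  - by rewrite lee_fin.
  rewrite mulrC EFinM; apply: lee_wpmul2l; first by rewrite lee_fin.
  exact: kd.
have I00 : \int[mu]_x phi' x = 0.
  rewrite -/phi h4 in h5; rewrite -/w in h1.
  apply/eqP; rewrite eq_le I0 andbT.
  exact: (gain_absorption eps0 I0 K0 erefl epsK h1 h2 h3 h5 h6).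
have aephi : {ae mu, forall y, phi y = 0}.
  have ip2' : (\int[mu]_x `|(phi' x)%:E|)%E = 0%E.
    rewrite (eq_integral (fun x : T => (phi' x)%:E)); last first.
      by move=> x _; rewrite gee0_abs// lee_fin.
    by rewrite -[LHS]fineK ?integrable_fin_num// -[fine _]/(\int[mu]_x phi' x) I00.
  have /(ae_eq_integral_abs mu measurableT (measurable_int mu ip')) H := ip2'.
  near=> y; have -> : phi y = phi' y by near: y.
  have : setT y -> (phi' y)%:E = 0%E by near: y.
  by move=> /(_ Logic.I) [].
have r220 : 0 < r ^+ 2 / 2 by rewrite divr_gt0// exprn_gt0.
have [d3 d30 d3P] := sqn_lt_of_coord r220.
exists (eps * (r ^+ 2 / 2)); first by rewrite mulr_gt0.
exists (Num.min d3 d2); first by rewrite lt_min d30.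
apply: filterS aephi => y phy yd.
have yd3 : sqn (y - x0) <= r ^+ 2 / 2.
  by apply: d3P => i; rewrite !mxE (lt_le_trans (yd i))// ge_min lexx.
have by0 : r ^+ 2 / 2 <= b y.
  by have := barrier_ge r0 rl y; rewrite -/b; move: yd3; clear; lra.
have ly : l < y ord0 ord0.
  have : `|y ord0 ord0 - x0 ord0 ord0| < d2 by rewrite (lt_le_trans (yd ord0))// ge_min lexx orbT.
  by rewrite ltr_norml => /andP[]; move: d2l; clear; lra.
have : 0 <= h y.
  rewrite leNgt; apply/negP => hy; move: phy; rewrite /phi/half_neg ly.
  by apply/eqP; rewrite gt_eqF// lt_max oppr_gt0 hy orbT.
rewrite /h subr_ge0; apply: le_trans; rewrite ler_wpM2l// ltW//.
Unshelve. all: by end_near. Qed.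

End strong_maximum.

(** * Moving the planes *)

Section planes_in_measure.
Context (R : realType) (n : nat).
Local Notation V := 'rV[R]_n.+1.
Local Notation T := (lebRN R n).
Local Notation mu := (@leb R n).
Implicit Types (x y z : V) (u v w b : V -> R) (l r : R) (U Z : set V).

Definition gap_nonneg l u := {ae mu, forall x, l < x ord0 ord0 -> 0 <= reflection_gap l u x}.

Lemma leb_le_eps0 Z : (forall e : R, 0 < e -> (mu Z <= e%:E)%E) -> mu Z = 0%E.
Proof.
move=> Ze; apply/eqP; rewrite eq_le leb_ge0 andbT; apply/lee_addgt0Pr => e e0.
by rewrite add0e Ze.
Qed.

(** A set that is locally null is null, since countably many boxes suffice. *)
Lemma locally_null_leb U Z :
  (forall x, U x -> exists2 d : R, 0 < d &
    mu (Z `&` [set y : V | forall i, `|y ord0 i - x ord0 i| < d]) = 0%E) ->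
  mu (U `&` Z) = 0%E.
Proof.
move=> UZ; pose F (k : nat * 'rV[int]_n.+1) : set V :=
  if `[< mu (Z `&` small_box (grid_point R k.1 k.2) k.1) = 0%E >]
  then Z `&` small_box (grid_point R k.1 k.2) k.1 else set0.
have F0 k : mu (F k) = 0%E by rewrite /F; case: asboolP => // _; exact: measure0.
apply/eqP; rewrite eq_le leb_ge0 andbT -(leb_bigcup0_count F0); apply: le_leb => x [Ux Zx].
have [d d0 dU] := UZ x Ux; have [m mP] := small_box_sub x (divr_gt0 d0 (@ltr0n R 2)).
have [p px] := mem_grid m x; exists (m, p) => //=.
rewrite /F asboolT//=; apply/eqP; rewrite eq_le leb_ge0 andbT -dU; apply: le_leb.
move=> y [Zy yp]; split=> // i.
have := mP _ _ px i; have := mP _ _ yp i => yg xg.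
have -> : y ord0 i - x ord0 i = (y ord0 i - grid_point R m p ord0 i) -
    (x ord0 i - grid_point R m p ord0 i) by ring.
by rewrite (le_lt_trans (ler_normB _ _))// (splitr d) ltrD.
Qed.

(** Reflections in two hyperplanes differ by a translation. *)
Lemma leb_reflection_continuous u l N (eta e : R) : measurable_fun [set: T] (u : T -> R) ->
  0 < eta -> 0 < e -> exists2 d : R, 0 < d & forall m, `|m - l| < d ->
    (mu (cube N `&` [set x : V | (eta < `|u (refl m x) - u (refl l x)|)%R]) <= e%:E)%E.
Proof.
move=> mu_ eta0 e0.
have mul : measurable_fun [set: T] ((u \o refl l) : T -> R).
  exact: (measurableT_comp mu_ (leb_measurable_isometry (isometry_refl l))).
have [d d0 dP] := leb_translation_continuous N mul eta0 e0.
exists (d / 2); first by rewrite divr_gt0.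
move=> m ml; pose h : V := \row_i (if i == ord0 then 2 * (l - m) else 0).
have hd i : `|h ord0 i| < d.
  rewrite mxE; case: ifP => _; last by rewrite normr0.
  by rewrite normrM ger0_norm// distrC mulrC -ltr_pdivlMr.
have := dP _ hd; congr (mu _ <= _)%E; congr (_ `&` _); apply/seteqP; split=> x /=.
all: rewrite (_ : refl l (x + h) = refl m x)//; apply/rowP => i; rewrite !(reflE, mxE) eqxx.
all: by case: eqP => _; [ring|rewrite addr0].
Qed.

Lemma gap_nonneg_closed u l : measurable_fun [set: T] (u : T -> R) ->
  (forall d : R, 0 < d -> exists2 m, `|m - l| < d & gap_nonneg m u) -> gap_nonneg l u.
Proof.
move=> mu_ H.
pose E k : set V := cube k `&` [set x : V | l + k.+1%:R^-1 < x ord0 ord0] `&`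
  [set x : V | reflection_gap l u x < - k.+1%:R^-1].
have E0 k : mu (E k) = 0%E.
  apply: leb_le_eps0 => e e0; have k0 : 0 < k.+1%:R^-1 :> R by rewrite invr_gt0.
  have [d d0 dP] := leb_reflection_continuous l k mu_ k0 e0.
  have [|m ml /aeP Tm] := H (Num.min d k.+1%:R^-1); first by rewrite lt_min d0.
  have [md mk] : `|m - l| < d /\ `|m - l| < k.+1%:R^-1.
    by move: ml; rewrite lt_min => /andP.
  rewrite -[leRHS]add0e -[X in (X + _)%E]Tm; apply: le_trans (leeD (lexx _) (dP _ md)).
  apply: le_trans (leb_subadd _ _); apply: le_leb => x [[xk lx] gx].
  have mx : m < x ord0 ord0.
  move: mk lx; rewrite ltr_norml /= => /andP[_]; move: (_^-1) (x _ _); clear => *; lra.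
  have [gm|gm] := leP 0 (reflection_gap m u x); last first.
    by left => /= /(_ mx); rewrite leNgt gm.
  right; split => //=; rewrite (lt_le_trans _ (ler_norm _))//.
  move: gm gx; rewrite /reflection_gap/=; move: (u _) (u _) (u _) (_^-1).
  by clear => *; lra.
apply/aeP/eqP; rewrite eq_le leb_ge0 andbT -(leb_bigcup0 E0); apply: le_leb => x /= nx.
have [lx gx] : l < x ord0 ord0 /\ reflection_gap l u x < 0.
  apply: contrapT => H2; apply: nx => lx; rewrite leNgt; apply/negP => gx.
  exact: H2.
have lx0 : 0 < x ord0 ord0 - l by rewrite subr_gt0.
have [k1 k1P] := inv_nat_lt lx0.
have gx0 : 0 < - reflection_gap l u x by rewrite oppr_gt0.
have [k2 k2P] := inv_nat_lt gx0.
have [m _ xm] : (\bigcup_m @cube R n m) x by rewrite bigcup_cube.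
pose k := maxn m (maxn k1 k2).
have [h1 h2 h3] : [/\ (m <= k)%N, (k1 <= k)%N & (k2 <= k)%N] by rewrite /k !leq_max !leqnn !orbT.
exists k => //; split; last by rewrite /= ltrNr k2P.
by split; [exact: le_cube xm|rewrite /= -ltrBrDl k1P].
Qed.

Lemma leb_slab_le N l (e : R) : 0 < e -> exists2 d : R, 0 < d &
  (mu (cube N `&` [set x : V | (l - d < x ord0 ord0 <= l)%R]) <= e%:E)%E.
Proof.
move=> e0; pose P : R := \prod_(i < n.+1 | i != ord0) (2 * N%:R).
have P0 : 0 <= P by apply: prodr_ge0 => i _; rewrite mulr_ge0.
exists (e / (P + 1)); first by rewrite divr_gt0// ltr_wpDl.
set d := e / _; have d0 : 0 <= d by rewrite divr_ge0 ?(ltW e0)// addr_ge0.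
pose a : V := \row_i (if i == ord0 then l - d else - N%:R).
pose b : V := \row_i (if i == ord0 then l else N%:R).
apply: (@le_trans _ _ (mu (box a b))).
  apply: le_leb => x [/cubeP xN /andP[x1 x2]] i; rewrite !mxE.
  by case: eqP => [->|_]; [rewrite ltW|rewrite -ler_norml].
have ab i : a ord0 i <= b ord0 i.
  by rewrite !mxE; case: ifP => _; [rewrite gerBl|rewrite ge0_cp].
apply: (le_trans (lebesgue_outer_box_le ab)); rewrite lee_fin /box_vol (bigD1 ord0)//=.
rewrite !mxE eqxx opprB addrC subrK.
rewrite (eq_bigr (fun=> 2 * N%:R)); last first.
  by move=> i /negbTE i0; rewrite !mxE i0 opprK mulr2n mulrDl mul1r.
by rewrite -/P /d mulrAC ler_pdivrMr ?ltr_wpDl// ler_pM2l// lerDl.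
Qed.

Lemma small_values_continuous (A : set V) N (g : V -> R) (e : R) :
  measurable (A : set T) -> measurable_fun [set: T] (g : T -> R) -> A `<=` cube N ->
  {ae mu, forall x, A x -> 0 < g x} -> 0 < e ->
  exists2 eta : R, 0 < eta & (mu (A `&` [set x : V | (g x <= eta)%R]) <= e%:E)%E.
Proof.
move=> mA mg AN g0 e0.
pose F k : set V := A `&` [set x : V | g x <= k.+1%:R^-1].
have mF k : measurable (F k : set T).
  apply: measurableI => //; rewrite (_ : [set x : V | _] = ~` [set x : V | k.+1%:R^-1 < g x]).
    by apply: measurableC; exact: measurable_fun_ltc.
  by apply/seteqP; split=> x /=; rewrite leNgt => /negP.
have F0 : mu (\bigcap_k F k) = 0%E.
  move/aeP: g0 => g0; apply/eqP; rewrite eq_le leb_ge0 andbT -g0; apply: le_leb.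
  move=> x Fx /= gx; have [Ax _] := Fx 0%N Logic.I.
  have [N0 N0P] := inv_nat_lt (gx Ax).
  by have [_] := Fx N0 Logic.I; rewrite /= leNgt N0P.
have F0oo : (mu (F 0%N) < +oo)%E.
  by apply: le_lt_trans (leb_cube_lty R n N); apply: le_leb => x [/AN].
have ndF : nonincreasing_seq F.
  apply/nonincreasing_seqP => k; apply/subsetPset => x [Ax /= gx]; split=> //=.
  by rewrite (le_trans gx)// lef_pV2 ?posrE// ler_nat.
have mcap : measurable (\bigcap_k F k : set T) by apply: bigcapT_measurable.
have := @nonincreasing_cvg_mu _ T R mu F F0oo mF.
move=> /(_ mcap ndF); rewrite [X in _ --> X](_ : _ = 0%E); last exact: F0.
move=> /fine_cvgP[H1 /cvgrPdist_le/(_ _ e0) H2].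
have [k kP] : exists k, (mu (F k) <= e%:E)%E.
  have : \forall k \near \oo, (mu (F k) <= e%:E)%E.
    near=> k.
    have fk : (mu (F k) \is a fin_num)%E by near: k.
    have : (`|0 - fine (mu (F k))| <= e)%R by near: k.
    rewrite sub0r normrN -(fineK fk) lee_fin; apply: le_trans; exact: ler_norm.
  by move=> [K _ KP]; exists K; apply: KP => /=.
by exists k.+1%:R^-1.
Unshelve. all: by end_near. Qed.

End planes_in_measure.

Section continuation.
Context (R : realType) (n : nat).
Local Notation V := 'rV[R]_n.+1.
Local Notation T := (lebRN R n).
Local Notation mu := (@leb R n).
Implicit Types (x y z : V) (u v w phi g h b : V -> R) (l r : R).

Context (j : V -> R) (jG : good_kernel j).
Context (Omega : set V) (OD : symmetric_domain Omega).
Context (L : R) (L0 : 0 <= L).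

Lemma gap_ae_gt0 u l : admissible j Omega L u -> 0 < l -> gap_nonneg l u ->
  ~ {ae mu, forall x, l < x ord0 ord0 -> reflection_gap l u x = 0} ->
  {ae mu, forall x, (Omega `&` [set y : V | l < y ord0 ord0]) x -> 0 < reflection_gap l u x}.
Proof.
move=> au l0 w0 wN.
pose A := Omega `&` [set y : V | l < y ord0 ord0].
have H : mu (A `&` [set x : V | ~ 0 < reflection_gap l u x]) = 0%E.
  apply: locally_null_leb => x [Ox lx].
  have [c c0 [d d0 /aeP dP]] := strong_maximum_principle jG OD L0 au l0 w0 wN Ox lx.
  exists d => //; apply/eqP; rewrite eq_le leb_ge0 andbT -dP; apply: le_leb.
  by move=> y [/= ny yd] /(_ yd) cy; apply: ny; exact: lt_le_trans cy.
apply/aeP; rewrite -[RHS]H; congr (mu _); apply/seteqP; split=> x /=.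
  by move=> nx; split; [apply: contrapT => nA; apply: nx|move=> gx; apply: nx].
by move=> [Ax gx] /(_ Ax).
Qed.

(** A neighbouring gap can be negative at x only if x lies in a thin slab between the two
    hyperplanes, or the positive gap at x is small, or it changes by a definite amount:
    three sets of small measure. *)
Lemma gap_nonneg_open u l : admissible j Omega L u -> 0 < l -> gap_nonneg l u ->
  ~ {ae mu, forall x, l < x ord0 ord0 -> reflection_gap l u x = 0} ->
  exists2 d : R, 0 < d & forall m, 0 < m -> `|m - l| < d -> gap_nonneg m u.
Proof.
move=> au l0 w0 wN; have [[eu u0 _ uO] _] := au.
have [D D0 DP] := small_volume_maximum_principle jG OD L0.
have [oO [N ON] _] := OD.
have mO := open_leb_measurable oO.
have e0 : 0 < D / 3 by rewrite divr_gt0.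
have eD : D / 3 + (D / 3 + D / 3) <= D by lra.
set e := D / 3 in e0.
have mA : measurable ((Omega `&` [set y : V | l < y ord0 ord0]) : set T).
  by apply: measurableI => //; exact: measurable_half_space.
have mw := (finite_energy_gap jG l eu).1.
have AN : Omega `&` [set y : V | l < y ord0 ord0] `<=` cube N by move=> y [/ON].
have [eta eta0 h2] := small_values_continuous mA mw AN (gap_ae_gt0 au l0 w0 wN) e0.
have [d1 d10 h1] := leb_slab_le n N l e0.
have [d2 d20 h3] := leb_reflection_continuous l N eu.1 eta0 e0.
exists (Num.min d1 d2); first by rewrite lt_min d10.
move=> m m0; rewrite lt_min => /andP[md1 md2]; apply: DP => //.
apply: (@le_trans _ _ (e%:E + (e%:E + e%:E))%E); last first.
  by rewrite -!EFinD lee_fin.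
apply: le_trans (leeD h1 (leeD h2 (h3 _ md2))).
apply: le_trans (leeD (lexx _) (leb_subadd _ _)).
apply: le_trans (leb_subadd _ _); apply: le_leb => x [mx gx].
have Ox : Omega x.
  apply: contrapT => /uO ux; move: gx.
  by rewrite /reflection_gap ux subr0 ltNge u0.
have [xl|lx] := leP (x ord0 ord0) l.
  left; split; first exact: ON.
  rewrite /= xl andbT; move: mx md1; rewrite ltr_norml => + /andP[+ _].
  by move: (x _ _); clear => *; lra.
right; have [wx|wx] := leP (reflection_gap l u x) eta; first by left.
right; split; first exact: ON.
rewrite /= distrC (lt_le_trans _ (ler_norm _))//.
move: wx gx; rewrite /reflection_gap; move: (u _) (u _) (u _).
by clear => *; lra.
Qed.

Lemma Omega_refl0 x : Omega x -> Omega (refl 0 x).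
Proof.
by have [_ _ OS] := OD => Ox; apply: OS => //; rewrite mulr0 sub0r normrN.
Qed.

Lemma admissible_refl0 u : admissible j Omega L u -> admissible j Omega L (u \o refl 0).
Proof.
move=> [[eu u0 [M uM] uO] [b ub bL]]; split.
  split; first exact: finite_energy_refl.
  - by move=> x; exact: u0.
  - by exists M => x; exact: uM.
  - by move=> x nO; apply: uO => /Omega_refl0; rewrite reflK.
exists (b \o refl 0).
  move=> phi ep pO; have epQ := finite_energy_refl jG 0 ep.
  have pQO x : ~ Omega x -> (phi \o refl 0) x = 0.
    by move=> nO; apply: pO => /Omega_refl0; rewrite reflK.
  have [ib eb] := ub _ epQ pQO.
  have bQO x : ~ Omega x -> b x * (phi \o refl 0) x = 0 by move=> nO; rewrite pQO// mulr0.
  have bO x : ~ Omega x -> (b \o refl 0) x * phi x = 0 by move=> nO; rewrite pO// mulr0.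
  rewrite integral_support// in eb; rewrite integral_support//.
  have ib' := integrable_support OD bQO ib.
  have ib2 := leb_integrable_isometry (isometry_refl 0) ib'.
  have [oO _ _] := OD; have mO := open_leb_measurable oO.
  split.
    apply: (integrableS measurableT) => //.
    have := ib2; congr (_ = true); congr (integrable _ _ _).
    by apply/funext => x /=; rewrite reflK.
  have -> : energy_form j (u \o refl 0) phi = energy_form j u (phi \o refl 0).
    have := energy_form_refl jG 0 eu epQ; rewrite (_ : (phi \o refl 0) \o refl 0 = phi)//.
    by apply/funext => x /=; rewrite reflK.
  rewrite eb; have mb : measurable_fun [set: T] ((fun x => b x * (phi \o refl 0) x) : T -> R).
    exact/measurable_EFinP/(measurable_int mu ib').
  rewrite -(Rintegral_isometry (isometry_refl 0) mb); apply: eq_Rintegral => x _.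
  by rewrite /= reflK.
move=> l lN0; have lN : - l != 0 by rewrite oppr_eq0.
have x0E x : refl (- l) (refl 0 x) = refl 0 (refl l x) by rewrite refl_refl0 opprK.
apply: filterS (ae_isometry (isometry_refl 0) (bL _ lN)) => x H Ox x1.
have := H (Omega_refl0 Ox); rewrite x0E reflE eqxx mulr0 sub0r invrN mulrNN => /(_ x1).
by rewrite /reflection_gap x0E.
Qed.

End continuation.

Section conclusion.
Context (R : realType) (n : nat).
Local Notation V := 'rV[R]_n.+1.
Local Notation mu := (@leb R n).
Implicit Types (x y z : V) (u v w phi g h b : V -> R) (l r : R).

Context (j : V -> R) (jG : good_kernel j).

Lemma neighborhood_nonnull x (P : V -> Prop) (d : R) : 0 < d ->
  (forall y, (forall i, `|y ord0 i - x ord0 i| < d) -> P y) -> ~ {ae mu, forall y, ~ P y}.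
Proof.
move=> d0 dP /aeP P0.
pose U : set V := [set y : V | forall i, `|y ord0 i - x ord0 i| < d].
have Ux : (U°) x by apply/nbhs_rVP; exists d.
have U0 : mu (U°) = 0%E.
  apply/eqP; rewrite eq_le leb_ge0 andbT -P0; apply: le_leb => y /interior_subset.
  by move=> /dP Py; apply.
have V0 := open_null_leb (open_interior _) Ux U0.
have [[mj _ _ _] [_ joo _]] := jG.
suff : (\int[mu]_z (j z)%:E = 0)%E by rewrite joo.
apply: null_set_integral; [exact: measurableT| |exact: V0].
apply/measurable_EFinP; exact: bor_leb_measurable_fun mj.
Qed.

Context (Omega : set V) (OD : symmetric_domain Omega).
Context (L : R) (L0 : 0 <= L).

Lemma gap_zero_ae u l :
  {ae mu, forall x, l < x ord0 ord0 -> reflection_gap l u x = 0} ->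
  {ae mu, forall x, u (refl l x) = u x}.
Proof.
move=> w0; have w1 := ae_isometry (isometry_refl l) w0.
apply: filterS2 w0 w1 => x x1; rewrite /= /reflection_gap reflK reflE eqxx => x2.
have [lx|xl|xl] := ltgtP l (x ord0 ord0).
- by apply/eqP; rewrite -subr_eq0; apply/eqP; exact: x1.
- have lx : l < 2 * l - x ord0 ord0 by lra.
  by apply/esym/eqP; rewrite -subr_eq0; apply/eqP; exact: x2.
- by rewrite refl_fix.
Qed.

(** Let s be the right end of Omega. If u is symmetric about some l > 0, it vanishes where x_1 < 2 l - s,
    so its mirror image v = u o refl 0 vanishes where x_1 > s - 2 l. For m slightly smaller
    than s the gap of v at m is then nonnegative, and zero near the points of Omega with
    x_1 > m; by the strong maximum principle v is symmetric about m too, and then it vanishes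
    on both sides. *)
Lemma gap_zero_trivial u l : admissible j Omega L u -> 0 < l ->
  {ae mu, forall x, l < x ord0 ord0 -> reflection_gap l u x = 0} ->
  {ae mu, forall x, u x = 0}.
Proof.
move=> au l0 /gap_zero_ae usym; have [[eu u0 _ uO] _] := au.
have [oO [N ON] OS] := OD.
have [[X0 OX0]|Oe] := pselect (exists x, Omega x); last first.
  by apply/aeP; rewrite (_ : [set _ | _] = set0) ?measure0//; apply/seteqP; split=> x //=;
    apply; apply: uO => Ox; apply: Oe; exists x.
pose S := [set x ord0 ord0 | x in Omega].
have ubS : has_ubound S.
  exists N%:R => _ [x Ox <-]; have /cubeP/(_ ord0) := ON _ Ox.
  by apply: le_trans; exact: ler_norm.
have hsS : has_sup S by split => //; exists (X0 ord0 ord0), X0.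
have [s sE] : exists s, s = sup S by exists (sup S).
have leS x : Omega x -> x ord0 ord0 <= s by move=> Ox; rewrite sE; apply: ub_le_sup => //; exists x.
have s0 : 0 < s.
  have /nbhs_rVP[d d0 dP] : nbhs X0 Omega by exact: open_nbhs_nbhs.
  have [XN|X0p] := ltP (X0 ord0 ord0) 0.
    have := leS _ (OS X0 (- X0 ord0 ord0) OX0 _); rewrite normrN => /(_ (lexx _)).
    by rewrite set_coordE eqxx => ?; lra.
  have d20 : 0 < d / 2 by rewrite divr_gt0.
  have /leS : Omega (set_coord X0 ord0 (X0 ord0 ord0 + d / 2)).
    apply: dP => i; rewrite set_coordE; case: eqP => [->|_]; last by rewrite subrr normr0.
    by rewrite addrAC subrr add0r gtr0_norm// ltr_pdivrMr// ltr_pMr// ltr1n.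
  by rewrite set_coordE eqxx => ?; lra.
pose v := u \o refl 0.
have av : admissible j Omega L v by exact: admissible_refl0.
have [[ev v0 _ vO] _] := av.
have v_supp : {ae mu, forall x, s - 2 * l < x ord0 ord0 -> v x = 0}.
  apply: filterS (ae_isometry (isometry_refl 0) usym) => x /= ux sx.
  rewrite /v /= -ux; apply: uO => /leS; rewrite !reflE eqxx; apply/negP; rewrite -ltNge.
  by lra.
(* the last inequality puts the reflection at m of the points of Omega right of m where v = 0 *)
have [m [m0 ms ml ml2]] : exists m, [/\ 0 < m, m < s, s - 2 * l < m & s < 2 * m + 2 * l - s].
  have [sl|ls] := leP s l; first by exists (s / 2); split; lra.
  by exists (s - l / 2); split; lra.
have sm0 : 0 < s - m by rewrite subr_gt0.
have [_ [x0 Ox0 <-]] := sup_adherent sm0 hsS; rewrite -sE subKr => mx0.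
have gv : gap_nonneg m v.
  apply: filterS v_supp => x vx mx; rewrite /reflection_gap vx ?subr0//.
  exact: lt_trans mx.
have [/gap_zero_ae vsym|vN] := pselect {ae mu, forall x, m < x ord0 ord0 -> reflection_gap m v x = 0}.
  have v_ae : {ae mu, forall x, v x = 0}.
    apply: filterS3 vsym v_supp (ae_isometry (isometry_refl m) v_supp) => x vx vsx vsr.
    have [sx|xs] := ltP (s - 2 * l) (x ord0 ord0); first exact: vsx.
    rewrite -vx; apply: vsr; rewrite reflE eqxx.
    by lra.
  by apply: filterS (ae_isometry (isometry_refl 0) v_ae) => x; rewrite /v/= reflK.
have [c c0 [d d0 cP]] := strong_maximum_principle jG OD L0 av m0 gv vN Ox0 mx0.
have x0s := leS _ Ox0.
exfalso; pose d' := Num.min d (Num.min (x0 ord0 ord0 - m) (2 * m + 2 * l - s - x0 ord0 ord0)).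
have d'0 : 0 < d'.
  by rewrite !lt_min d0 !subr_gt0 mx0 (le_lt_trans x0s).
have [d1 d2 d3] : [/\ d' <= d, d' <= x0 ord0 ord0 - m &
    d' <= 2 * m + 2 * l - s - x0 ord0 ord0] by rewrite /d' !ge_min !lexx !orbT.
apply: (neighborhood_nonnull (x := x0)
  (P := fun y => forall i, `|y ord0 i - x0 ord0 i| < d') d'0) => //.
apply: filterS3 cP v_supp (ae_isometry (isometry_refl m) v_supp) => y cy vsy vsr yd.
have := cy (fun i => lt_le_trans (yd i) d1); rewrite /reflection_gap vsy ?vsr ?subrr.
- by rewrite leNgt c0.
- have := yd ord0; rewrite ltr_norml reflE eqxx => /andP[_] ?; lra.
- have := yd ord0; rewrite ltr_norml => /andP[? _]; lra.
Qed.

(** Otherwise the supremum of the bad positive l would be a positive limit of good ones, hence good, and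
    by openness it could not be a limit of bad ones. *)
Lemma gap_nonneg_pos u l : admissible j Omega L u -> ~ {ae mu, forall x, u x = 0} -> 0 < l ->
  gap_nonneg l u.
Proof.
move=> au uN l0; apply: contrapT => lN; have [[eu u0 _ uO] _] := au.
have [oO [N ON] OS] := OD.
pose A := [set m : R | 0 < m /\ ~ gap_nonneg m u].
have ubA : has_ubound A.
  exists N%:R => m [m0 mN]; rewrite leNgt; apply/negP => Nm; apply: mN.
  apply: nearW => x mx; rewrite /reflection_gap (uO x) ?subr0//.
  move=> /ON/cubeP/(_ ord0); apply/negP; rewrite -ltNge.
  by rewrite (lt_le_trans (lt_trans Nm mx))// ler_norm.
have hsA : has_sup A by split => //; exists l.
pose s := sup A.
have leA m : A m -> m <= s by exact: ub_le_sup.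
have ls : l <= s by exact: leA.
have s0 : 0 < s by exact: lt_le_trans ls.
have gtA m : s < m -> gap_nonneg m u.
  move=> sm; apply: contrapT => mN; move: (sm); rewrite ltNge leA//; split=> //.
  exact: lt_trans sm.
have gs : gap_nonneg s u.
  apply: gap_nonneg_closed eu.1 _ => d d0; exists (s + d / 2).
    by rewrite addrAC subrr add0r gtr0_norm ?divr_gt0// ltr_pdivrMr// ltr_pMr// ltr1n.
  by apply: gtA; rewrite ltrDl divr_gt0.
have [d d0 dP] := gap_nonneg_open jG OD L0 au s0 gs (fun H => uN (gap_zero_trivial au s0 H)).
have [m Am] := sup_adherent d0 hsA; rewrite -/s => sm; apply: Am.2; apply: dP; first exact: Am.1.
have := leA _ Am; rewrite distrC => ms; rewrite ger0_norm ?subr_ge0//.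
by rewrite ltrBlDr -ltrBlDl.
Qed.

Lemma gap_nonneg0 u : admissible j Omega L u -> ~ {ae mu, forall x, u x = 0} -> gap_nonneg 0 u.
Proof.
move=> au uN; have [[eu _ _ _] _] := au.
apply: gap_nonneg_closed eu.1 _ => d d0; exists (d / 2).
  by rewrite subr0 gtr0_norm ?divr_gt0// ltr_pdivrMr// ltr_pMr// ltr1n.
by apply: gap_nonneg_pos => //; rewrite divr_gt0.
Qed.

Lemma refl0_nonzero u : ~ {ae mu, forall x, u x = 0} -> ~ {ae mu, forall x, (u \o refl 0) x = 0}.
Proof.
move=> uN H; apply: uN; apply: filterS (ae_isometry (isometry_refl 0) H) => x.
by rewrite /= reflK.
Qed.

(** The gaps of u and of its mirror image at l = 0 are opposite to each other and both are nonnegative. *)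
Theorem admissible_symmetric u : admissible j Omega L u -> {ae mu, forall x, u (refl 0 x) = u x}.
Proof.
move=> au; have [uz|uN] := pselect {ae mu, forall x, u x = 0}.
  apply: filterS2 uz (ae_isometry (isometry_refl 0) uz) => x ux urx.
  by rewrite ux urx.
have w0 := gap_nonneg0 au uN.
have v0 := gap_nonneg0 (admissible_refl0 jG OD au) (refl0_nonzero uN).
apply: gap_zero_ae; apply: filterS2 w0 v0 => x wx vx x0; apply/eqP.
rewrite eq_le wx// andbT; have := vx x0; rewrite /reflection_gap/= reflK.
by rewrite subr_le0 subr_ge0.
Qed.

(** For l < 0 apply the case l > 0 to the mirror image. *)
Theorem admissible_decreasing u l x0 : admissible j Omega L u ->
  ~ {ae mu, forall x, u x = 0} -> Omega x0 -> l != 0 -> 1 < x0 ord0 ord0 / l ->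
  exists2 c : R, 0 < c & exists2 d : R, 0 < d &
    {ae mu, forall y, (forall i, `|y ord0 i - x0 ord0 i| < d) -> c <= reflection_gap l u y}.
Proof.
move=> + uN Ox lN0 + ; wlog l0 : u l x0 uN Ox lN0 / 0 < l.
  move=> H au lx; have [l0|l0] := ltP 0 l; first exact: H.
  have l'0 : 0 < - l by rewrite oppr_gt0 lt_neqAle lN0.
  have [||||||c c0 [d d0 dP]] := H (u \o refl 0) (- l) (refl 0 x0).
  - exact: refl0_nonzero.
  - exact: Omega_refl0.
  - by rewrite oppr_eq0.
  - exact: l'0.
  - exact: admissible_refl0.
  - by rewrite reflE eqxx mulr0 sub0r invrN mulrNN.
  exists c => //; exists d => //.
  apply: filterS (ae_isometry (isometry_refl 0) dP) => y /= dy yd.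
  have : c <= reflection_gap (- l) (u \o refl 0) (refl 0 y).
    apply: dy => i; rewrite !reflE; case: eqP => [_|_]; last exact: yd.
    by rewrite !mulr0 !sub0r -opprD normrN; exact: yd.
  by rewrite /reflection_gap /= reflK refl_refl0 opprK reflK.
move=> au; rewrite ltr_pdivlMr// mul1r => lx.
apply: (strong_maximum_principle jG OD L0 au l0 _ _ Ox lx); first exact: gap_nonneg_pos.
by move=> H; apply: uN; exact: gap_zero_trivial H.
Qed.

(** A point of Omega is the reflection of a point of Omega farther from the
    hyperplane x_1 = 0, and u is nonnegative there. *)
Theorem admissible_positive u x0 : admissible j Omega L u ->
  ~ {ae mu, forall x, u x = 0} -> Omega x0 ->
  exists2 c : R, 0 < c & exists2 d : R, 0 < d &
    {ae mu, forall y, (forall i, `|y ord0 i - x0 ord0 i| < d) -> c <= u y}.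
Proof.
move=> au uN Ox0; have [oO _ OS] := OD; have [[_ u0 _ _] _] := au.
have [a aE] : exists a, a = `|x0 ord0 ord0| by exists `|x0 ord0 ord0|.
have OY : Omega (set_coord x0 ord0 a) by apply: OS => //; rewrite aE normr_id.
have /nbhs_rVP[d d0 dP] : nbhs (set_coord x0 ord0 a) Omega by exact: open_nbhs_nbhs.
have d20 : 0 < d / 2 by rewrite divr_gt0.
pose t := a + d / 2; pose x := set_coord x0 ord0 t.
have Ox : Omega x.
  apply: dP => i; rewrite !set_coordE; case: eqP => [_|_]; last by rewrite subrr normr0.
  by rewrite /t addrAC subrr add0r gtr0_norm// ltr_pdivrMr// ltr_pMr// ltr1n.
have xt : x ord0 ord0 = t by rewrite set_coordE eqxx.
pose l := (t + x0 ord0 ord0) / 2.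
have /andP[ax xa] : - a <= x0 ord0 ord0 <= a by rewrite -ler_norml aE.
have [l0 lt] : 0 < l /\ l < t.
  by rewrite /l /t; split; lra.
have rx : refl l x = x0.
  apply/rowP => i; rewrite reflE xt; case: eqP => [->|/eqP/negbTE i0]; first by rewrite /l; lra.
  by rewrite set_coordE i0.
have lx : 1 < x ord0 ord0 / l by rewrite xt ltr_pdivlMr// mul1r.
have [c c0 [e e0 eP]] := admissible_decreasing au uN Ox (lt0r_neq0 l0) lx.
exists c => //; exists e => //.
apply: filterS (ae_isometry (isometry_refl l) eP) => y /= ey yd.
have : c <= reflection_gap l u (refl l y).
  apply: ey => i; rewrite -(reflK l x) rx !reflE; case: eqP => [_|_]; last exact: yd.
  rewrite (_ : _ - _ - _ = - (y ord0 ord0 - x0 ord0 ord0)); last by ring.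
  by rewrite normrN; exact: yd.
by rewrite /reflection_gap reflK => /le_trans; apply; rewrite gerBl.
Qed.

End conclusion.

(** * Compact sets and the weak formulation *)

Section compact_sets.
Context (R : realType) (n : nat).
Local Notation V := 'rV[R]_n.+1.
Local Notation mu := (@leb R n).
Implicit Types (x y z : V) (g : V -> R).

Lemma condD_symmetric_domain (Omega : set V) : condD Omega -> symmetric_domain Omega.
Proof.
move=> [oO bO sO]; split => //.
  have [M M0 OM] := pinfty_ex_gt0 bO.
  exists (Num.trunc (M + 1)).+1 => x Ox; apply/cubeP => i.
  have : ball (0 : V) (M + 1) x.
    by rewrite -ball_normE /ball_/= sub0r normrN (le_lt_trans (OM _ Ox))// ltrDl.
  move=> [_ /(_ ord0 i)]; rewrite -ball_normE /ball_/= mxE sub0r normrN => xi.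
  by rewrite ltW// (lt_trans xi)// truncnS_gt.
move=> x t Ox tx.
have [x0|x0] := eqVneq (x ord0 ord0) 0.
  move: tx; rewrite x0 normr0 normr_le0 => /eqP ->.
  by rewrite (_ : set_coord _ _ _ = x)//; apply/rowP => i; rewrite set_coordE;
    case: eqP => [->|].
have := sO x (t / x ord0 ord0) Ox; rewrite pt_set_coord /fst_coord divfK//; apply.
by rewrite -ler_norml normrM normfV ler_pdivrMr ?normr_gt0// mul1r.
Qed.

(** By compactness one radius e serves as radius and as lower bound for all points of K. *)
Lemma compact_ess_inf_gt0 (K : set V) g : compact K ->
  (forall x, K x -> exists2 c : R, 0 < c & exists2 d : R, 0 < d &
    {ae mu, forall y, (forall i, `|y ord0 i - x ord0 i| < d) -> c <= g y}) ->
  (0 < ess_inf_on K g)%E.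
Proof.
move=> /compact_near_coveringP cK Kg.
pose P (e : R) x := {ae mu, forall y, (forall i, `|y ord0 i - x ord0 i| < e) -> e <= g y}.
have : \forall e \near 0^'+, K `<=` P e.
  apply: cK => x /Kg[c c0 [d d0 cP]].
  have d20 : 0 < d / 2 by rewrite divr_gt0.
  have H : \forall x' \near x & e \near (0 : R)^'+,
      (forall i, `|(x' : V) ord0 i - x ord0 i| < d / 2) /\ e < Num.min c (d / 2).
    exists ([set x' : V | forall i, `|x' ord0 i - x ord0 i| < d / 2], [set e | e < Num.min c (d / 2)]) => /=.
      split; first by apply/nbhs_rVP; exists (d / 2).
      by apply: nbhs_right_lt; rewrite lt_min c0.
    by move=> [x' e] [/= h1 h2].
  apply: filterS H => -[x' e] [/= xx']; rewrite lt_min => /andP[ec ed].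
  apply: filterS cP => y cy ye; rewrite (le_trans (ltW ec))// cy// => i.
  have -> : y ord0 i - x ord0 i = (y ord0 i - x' ord0 i) + (x' ord0 i - x ord0 i) by ring.
  rewrite (le_lt_trans (ler_normD _ _))// (splitr d) ltrD//; exact: lt_trans ed.
move=> H; have [e e0 eP] : exists2 e : R, 0 < e & K `<=` P e.
  near (0 : R)^'+ => e; exists e; first by near: e; exact: nbhs_right_gt.
  by near: e.
have Kae : {ae mu, forall y, K y -> e <= g y}.
  have K0 : mu (K `&` [set y : V | ~ e <= g y]) = 0%E.
    apply: locally_null_leb => x /eP/aeP xP; exists e => //.
    apply/eqP; rewrite eq_le leb_ge0 andbT -xP; apply: le_leb => y [/= ey yx] /(_ yx).
    exact: ey.
  apply/aeP; rewrite -[RHS]K0; congr (mu _); apply/seteqP; split=> y /=.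
    by move=> nK; split; [apply: contrapT => nKy; apply: nK|move=> ey; apply: nK].
  by move=> [Ky ny] /(_ Ky).
apply: (@lt_le_trans _ _ e%:E); first by rewrite lte_fin.
rewrite /ess_inf_on ess_infEae; apply: ereal_sup_ubound => /=.
apply: filterS Kae => y yK; case: ifPn => [/set_mem/yK|_]; first by rewrite lee_fin.
exact: leey.
Unshelve. all: by end_near. Qed.

End compact_sets.

Section transfer.
Context (R : realType) (n : nat).
Local Notation V := 'rV[R]_n.+1.
Local Notation T := (lebRN R n).
Local Notation mu := (@leb R n).
Implicit Types (x y z : V) (u v w phi : V -> R).

Context (J j : V -> R) (jG : good_kernel j).
Hypothesis (mJ : measurable_fun [set: T] (J : T -> R)).
Hypothesis (jJ : {ae mu, forall z, j z = J z}).

(** The null set where the two kernels differ depends on y, but only through a translation. *)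
Lemma bilin_iterated u v : measurable_fun [set: T] (u : T -> R) ->
  measurable_fun [set: T] (v : T -> R) ->
  bilin J u v = ((2^-1)%:E * \int[mu]_y fubini_G mu (EFin \o energy_density j u v) y)%E.
Proof.
move=> mu_ mv; congr (_ * _)%E; apply: eq_integral => y _; rewrite /fubini_G.
apply: ae_eq_integral.
- exact: measurableT.
- apply/measurable_EFinP; apply: measurable_funM.
    by apply: measurable_funM; apply: measurable_funB => //; exact: measurable_cst.
  exact: (measurableT_comp mJ (leb_measurable_isometry (isometry_sub y))).
- apply/measurable_EFinP; have := measurable_energy_density jG mu_ mv.
  by move=> H; apply: (measurableT_comp H); exact: measurable_fun_pair.
apply: filterS (ae_isometry (isometry_sub y) jJ) => x jx _ /=.
by rewrite /energy_density /kern/= jx.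
Qed.

Lemma bilin_energy_form u v : finite_energy j u -> finite_energy j v ->
  bilin J u v = (2^-1 * energy_form j u v)%:E.
Proof.
move=> eu ev; have iE := integrable_energy_density jG eu ev.
rewrite (bilin_iterated eu.1 ev.1) (integral21_prod_meas1 iE) EFinM; congr (_ * _)%E.
by rewrite /energy_form /Rintegral fineK//; exact: integrable_fin_num.
Qed.

Lemma bilin_finite_energy u : measurable_fun [set: T] (u : T -> R) ->
  (bilin J u u < +oo)%E -> finite_energy j u.
Proof.
move=> mu_ uoo; split=> //.
have mE : measurable_fun setT (EFin \o energy_density j u u).
  by apply/measurable_EFinP; exact: measurable_energy_density.
have E0 (p : T * T) : (0 <= (EFin \o energy_density j u u) p)%E.
  by rewrite lee_fin energy_density_ge0.
apply/integrableP; split=> //; rewrite (eq_integral (EFin \o energy_density j u u)); last first.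
  by move=> p _; rewrite gee0_abs.
rewrite (fubini_tonelli2 _ mE E0).
have : (2%:E * bilin J u u < +oo)%E by rewrite lte_mul_pinfty.
by rewrite (bilin_iterated mu_ mu_) muleA -EFinM divff// mul1e.
Qed.

End transfer.

Section solutions.
Context (R : realType) (n : nat).
Local Notation V := 'rV[R]_n.+1.
Local Notation T := (lebRN R n).
Local Notation mu := (@leb R n).
Implicit Types (x y z : V) (u v w phi : V -> R) (f : V -> R -> R) (Omega : set V).

Lemma Linfty_bounded Omega u : mu [set: V] != 0%E -> Linfty Omega u ->
  exists2 C : R, 0 <= C & {ae mu, forall x, `|u x| <= C}.
Proof.
move=> V0 [+ _]; rewrite inE => /andP[_]; rewrite inE /= /finite_norm unlock /Lnorm.
have -> : (0 < mu [set: T])%E by rewrite lt0e V0 leb_ge0.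
rewrite ess_supEae => /ereal_inf_lt[c /= cP coo].
exists (Num.max 0 (fine c)); first by rewrite le_max lexx.
apply: filterS cP => x; rewrite le_max => H; apply/orP; right.
move: c H coo => [r||]//=.
Qed.

(** Bounds and signs that hold almost everywhere are made to hold everywhere. *)
Lemma clamp_version Omega u (C : R) : measurable (Omega : set T) ->
  measurable_fun [set: T] (u : T -> R) -> 0 <= C -> {ae mu, forall x, 0 <= u x} ->
  {ae mu, forall x, `|u x| <= C} -> {ae mu, forall x, ~ Omega x -> u x = 0} ->
  exists u', [/\ measurable_fun [set: T] (u' : T -> R), {ae mu, forall x, u x = u' x},
    forall x, 0 <= u' x <= C & forall x, ~ Omega x -> u' x = 0].
Proof.
move=> mO mu_ C0 u0 uC uO; exists (fun x => \1_Omega x * Num.max 0 (Num.min (u x) C)); split.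
- apply: measurable_funM; first exact: measurable_indic.
  apply: measurable_maxr; first exact: measurable_cst.
  by apply: measurable_minr => //; exact: measurable_cst.
- apply: filterS3 u0 uC uO => x x0 xC xO; rewrite indicE.
  have [Ox|nO] := boolP (x \in Omega); last first.
    by rewrite mul0r xO// => Ox; move/negP: nO; apply; rewrite inE.
  rewrite mul1r min_l; last by rewrite (le_trans (ler_norm _)).
  by rewrite max_r.
- move=> x; rewrite indicE; case: (x \in Omega); last by rewrite mul0r lexx C0.
  by rewrite mul1r le_max lexx/= ge_max C0/= ge_min lexx orbT.
- by move=> x nO; rewrite indicE memNset ?mul0r.
Qed.

(** For x in Omega with x_1 / l > 1 the first coordinate of refl l x is s x_1 with |s| <= 1, so that
    f (refl l x) a >= f x a by (F2); the Lipschitz bound (F1), on the range of u, compares the two values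
    of u at the same point x. *)
Lemma solution_admissible (J j : V -> R) Omega f u : good_kernel j ->
  measurable_fun [set: T] (J : T -> R) -> {ae mu, forall z, j z = J z} ->
  condD Omega -> F1 Omega f -> F2 Omega f -> Linfty Omega u ->
  {ae mu, forall x, 0 <= u x} -> solution J Omega f u ->
  exists L u', [/\ 0 <= L, {ae mu, forall x, u x = u' x} & admissible j Omega L u'].
Proof.
move=> jG mJ jJ OD [_ fL] f2 ub u0 [[mu_ uJ uO] usol].
have SD := condD_symmetric_domain OD; have [oO _ OS] := SD.
have mO := open_leb_measurable oO.
have V0 : mu [set: V] != 0%E.
  apply/eqP => V0; apply: (neighborhood_nonnull jG (x := 0) (P := fun=> True) ltr01) => //.
  apply/aeP; rewrite -[RHS]V0; congr (mu _).
  by apply/seteqP; split=> y //= _; apply.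
have [C C0 uC] := Linfty_bounded V0 ub.
have [u' [mu' uu' u'C u'O]] := clamp_version mO mu_ C0 u0 uC uO.
have bK : bounded_set [set t : R | 0 <= t <= C].
  by exists C; split; [exact: num_real|move=> M CM t /= /andP[t0 tC];
    rewrite ger0_norm// (le_trans tC)// ltW].
have [L L0 LP] := fL _ bK.
have eu : finite_energy j u by exact: bilin_finite_energy uJ.
exists L, u'; split => //; first exact: ltW.
split; first split.
- exact: ae_eq_finite_energy uu' eu.
- by move=> x; case/andP: (u'C x).
- by exists C => x; case/andP: (u'C x).
- exact: u'O.
(* the original u may be kept here, as it is equal to u' almost everywhere *)
exists (fun x => f x (u x)).
  move=> phi ephi pO.
  have pS : energy_space J Omega phi.
    split; first exact: ephi.1.
      by rewrite (bilin_energy_form jG mJ jJ ephi ephi) ltry.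
    exact: nearW.
  have [ib eb] := usol _ pS; split=> //.
  rewrite -(ae_eq_energy_form jG mu_ mu' ephi.1 uu').
  by rewrite /Rintegral -eb (bilin_energy_form jG mJ jJ eu ephi).
move=> l l0; apply: filterS2 uu' (ae_isometry (isometry_refl l) uu') => x ux urx Ox lx.
have f2x a : f x a <= f (refl l x) a.
  have x0 : x ord0 ord0 != 0.
    by apply: contraTneq lx => ->; rewrite mul0r -leNgt ler01.
  have := f2 a x ((2 * l - x ord0 ord0) / x ord0 ord0) Ox.
  rewrite refl_pt /fst_coord divfK//; apply.
  have [r r0 xr] : exists2 r, 1 < r & x ord0 ord0 = r * l.
    by exists (x ord0 ord0 / l); rewrite ?divfK.
  have rN : r != 0 by rewrite gt_eqF// (lt_trans ltr01).
  have -> : (2 * l - x ord0 ord0) / x ord0 ord0 = 2 / r - 1 by rewrite xr; field; rewrite rN.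
  have r20 : 0 <= 2 / r by rewrite divr_ge0// ltW// (lt_trans ltr01).
  have r22 : 2 / r <= 2.
    by rewrite ler_pdivrMr ?(lt_trans ltr01)// ler_peMr// ltW.
  by apply/andP; split; move: r20 r22; clear; move: (2 / r) => t; lra.
have fLx : `|f x (u' (refl l x)) - f x (u' x)| <= L * `|u' (refl l x) - u' x|.
  rewrite -lee_fin; apply: le_trans (LP _ _ (u'C _) (u'C _)).
  by apply: ereal_sup_ubound; exists x.
rewrite urx ux /reflection_gap mulNr; apply: (@le_trans _ _ (f x (u' (refl l x)) - f x (u' x))).
  by move: fLx; rewrite ler_norml => /andP[].
by rewrite lerB.
Qed.

End solutions.

Theorem theorem1p1 (R : realType) (n : nat)
    (J : 'rV[R]_n.+1 -> R) (Omega : set 'rV[R]_n.+1) (f : 'rV[R]_n.+1 -> R -> R)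
    (J_measurable : measurable_fun ([set~ (0 : 'rV[R]_n.+1)] : set (lebRN R n)) J)
    (J_ge0 : forall z : 'rV[R]_n.+1, z != 0 -> 0 <= J z)
    (J_even : forall z : 'rV[R]_n.+1, z != 0 -> J (- z) = J z)
    (J_J1 : J1 J) (J_J2 : J2 J)
    (Omega_D : condD Omega)
    (f_F1 : F1 Omega f) (f_F2 : F2 Omega f)
    (u : 'rV[R]_n.+1 -> R)
    (u_Linfty : Linfty Omega u) (u_energy : energy_space J Omega u)
    (u_ge0 : {ae leb, forall x, 0 <= u x})
    (u_sol : solution J Omega f u) :
  symmetric_x1 Omega u /\
  ({ae leb, forall x, u x = 0} \/
   (strictly_decreasing_x1 Omega u /\
    forall K : set 'rV[R]_n.+1, compact K -> K `<=` Omega -> (0 < ess_inf_on K u)%E)).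
Proof.
have mJ := measurable_fun_punctured J_measurable.
have [j jG jJ] := good_kernel_exists J_measurable J_ge0 J_even J_J1 J_J2.
have [L [u' [L0 uu' au]]] :=
  solution_admissible jG mJ jJ Omega_D f_F1 f_F2 u_Linfty u_ge0 u_sol.
have OD := condD_symmetric_domain Omega_D.
split.
  have su := admissible_symmetric jG OD L0 au.
  apply: filterS3 uu' (ae_isometry (isometry_refl 0) uu') su => x ux urx sx _.
  by rewrite -refl0_pt urx ux.
have [uz|uN] := pselect {ae leb, forall x, u' x = 0}.
  by left; apply: filterS2 uu' uz => x -> ->.
right; split=> [l K l0 cK KO|K cK KO]; apply: compact_ess_inf_gt0 => // x Kx.
  have [Ox lx] := KO _ Kx.
  have [c c0 [d d0 cP]] := admissible_decreasing jG OD L0 au uN Ox l0 lx.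
  exists c => //; exists d => //.
  apply: filterS3 uu' (ae_isometry (isometry_refl l) uu') cP => y uy ury cy yd.
  by rewrite -refl_pt ury uy; exact: cy.
have [c c0 [d d0 cP]] := admissible_positive jG OD L0 au uN (KO _ Kx).
exists c => //; exists d => //.
by apply: filterS2 uu' cP => y uy cy yd; rewrite uy; exact: cy.
Qed.
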